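(* Let $K$ be the kernel of $U_{5}+I$ acting on the space $M(\mathit{odd})$ of odd mod 2 modular forms of level $\Gamma_{0}(5)$. Then there are $m_{i,j}$ in $K$ ($i,j\ge 0$) such that: (a) $m_{0,0}=r^{2}+r=F+G$. (b) $T_{3}(m_{i,j})=m_{i-1,j}$ or $0$ according as $i>0$ or $i=0$. (c) $T_{7}(m_{i,j})=m_{i,j-1}$ or $0$ according as $j>0$ or $j=0$. (d) The $m_{i,j}$ are a $\mathbb{Z}/2$-basis of $K$.
   Context: Let $r=\sum_{n>0}(x^{n^{2}}+x^{2n^{2}}+x^{5n^{2}}+x^{10n^{2}})\in \mathbb{Z}/2[[x]]$. The space $M$ of mod 2 modular forms of level $\Gamma_{0}(5)$ is the subspace $\mathbb{Z}/2[r]$ of $\mathbb{Z}/2[[x]]$, and $M(\mathit{odd})$ is the subspace of odd power series in $M$; it is the span of the $(r^{2}+r)r^{2n}$, $n\ge 0$. $F=r(r+1)^{5}=\sum_{n \text{ odd},\,n>0}x^{n^{2}}$ and $G=r^{5}(r+1)=\sum_{n\text{ odd},\,n>0}x^{5n^{2}}$ (the mod 2 reductions of the expansions at infinity of $\Delta(z)$ and $\Delta(5z)$). $U_{5}:\mathbb{Z}/2[[x]]\to\mathbb{Z}/2[[x]]$ takes $\sum c_{n}x^{n}$ to $\sum c_{5n}x^{n}$; it stabilizes $M(\mathit{odd})$. $I$ is the identity map. For a prime $p\ne 2,5$, the formal Hecke operator $T_{p}:\mathbb{Z}/2[[x]]\to\mathbb{Z}/2[[x]]$ takes $\sum c_{n}x^{n}$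 to $\sum c_{pn}x^{n}+\sum c_{n}x^{pn}$. The $T_{p}$ commute with each other and with $U_{5}$ and stabilize $M(\mathit{odd})$, hence stabilize $K$. *)

(* Defs.v *)
From HB Require Import structures.
From mathcomp Require Import all_boot all_order all_algebra.
From mathcomp Require Import boolp classical_sets.

Set Implicit Arguments.
Unset Strict Implicit.
Unset Printing Implicit Defensive.

Import GRing.Theory.
Local Open Scope classical_set_scope.
Local Open Scope ring_scope.

(* A record rather than an alias of [nat -> R], so that no pointwise product
   of functions can be picked up in place of the Cauchy product. *)
Record fps (R : Type) := Fps { fcoef : nat -> R }.

HB.instance Definition _ (R : Type) := gen_eqMixin (fps R).
HB.instance Definition _ (R : Type) := gen_choiceMixin (fps R).

Lemma fps_eqP (R : Type) (f g : fps R) : fcoef f =1 fcoef g -> f = g.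
Proof. by case: f g => [a] [b] /= /funext ->. Qed.

Section FpsRing.
Variable R : comNzRingType.
Implicit Types f g h : fps R.

Definition fps_zero : fps R := Fps (fun=> 0).
Definition fps_one : fps R := Fps (fun n => (n == 0%N)%:R).
Definition fps_opp f : fps R := Fps (fun n => - fcoef f n).
Definition fps_add f g : fps R := Fps (fun n => fcoef f n + fcoef g n).
Definition fps_scale (a : R) f : fps R := Fps (fun n => a * fcoef f n).
Definition fps_mul f g : fps R :=
  Fps (fun n => \sum_(i < n.+1) fcoef f i * fcoef g (n - i)%N).

Fact fps_addA : associative fps_add.
Proof. by move=> f g h; apply: fps_eqP => n /=; rewrite addrA. Qed.
Fact fps_addC : commutative fps_add.
Proof. by move=> f g; apply: fps_eqP => n /=; rewrite addrC. Qed.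
Fact fps_add0 : left_id fps_zero fps_add.
Proof. by move=> f; apply: fps_eqP => n /=; rewrite add0r. Qed.
Fact fps_addN : left_inverse fps_zero fps_opp fps_add.
Proof. by move=> f; apply: fps_eqP => n /=; rewrite addNr. Qed.

HB.instance Definition _ :=
  GRing.isZmodule.Build (fps R) fps_addA fps_addC fps_add0 fps_addN.

Let trunc n f : {poly R} := \poly_(i < n) fcoef f i.

Let coef_mul_trunc n k f g : (k < n)%N ->
  fcoef (fps_mul f g) k = (trunc n f * trunc n g)`_k.
Proof.
move=> lt_kn; rewrite coefM; apply: eq_bigr => i _.
by rewrite !coef_poly (leq_ltn_trans _ lt_kn) ?leq_ord //
           (leq_ltn_trans (leq_subr _ _) lt_kn).
Qed.

Fact fps_mulC : commutative fps_mul.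
Proof.
by move=> f g; apply: fps_eqP => n; rewrite !(@coef_mul_trunc n.+1) // mulrC.
Qed.

Let coef_mul_low n k (p q p' : {poly R}) : (k < n)%N ->
  (forall i, (i < n)%N -> p`_i = p'`_i) -> (p * q)`_k = (p' * q)`_k.
Proof.
move=> lt_kn eq_p; rewrite !coefM; apply: eq_bigr => i _.
by rewrite eq_p // (leq_ltn_trans _ lt_kn) // leq_ord.
Qed.

Let coef_mul3 n f g h : fcoef (fps_mul (fps_mul f g) h) n =
  (trunc n.+1 f * trunc n.+1 g * trunc n.+1 h)`_n.
Proof.
rewrite (@coef_mul_trunc n.+1) //; apply: (@coef_mul_low n.+1) => // i lt_in.
by rewrite coef_poly lt_in (@coef_mul_trunc n.+1).
Qed.

Fact fps_mulA : associative fps_mul.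
Proof.
move=> f g h; apply: fps_eqP => n.
by rewrite fps_mulC !coef_mul3 mulrC mulrA.
Qed.
Fact fps_mul1 : left_id fps_one fps_mul.
Proof.
move=> f; apply: fps_eqP => n /=.
rewrite big_ord_recl /= mul1r subn0 big1 ?addr0 // => i _.
by rewrite mul0r.
Qed.
Fact fps_mulDl : left_distributive fps_mul fps_add.
Proof.
move=> f g h; apply: fps_eqP => n /=; rewrite -big_split /=.
by apply: eq_bigr => i _; rewrite mulrDl.
Qed.
Fact fps_one_neq0 : fps_one != 0 :> fps R.
Proof.
apply/eqP => /(congr1 (fun f => fcoef f 0)) /= /eqP.
by rewrite oner_eq0.
Qed.

HB.instance Definition _ := GRing.Zmodule_isComNzRing.Build (fps R)
  fps_mulA fps_mulC fps_mul1 fps_mulDl fps_one_neq0.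

Fact fps_scaleA a b f : fps_scale a (fps_scale b f) = fps_scale (a * b) f.
Proof. by apply: fps_eqP => n /=; rewrite mulrA. Qed.
Fact fps_scale1 : left_id 1 fps_scale.
Proof. by move=> f; apply: fps_eqP => n /=; rewrite mul1r. Qed.
Fact fps_scaleDr : right_distributive fps_scale +%R.
Proof. by move=> a f g; apply: fps_eqP => n /=; rewrite mulrDr. Qed.
Fact fps_scaleDl f : {morph fps_scale^~ f : a b / a + b}.
Proof. by move=> a b; apply: fps_eqP => n /=; rewrite mulrDl. Qed.

HB.instance Definition _ := GRing.Zmodule_isLmodule.Build R (fps R)
  fps_scaleA fps_scale1 fps_scaleDr fps_scaleDl.

Fact fps_scaleAl (a : R) (f g : fps R) : a *: (f * g) = (a *: f) * g.
Proof.
apply: fps_eqP => n /=; rewrite big_distrr /=.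
by apply: eq_bigr => i _; rewrite mulrA.
Qed.

HB.instance Definition _ := GRing.Lmodule_isLalgebra.Build R (fps R) fps_scaleAl.
HB.instance Definition _ := GRing.Lalgebra_isComAlgebra.Build R (fps R).

(* The sum of x^(a n^2) over the n > 0 satisfying P. For a > 0, only the
   n <= k can contribute to the coefficient of x^k. *)
Definition theta (P : pred nat) (a : nat) : fps R :=
  Fps (fun k => \sum_(1 <= n < k.+1 | P n) ((a * n ^ 2)%N == k)%:R).

Definition hecke_U (p : nat) f : fps R := Fps (fun n => fcoef f (p * n)%N).

Definition hecke_T (p : nat) f : fps R :=
  Fps (fun n => fcoef f (p * n)%N + (if (p %| n)%N then fcoef f (n %/ p) else 0)).

Definition odd_fps : set (fps R) := [set f | forall n, ~~ odd n -> fcoef f n = 0].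

End FpsRing.

Arguments theta {R} P a.

(* A doubly indexed family is a basis of the subspace S. Every finite linear
   combination of the family is supported on some square [0, N) x [0, N). *)
Definition is_basis2 (R : nzRingType) (V : lmodType R) (S : set V)
    (m : nat -> nat -> V) : Prop :=
  [/\ forall i j, S (m i j),
      forall (N : nat) (c : nat -> nat -> R),
        \sum_(i < N) \sum_(j < N) c i j *: m i j = 0 ->
        forall i j, (i < N)%N -> (j < N)%N -> c i j = 0
    & forall v, S v -> exists (N : nat) (c : nat -> nat -> R),
        v = \sum_(i < N) \sum_(j < N) c i j *: m i j].

Definition r : fps 'F_2 :=
  theta predT 1 + theta predT 2 + theta predT 5 + theta predT 10.

Definition F : fps 'F_2 := theta odd 1.
Definition G : fps 'F_2 := theta odd 5.

Definition M : set (fps 'F_2) := range (fun p : {poly 'F_2} => horner_alg r p).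

Definition M_odd : set (fps 'F_2) := M `&` odd_fps (R := 'F_2).

Definition K : set (fps 'F_2) := [set f | M_odd f /\ hecke_U 5 f + f = 0].

(* Main.v *)
(* Put s = F + G = r^2 + r. A mod 2 form f with U5 f = f is an odd polynomial in
   s; conversely the odd polynomials in s fixed by U5 have a basis with degrees
   12 j + c, c in {1, 3, 7, 9}. Keeping only the exponents congruent to 1, 3, 7 or
   9 mod 20 is a projection pr that commutes with T3 and T7, is injective on K, and
   takes K onto the free F_2[u]-module with basis the D_c = pr (s^c), u = G^4.

   The theta identities (F + F(x^3))^4 = F F(x^3) and its analogue for 7, read off
   from the lattices of the forms x^2 + 3 y^2 and x^2 + 7 y^2, make T3 (u^j D_c) and
   T7 (u^j D_c) satisfy recursions in j. By these, T3 and T7 strictly lower the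
   weight of u^j D_c, namely 2 h(j) + w_c with h(j) the digit sum of j in base 4
   (digits counting 0, 1, 1, 2, and place 4^i counting 2^i) and w_c = 0, 1, 1, 2.
   Following leading terms in the recursions shows that T3 and T7 have no common
   kernel on K besides s.

   There are exactly a basis' worth of pairs (a, b) with a + b < n in weight < n, so
   f |-> (coefficient of x in T3^a T7^b f), which is injective on weight < n, is
   bijective there, and the m i j are the dual basis. *)

Require Import Defs.
From Stdlib Require Import Ring Ring_theory BinNat.
From mathcomp Require Import all_boot all_order all_algebra.
From mathcomp Require Import boolp classical_sets functions cardinality fsbigop.
From mathcomp Require Import zify.

Set Implicit Arguments.
Unset Strict Implicit.
Unset Printing Implicit Defensive.

Import Order.TTheory GRing.Theory Num.Theory.
Local Open Scope ring_scope.

(** The relation [F * G = s ^+ 6] governs the algebra: [F] and [G] are the roots of T^2 + s T + s^6,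
    exchanged by r -> r + 1, and U5 (G f) = F U5 f. Hence (U5 + I) s^k is a polynomial in [F]; it
    reaches degree (k - 2)/3 only for k = 5 mod 6, which removes the degrees 5 and 11 mod 12 from K.
    The obstacle is that K is not stable under multiplication by [u]. Only its image under [pr] is:
    [u] has exponents divisible by 20, and modulo the kernel of [pr] every product of [G] with an
    even polynomial in s becomes an odd polynomial in s. As u = F(x^20), [u] inherits the theta
    identities of [F]. Frobenius turns the resulting recursions into ones whose step is any power of
    2, so that the top binary digit of j can be removed at once. The even and odd binary digits of j
    give [E j] and [O j], the Nicolas-Serre code of 2 j + 1. In one coordinate T3 and T7 have the
    same extreme terms; there T3 + T7 has to be used. *)

Notation Ft := (fps 'F_2).

(** * Power series over F_2 *)

Lemma F2_pchar2 : (2 \in [pchar 'F_2])%N.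
Proof. exact: pchar_Fp. Qed.

Lemma fps_pchar2 : (2 \in [pchar Ft])%N.
Proof.
apply/andP; split=> //; apply/eqP; apply: fps_eqP => n.
by rewrite mulr2n /= addrr_pchar2 // F2_pchar2.
Qed.

Lemma faddff (f : Ft) : f + f = 0.
Proof. by rewrite addrr_pchar2 // fps_pchar2. Qed.

Lemma foppE (f : Ft) : - f = f.
Proof. by rewrite oppr_pchar2 // fps_pchar2. Qed.

(** Monomorphic aliases that the reification of [ring] recognises syntactically. The coefficient
    ring is [bool] with [xorb], so that normalisation already knows 2 = 0. *)
Definition fadd (f g : Ft) : Ft := f + g.
Definition fmul (f g : Ft) : Ft := f * g.
Definition fexp (f : Ft) (n : nat) : Ft := f ^+ n.
Definition fzero : Ft := 0.
Definition fone : Ft := 1.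
Definition fid (f : Ft) : Ft := f.

Lemma f_rt : ring_theory fzero fone fadd fmul fadd fid (@eq Ft).
Proof.
split; rewrite /fadd /fmul /fzero /fone /fid.
- exact: add0r. - exact: addrC. - exact: addrA. - exact: mul1r. - exact: mulrC.
- exact: mulrA. - exact: mulrDl. - by []. - exact: faddff.
Qed.

Definition f_of_bool (b : bool) : Ft := if b then fone else fzero.

Lemma f_morph : ring_morph fzero fone fadd fmul fadd fid (@eq Ft)
  false true xorb andb xorb id eqb f_of_bool.
Proof.
split => //=; rewrite /f_of_bool /fadd /fmul /fzero /fone /fid.
- by case; case; rewrite /= ?addr0 ?add0r ?faddff.
- by case; case; rewrite /= ?addr0 ?add0r ?faddff.
- by case; case; rewrite /= ?mulr1 ?mulr0.
- by case; case.
Qed.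

Lemma f_pow : power_theory fone fmul (@eq Ft) N.to_nat fexp.
Proof.
split => r n; rewrite /fexp; case: n => [|p] //=.
elim: p => [p IH|p IH|] /=.
- by rewrite Pnat.Pos2Nat.inj_xI multE -IH /fmul exprS mulnC exprM expr2.
- by rewrite Pnat.Pos2Nat.inj_xO multE -IH /fmul mulnC exprM expr2.
- by rewrite expr1.
Qed.

Ltac f_cst t := match t with fzero => constr:(false) | fone => constr:(true) | _ => constr:(InitialRing.NotConstant) end.
Ltac f_pow_tac t := match isnatcst t with true => constr:(N.of_nat t) | _ => constr:(InitialRing.NotConstant) end.

Add Ring f_ring : f_rt (morphism f_morph, constants [f_cst], power_tac f_pow [f_pow_tac]).

Lemma faddE (f g : Ft) : f + g = fadd f g. Proof. by []. Qed.
Lemma fmulE (f g : Ft) : f * g = fmul f g. Proof. by []. Qed.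
Lemma fexpE (f : Ft) n : f ^+ n = fexp f n. Proof. by []. Qed.
Lemma fzeroE : 0 = fzero. Proof. by []. Qed.
Lemma foneE : 1 = fone. Proof. by []. Qed.

Lemma fadd_eq0 (f g : Ft) : f + g = 0 -> f = g.
Proof. by move=> fg0; rewrite -[f]addr0 -(faddff g) addrA fg0 add0r. Qed.

(* [ring] in characteristic 2: an equation is first turned into f + g = 0. *)
Ltac ring2 := apply: fadd_eq0; rewrite ?foppE ?faddE ?fmulE ?fexpE ?fzeroE ?foneE;
  match goal with |- @eq _ ?a ?b => change (@eq Ft a b) end; ring.

Section Kit.
Variable R : comNzRingType.
Implicit Types f g : fps R.

Lemma fcoefD f g n : fcoef (f + g) n = fcoef f n + fcoef g n.
Proof. by []. Qed.

Lemma fcoef_sum I (s : seq I) (P : pred I) (F : I -> fps R) n :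
  fcoef (\sum_(i <- s | P i) F i) n = \sum_(i <- s | P i) fcoef (F i) n.
Proof. by elim/big_rec2: _ => // i x y _ <-. Qed.

Lemma fcoefZ (a : R) f n : fcoef (a *: f) n = a * fcoef f n.
Proof. by []. Qed.

Lemma fcoefM f g n :
  fcoef (f * g) n = \sum_(i < n.+1) fcoef f i * fcoef g (n - i)%N.
Proof. by []. Qed.

Definition ftrunc n f : {poly R} := \poly_(i < n) fcoef f i.

Lemma coef_ftrunc n f i : (i < n)%N -> (ftrunc n f)`_i = fcoef f i.
Proof. by rewrite coef_poly => ->. Qed.

Lemma fcoefM_ftrunc n f g k : (k < n)%N ->
  fcoef (f * g) k = (ftrunc n f * ftrunc n g)`_k.
Proof.
move=> lt_kn; rewrite coefM; apply: eq_bigr => i _.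
by rewrite !coef_ftrunc // (leq_ltn_trans _ lt_kn) ?leq_subr // -ltnS.
Qed.

Lemma coefM_low n (p q p' q' : {poly R}) k : (k < n)%N ->
  (forall i, (i < n)%N -> p`_i = p'`_i) ->
  (forall i, (i < n)%N -> q`_i = q'`_i) -> (p * q)`_k = (p' * q')`_k.
Proof.
move=> lt_kn pE qE; rewrite !coefM; apply: eq_bigr => i _.
by rewrite pE ?qE // (leq_ltn_trans _ lt_kn) ?leq_subr // -ltnS.
Qed.

(** The substitution x -> x^k, so that T_p = U_p + [dil p]. *)
Definition dil k f : fps R :=
  Fps (fun n => if (k %| n)%N then fcoef f (n %/ k) else 0).

Lemma fcoef_dil k f n :
  fcoef (dil k f) n = if (k %| n)%N then fcoef f (n %/ k) else 0.
Proof. by []. Qed.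

Lemma dilD k f g : dil k (f + g) = dil k f + dil k g.
Proof. by apply: fps_eqP => n /=; case: ifP; rewrite ?addr0. Qed.

Lemma dil0 k : dil k 0 = 0.
Proof. by apply: fps_eqP => n /=; case: ifP. Qed.

Lemma dil1 k : (0 < k)%N -> dil k 1 = 1.
Proof.
move=> k0; apply: fps_eqP => -[|n] /=; first by rewrite dvdn0 div0n.
case: ifP => // /dvdnP [m def_n]; rewrite def_n mulnK //.
by case: m def_n => // m.
Qed.

Lemma dilM k f g : (0 < k)%N -> dil k (f * g) = dil k f * dil k g.
Proof.
move=> k0; apply: fps_eqP => n.
have low h i : (i < n.+1)%N ->
  (ftrunc n.+1 (dil k h))`_i = (ftrunc n.+1 h \Po 'X^k)`_i.
  move=> lt_in; rewrite coef_ftrunc // coef_comp_poly_Xn //= .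
  by case: ifP => // _; rewrite coef_ftrunc // (leq_ltn_trans (leq_div _ _) lt_in).
rewrite [RHS](@fcoefM_ftrunc n.+1) //.
rewrite (@coefM_low n.+1 _ _ _ _ _ _ (low f) (low g)) // -comp_polyM.
rewrite coef_comp_poly_Xn // fcoef_dil; case: ifP => // _.
by rewrite (@fcoefM_ftrunc n.+1) // ltnS leq_div.
Qed.

Lemma dilX k f m : (0 < k)%N -> dil k (f ^+ m) = dil k f ^+ m.
Proof.
move=> k0; elim: m => [|m IH]; first by rewrite !expr0 dil1.
by rewrite !exprS dilM // IH.
Qed.

Lemma dil_dil a b f : (0 < a)%N -> (0 < b)%N -> dil a (dil b f) = dil (a * b) f.
Proof.
move=> a0 b0; apply: fps_eqP => n /=.
case: (boolP (a %| n)%N) => [/dvdnP [m ->]|na]; last first.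
  by case: ifP => // /(dvdn_trans (dvdn_mulr _ (dvdnn a))); rewrite (negbTE na).
by rewrite mulnK // (mulnC a) dvdn_pmul2r // divnMr.
Qed.

Lemma dil_id f : dil 1 f = f.
Proof. by apply: fps_eqP => n /=; rewrite dvd1n divn1. Qed.

Lemma UD p f g : hecke_U p (f + g) = hecke_U p f + hecke_U p g.
Proof. exact: fps_eqP. Qed.

Lemma U0 p : hecke_U p (0 : fps R) = 0.
Proof. exact: fps_eqP. Qed.

Lemma U_dil p f : (0 < p)%N -> hecke_U p (dil p f) = f.
Proof. by move=> p0; apply: fps_eqP => n; rewrite /= dvdn_mulr // mulKn. Qed.

Lemma sum_dvdn (V : nmodType) p n (F : nat -> V) : (0 < p)%N ->
  \sum_(0 <= i < (p * n).+1 | (p %| i)%N) F i = \sum_(0 <= j < n.+1) F (p * j)%N.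
Proof.
move=> p0; elim: n => [|n IH].
  by rewrite muln0 big_mkcond !big_nat1 dvdn0 muln0.
rewrite [RHS]big_nat_recr // -IH (@big_cat_nat _ _ _ (p * n).+1) //=; last first.
  by rewrite ltnS leq_mul.
congr (_ + _); have -> : (p * n.+1 = p * n + p)%N by rewrite mulnS addnC.
rewrite big_mkcond big_nat_recr /=; last by rewrite -addn1 leq_add2l.
rewrite dvdn_addr ?dvdn_mulr // dvdnn big_nat big1 ?add0r // => i /andP [lo hi].
case: ifP => // /dvdnP [m def_i]; move: lo hi.
rewrite {}def_i -mulnSr !(mulnC p) !ltn_pmul2r // ltnS => h1 h2.
by have := leq_trans h1 h2; rewrite ltnn.
Qed.

(** Projection formula: a series in x^p leaves U_p as a scalar, with x^p replaced by x. All Hecke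
    recursions come from it. *)
Lemma U_dilM p f g : (0 < p)%N -> hecke_U p (dil p f * g) = f * hecke_U p g.
Proof.
move=> p0; apply: fps_eqP => n; rewrite [LHS]/= fcoefM.
rewrite -(big_mkord xpredT (fun i => fcoef (dil p f) i * fcoef g (p * n - i)%N)).
rewrite -[RHS](big_mkord xpredT (fun i => fcoef f i * fcoef g (p * (n - i))%N)).
rewrite (bigID (fun i => p %| i)%N) /= [X in _ + X]big1 ?addr0 => [|i /negbTE /= ->]; last by rewrite mul0r.
rewrite sum_dvdn //; apply: eq_bigr => j _.
by rewrite dvdn_mulr // mulKn // mulnBr.
Qed.

Lemma hecke_TE p f : hecke_T p f = hecke_U p f + dil p f.
Proof. exact: fps_eqP. Qed.

Lemma TD p f g : hecke_T p (f + g) = hecke_T p f + hecke_T p g.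
Proof. by rewrite !hecke_TE UD dilD addrACA. Qed.

Lemma T0 p : hecke_T p (0 : fps R) = 0.
Proof. by rewrite hecke_TE U0 dil0 addr0. Qed.

Lemma fcoefM_low f g a b :
  (forall i, (i < a)%N -> fcoef f i = 0) ->
  (forall i, (i < b)%N -> fcoef g i = 0) ->
  forall n, (n <= a + b)%N ->
  fcoef (f * g) n = if n == (a + b)%N then fcoef f a * fcoef g b else 0.
Proof.
move=> f0 g0 n le_n; rewrite fcoefM.
have [def_n|ne_n] := eqVneq n (a + b)%N.
  have lt_an : (a < n.+1)%N by rewrite def_n ltnS leq_addr.
  rewrite (bigD1 (Ordinal lt_an)) //= big1 ?addr0 => [|i ne_i]; first by rewrite def_n addKn.
  have [lt_ia|le_ai] := ltnP i a; first by rewrite f0 ?mul0r.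
  rewrite [fcoef g _]g0 ?mulr0 //.
  by move: ne_i; rewrite -val_eqE /=; have := ltn_ord i; lia.
rewrite big1 // => i _.
have [lt_ia|le_ai] := ltnP i a; first by rewrite f0 ?mul0r.
by rewrite [fcoef g _]g0 ?mulr0 //; have := ltn_ord i; lia.
Qed.

Lemma fps_neq0P f : f <> 0 ->
  exists2 a, fcoef f a != 0 & forall i, (i < a)%N -> fcoef f i = 0.
Proof.
move=> nz_f; have ex : exists n, fcoef f n != 0.
  apply: contrapT => no; apply: nz_f; apply: fps_eqP => n /=.
  by apply: contrapT => nz; apply: no; exists n; apply/eqP.
case: (ex_minnP ex) => a nz min; exists a => // i lt_ia.
by apply/eqP; apply: contraLR lt_ia => /min; rewrite -leqNgt.
Qed.

End Kit.

Lemma fmul_eq0 (f g : Ft) : f * g = 0 -> f = 0 \/ g = 0.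
Proof.
move=> fg0; case: (pselect (f = 0)) => [|/fps_neq0P [a fa f0]]; first by left.
case: (pselect (g = 0)) => [|/fps_neq0P [b gb g0]]; first by right.
have := fcoefM_low f0 g0 (leqnn _); rewrite eqxx fg0 => /eqP.
by rewrite eq_sym mulf_eq0 (negbTE fa) (negbTE gb).
Qed.

Lemma fmulI (f g h : Ft) : f <> 0 -> f * g = f * h -> g = h.
Proof.
move=> nz_f eq_fgh; have /fmul_eq0 [//|gh0] : f * (g + h) = 0.
  by rewrite mulrDr eq_fgh faddff.
by rewrite -[g]addr0 -(faddff h) addrA gh0 add0r.
Qed.

Lemma fexp_eq0 (f : Ft) n : f ^+ n = 0 -> f = 0.
Proof.
elim: n => [/eqP|n IH]; first by rewrite expr0 oner_eq0.
by rewrite exprS => /fmul_eq0 [].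
Qed.

Lemma F2_cases (x : 'F_2) : x = 0 \/ x = 1.
Proof.
by case: x => [[|[|n]] lt_x]; [left|right|]; try exact: val_inj.
Qed.

Lemma F2_sqr (x : 'F_2) : x * x = x.
Proof. by case: (F2_cases x) => ->; rewrite ?mulr0 ?mulr1. Qed.

Lemma F2_addxx (x : 'F_2) : x + x = 0.
Proof. by rewrite addrr_pchar2 // F2_pchar2. Qed.

(** Frobenius: in the Cauchy square the terms of indices i and n - i cancel in pairs, leaving the
    middle one for even n, and every coefficient is its own square. *)
Lemma sqr_dil (f : Ft) : f ^+ 2 = dil 2 f.
Proof.
apply: fps_eqP => n; rewrite expr2 fcoefM fcoef_dil.
pose F (i : nat) := fcoef f i * fcoef f (n - i)%N.
rewrite -(big_mkord xpredT F).
have rev m : (m <= n)%N -> \sum_(0 <= i < m) F i = \sum_(n.+1 - m <= i < n.+1) F i.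
  elim: m => [|m IH] lt_mn; first by rewrite subn0 !big_geq.
  rewrite big_nat_recr //= IH ?(ltnW lt_mn) // subSS.
  rewrite [RHS]big_ltn ?ltnS ?leq_subr // addrC subSn ?(ltnW lt_mn) //.
  by congr (_ + _); rewrite /F subKn ?(ltnW lt_mn) // mulrC.
have [ev|od] := boolP (2 %| n)%N.
  have def_n : n = (n %/ 2 + n %/ 2)%N by rewrite addnn -muln2 divnK.
  rewrite (@big_cat_nat _ _ _ (n %/ 2)) ?leq_div2 ?(leq_trans (leq_div _ _)) //=.
  rewrite rev ?leq_div // big_ltn ?ltnS ?leq_div // addrCA.
  have -> : (n.+1 - n %/ 2)%N = (n %/ 2).+1 by lia.
  by rewrite F2_addxx addr0 /F (_ : (n - n %/ 2)%N = (n %/ 2)%N) ?F2_sqr //; lia.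
have def_n : n = (n %/ 2 + n %/ 2).+1.
  rewrite {1}(divn_eq n 2) modn2 addnn -muln2.
  by move: od; rewrite dvdn2 negbK => ->; rewrite addn1.
have le_h : ((n %/ 2).+1 <= n)%N by rewrite {2}def_n ltnS leq_addr.
rewrite (@big_cat_nat _ _ _ (n %/ 2).+1) ?(leq_trans le_h) //=.
rewrite rev //.
have -> : (n.+1 - (n %/ 2).+1)%N = (n %/ 2).+1 by lia.
by rewrite F2_addxx.
Qed.

Lemma exp2n_dil (f : Ft) k : f ^+ (2 ^ k) = dil (2 ^ k) f.
Proof.
elim: k => [|k IH]; first by rewrite expr1 dil_id.
by rewrite expnSr exprM IH sqr_dil dil_dil // ?expn_gt0 // mulnC.
Qed.

Lemma U_dil_coprime (p k : nat) (f : Ft) : (0 < k)%N -> coprime p k ->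
  hecke_U p (dil k f) = dil k (hecke_U p f).
Proof.
move=> k0 co; apply: fps_eqP => n /=; rewrite Gauss_dvdr 1?coprime_sym //.
by case: ifP => // dv; rewrite -muln_divA.
Qed.

Lemma T_sqr p (f : Ft) : (0 < p)%N -> odd p -> hecke_T p (f ^+ 2) = hecke_T p f ^+ 2.
Proof.
move=> p0 od; rewrite !hecke_TE !sqr_dil U_dil_coprime ?coprimen2 // dilD.
by rewrite !dil_dil // mulnC.
Qed.

Lemma U_sqr p (f : Ft) : odd p -> hecke_U p (f ^+ 2) = hecke_U p f ^+ 2.
Proof. by move=> od; rewrite !sqr_dil U_dil_coprime ?coprimen2. Qed.

(** * Theta identities from lattice point counts mod 2 *)

Section Counting.
Local Open Scope classical_set_scope.

(** Parity of a number of lattice points. The sum over an infinite set is 0 by convention, hence the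
    condition [bounded] on every splitting. *)
Definition cnt (A : set (int * int)) : 'F_2 := \sum_(p \in A) (1 : 'F_2).
Arguments cnt A%_classical_set_scope.

Lemma cnt_bij (f g : int * int -> int * int) A B :
  (forall p, A p -> B (f p)) -> (forall q, B q -> A (g q)) ->
  (forall p, A p -> g (f p) = p) -> (forall q, B q -> f (g q) = q) ->
  cnt A = cnt B.
Proof.
move=> AB BA fK gK; rewrite /cnt (reindex_fsbig f A B) //; split=> //.
- by move=> x y /set_mem Ax /set_mem Ay eq_f; rewrite -(fK x) // eq_f fK.
- by move=> q Bq; exists (g q); [apply: BA | apply: gK].
Qed.

Lemma eq_cnt A B : (forall p, A p <-> B p) -> cnt A = cnt B.
Proof. by move=> AB; congr cnt; apply/seteqP; split=> p /AB. Qed.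

Lemma cnt0 A : (forall p, ~ A p) -> cnt A = 0.
Proof. by move=> A0; rewrite /cnt fsbig1 // => p /A0. Qed.

Lemma cnt1 A p0 : A p0 -> (forall p, A p -> p = p0) -> cnt A = 1.
Proof.
move=> Ap0 A1; have -> : cnt A = cnt [set p0]%classic.
  by apply: eq_cnt => p; split=> [/A1|->].
by rewrite /cnt fsbig_set1.
Qed.

Definition bounded (A : set (int * int)) :=
  exists N : int, forall x y : int, A (x, y) ->
    (- N <= x <= N) && (- N <= y <= N).

Lemma boundedP A : bounded A -> finite_set A.
Proof.
case=> N bdA; pose I : set int := (fun n : nat => n%:Z - N) @` `I_((absz (2 * N)%R).+1).
apply: (@sub_finite_set _ _ (I `*` I)).
  move=> [x y] /bdA bd; split=> /=.
    by exists (absz (x + N)%R); [rewrite /mkset; lia | lia].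
  by exists (absz (y + N)%R); [rewrite /mkset; lia | lia].
by apply: finite_setX; apply: finite_image; apply: finite_II.
Qed.

Lemma cnt_split C A : bounded A ->
  cnt A = cnt (fun p => A p /\ C p) + cnt (fun p => A p /\ ~ C p).
Proof. by move=> /boundedP finA; rewrite /cnt (fsbigID C). Qed.

Lemma bounded_sub (A B : set (int * int)) : bounded A -> (forall p, B p -> A p) -> bounded B.
Proof. by case=> N bd BA; exists N => x y /BA /bd. Qed.

Lemma cnt_invol C (f : int * int -> int * int) A : bounded A ->
  (forall p, A p -> A (f p)) -> (forall p, A p -> f (f p) = p) ->
  (forall p, A p -> (C (f p) <-> ~ C p)) -> cnt A = 0.
Proof.
move=> bd Af fK Cf; rewrite (cnt_split C) //.
rewrite (@cnt_bij f f _ (fun p => A p /\ ~ C p)) ?F2_addxx //.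
- by move=> p [Ap Cp]; split; [exact: Af | move/(Cf _ Ap)].
- by move=> p [Ap Cp]; split; [exact: Af | apply/(Cf _ Ap)].
- by move=> p [Ap _]; exact: fK.
- by move=> p [Ap _]; exact: fK.
Qed.

Lemma theta_wide (P : pred nat) a k N : (0 < a)%N -> (k <= N)%N ->
  fcoef (theta P a : Ft) k =
  \sum_(1 <= n < N.+1 | P n) ((a * n ^ 2)%N == k)%:R.
Proof.
move=> a0 le_kN; rewrite [RHS](@big_cat_nat _ _ _ k.+1) //=.
rewrite [X in _ + X]big_nat_cond [X in _ + X]big1 ?addr0 // => n.
by case/andP=> /andP [lo _] _; case: eqP => //= h; exfalso; move: h lo; nia.
Qed.

Definition sol (P Q : pred nat) (a b N : nat) : set (int * int) :=
  fun p => [/\ (0 < p.1)%R, (0 < p.2)%R, P (absz p.1), Q (absz p.2)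
    & a%:Z * (p.1 * p.1) + b%:Z * (p.2 * p.2) = N%:Z].

(** One-variable solutions are placed on the axis y = 0, so that coefficients of theta series and of
    their products are counts in the same plane. *)
Definition sol1 (P : pred nat) (a N : nat) : set (int * int) :=
  fun p => [/\ (0 < p.1)%R, p.2 = 0, P (absz p.1) & a%:Z * (p.1 * p.1) = N%:Z].

Lemma theta_cnt (P : pred nat) a N : (0 < a)%N ->
  fcoef (theta P a : Ft) N = cnt (sol1 P a N).
Proof.
move=> a0; rewrite (theta_wide _ a0 (leqnn N)).
pose r := [seq (n%:Z, 0 : int) | n <- [seq n <- index_iota 1 N.+1 | P n && ((a * n ^ 2)%N == N)]].
have -> : cnt (sol1 P a N) = cnt [set` r].
  apply: eq_cnt => -[x y]; split.
    case=> /= x0 -> Px e; apply/mapP; exists (absz x); last by congr (_, _); lia.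
    rewrite mem_filter Px mem_index_iota /=; nia.
  case/mapP => n; rewrite mem_filter mem_index_iota => /andP [/andP [Pn e] n1] [-> ->].
  by split=> //=; nia.
rewrite /cnt -fsbig_seq; last first.
  by rewrite map_inj_uniq ?filter_uniq ?iota_uniq // => x y [].
rewrite big_map big_filter big_mkcondr /=.
by apply: eq_bigr => n _; case: eqP.
Qed.

Lemma thetaM_cnt (P Q : pred nat) a b N : (0 < a)%N -> (0 < b)%N ->
  fcoef (theta P a * theta Q b : Ft) N = cnt (sol P Q a b N).
Proof.
move=> a0 b0; rewrite fcoefM.
transitivity (\sum_(1 <= n < N.+1 | P n) \sum_(1 <= m < N.+1 | Q m)
    ((a * n ^ 2 + b * m ^ 2)%N == N)%:R : 'F_2).
  under eq_bigr => i _ do rewrite (theta_wide P a0 (ltn_ord i : i <= N)%N)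
    (theta_wide Q b0 (leq_subr i N)) big_distrl /=.
  rewrite exchange_big /=; apply: eq_bigr => n _.
  under eq_bigr => i _ do rewrite big_distrr /=.
  rewrite exchange_big /=; apply: eq_bigr => m _.
  have [e|ne] := eqVneq (a * n ^ 2 + b * m ^ 2)%N N.
    have lt_i : (a * n ^ 2 < N.+1)%N by lia.
    rewrite (bigD1 (Ordinal lt_i)) //= eqxx -[N in (N - _)%N]e addKn eqxx mulr1.
    rewrite big1 ?addr0 // => i /negP ne_i.
    by case: eqP => [h|]; rewrite ?mul0r //; case: ne_i; apply/eqP/val_inj.
  rewrite big1 // => i _; case: eqP => [h1|]; rewrite ?mul0r //.
  case: eqP => [h2|]; rewrite ?mulr0 //; have := ltn_ord i; lia.
pose r := [seq p <- [seq (n%:Z, m%:Z) | n <- [seq n <- index_iota 1 N.+1 | P n],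
    m <- [seq m <- index_iota 1 N.+1 | Q m]] | a%:Z * (p.1 * p.1) + b%:Z * (p.2 * p.2) == N%:Z].
have -> : cnt (sol P Q a b N) = cnt [set` r].
  apply: eq_cnt => -[x y]; split.
    case=> /= x0 y0 Px Qy e; rewrite mem_filter /= e eqxx /=.
    apply/allpairsP; exists (absz x, absz y); rewrite /= !mem_filter Px Qy !mem_index_iota /=.
    by split; [nia|nia|congr (_, _); lia].
  rewrite /= mem_filter => /andP [/= /eqP e] /allpairsP [[n m]] /=.
  rewrite !mem_filter !mem_index_iota => -[/andP [Pn n1] /andP [Qm m1] [xE yE]].
  by rewrite /sol /=; split; rewrite ?e // ?xE ?yE //; lia.
rewrite /cnt -fsbig_seq; last first.
  rewrite filter_uniq // allpairs_uniq ?filter_uniq ?iota_uniq //.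
  by move=> [x1 y1] [x2 y2] _ _ [-> ->].
rewrite /r [RHS]big_filter [RHS]big_mkcond [RHS]big_allpairs_dep /= [RHS]big_filter; apply: eq_bigr => n _.
rewrite [RHS]big_filter; apply: eq_bigr => m _.
by rewrite (_ : (_ == _) = ((a * n ^ 2 + b * m ^ 2)%N == N)); [case: eqP | lia].
Qed.

End Counting.

Lemma cnt_inj (f : int * int -> int * int) (A B : set (int * int)) :
  (forall p, A p -> B (f p)) ->
  (forall p q, A p -> A q -> f p = f q -> p = q) ->
  (forall q, B q -> exists2 p, A p & f p = q) -> cnt A = cnt B.
Proof.
move=> AB inj surj; rewrite /cnt (reindex_fsbig f A B) //; split=> //.
by move=> x y /set_mem Ax /set_mem Ay; apply: inj.
Qed.

Lemma bounded_sqr (A : set (int * int)) (N : int) :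
  (forall x y, A (x, y) -> x * x <= N /\ y * y <= N) -> bounded A.
Proof. by move=> bd; exists N => x y /bd [h1 h2]; nia. Qed.

Lemma dil_theta P a k : (0 < a)%N -> (0 < k)%N ->
  dil k (theta P a : Ft) = theta P (k * a).
Proof.
move=> a0 k0; apply: fps_eqP => n; rewrite fcoef_dil.
case: ifP => [/dvdnP [m ->]|/negP nk].
  rewrite mulnK // [RHS](_ : _ = \sum_(1 <= i < (m * k).+1 | P i) ((k * a * i ^ 2)%N == m * k)%N%:R) //.
  rewrite (@theta_wide P a m (m * k)) ?leq_pmulr //; apply: eq_bigr => i _.
  by rewrite mulnC -mulnA (mulnC k) eqn_pmul2r // mulnC.
rewrite [RHS]big1 // => i _; case: eqP => // e; case: nk.
by rewrite -e -mulnA dvdn_mulr.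
Qed.

Lemma exp2n_theta P a k : (0 < a)%N -> (theta P a : Ft) ^+ (2 ^ k) = theta P (2 ^ k * a).
Proof. by move=> a0; rewrite exp2n_dil dil_theta // expn_gt0. Qed.

(* Representatives of the nonzero vectors of Z^2 up to sign. *)
Definition hp (p : int * int) : bool := (0 < p.1) || ((p.1 == 0) && (0 < p.2)).

(** Off the axes the points pair off under y -> -y. On the axis x = 0 this reflection leaves the
    half plane [hp], so that axis survives whole. *)
Lemma cnt_axes (A : set (int * int)) : bounded A ->
  (forall p, A p -> hp p) -> (forall x y, A (x, y) -> x != 0 -> A (x, - y)) ->
  cnt A = cnt (fun p => A p /\ p.2 = 0) + cnt (fun p => A p /\ p.1 = 0).
Proof.
move=> bdA Ahp Aconj; have bd2 := bounded_sub bdA.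
rewrite (cnt_split (fun p => p.2 = 0)) //; congr (_ + _).
rewrite (cnt_split (fun p => p.1 = 0)); last by apply: bd2 => p [].
rewrite [X in _ + X](@cnt_invol (fun p => 0 < p.2) (fun p => (p.1, - p.2))).
- rewrite addr0; apply: eq_cnt => -[x y] /=; split=> [[[Ap _]]|[Ap x0]] //.
  by split=> //; split=> // y0; move/Ahp: Ap; rewrite x0 y0.
- by apply: bd2 => p [[]].
- move=> [x y] [[Ap /= y0] /= x0]; split=> //; split=> /=; last by lia.
  by apply: Aconj => //; apply/eqP.
- by move=> [x y] _ /=; rewrite opprK.
- by move=> [x y] [[_ /= y0] x0]; lia.
Qed.

(** Multiplication by 1 - sqrt(-3), of norm 4, maps the points with x + y odd, taken up to sign,
    onto the odd solutions of n^2 + 3 m^2 = N up to signs; conjugation then leaves the two axes. *)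
Lemma theta3_cnt N :
  cnt (sol odd odd 1 3 N) = cnt (sol1 odd 4 N) + cnt (sol1 odd 12 N).
Proof.
pose A : set (int * int) := fun p => [/\ hp p, ((p.1 + p.2) %% 2)%Z = 1
  & 4 * (p.1 * p.1 + 3 * (p.2 * p.2)) = N%:Z].
have bdA : bounded A.
  by apply: (@bounded_sqr _ N) => x y [/= _ _ e]; nia.
rewrite -(@cnt_inj (fun p => (`|p.1 + 3 * p.2|, `|p.1 - p.2|)) A); first last.
- move=> [n m] [/= n0 m0 on om e].
  (* For odd n and m, 4 divides n - m or n + m; this sign makes the division by 1 - sqrt(-3) exact.
     The quotient or its opposite lies in [hp]. *)
  pose m' := if ((n - m) %% 4)%Z == 0 then m else - m.
  have m'E : (m' = m \/ m' = - m) /\ ((n - m') %% 4)%Z = 0 by rewrite /m'; case: ifP; lia.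
  have [x xE] : exists x, 4 * x = n + 3 * m' by exists ((n + 3 * m') %/ 4)%Z; lia.
  have [y yE] : exists y, 4 * y = n - m' by exists ((n - m') %/ 4)%Z; lia.
  have e2 : n * n + 3 * (m' * m') = N%:Z by case: m'E => -[] -> _; lia.
  have nE : n = x + 3 * y by lia.
  have mE : m' = x - y by lia.
  have [h|h] := boolP (hp (x, y)).
    by exists (x, y); [split=> //=; [lia|nia] | congr (_, _) => /=; lia].
  exists (-x, -y); first split=> /=; [move: h; rewrite /hp /=; lia|lia|nia|congr (_, _) => /=; lia].
- move=> [x y] [x' y'] [/= h p _] [/= h' p' _] [] e1 e2.
  by congr (_, _); move: h h'; rewrite /hp /=; lia.
- move=> [x y] [/= h p e]; by split=> /=; lia.
rewrite cnt_axes //; first last.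
- by move=> x y [/= h p e] x0; split=> /=; move: h; rewrite /hp /=; lia.
- by move=> p [].
congr (_ + _).
  by apply: eq_cnt => -[x y]; rewrite /A /hp /sol1 /=; split=> [[[h p e] yE]|[x0 -> p e]]; do ?split=> //; lia.
apply: (@cnt_bij (fun p => (p.2, p.1)) (fun p => (p.2, p.1))) => -[x y] //=.
  by case=> -[]; rewrite /hp /sol1 /= => *; split=> /=; lia.
by rewrite /sol1 /A /hp /= => -[x0 -> p e]; do ?split => /=; lia.
Qed.

(** Multiplication by (1 + sqrt(-7))/2, of norm 2, parametrises the solutions of n^2 + 7 m^2 = N by
    [A]. Points of [A] with odd coordinates match 2 n^2 + 14 m^2 = N and cancel; those with even
    coordinates are stable under conjugation, which leaves the axes. *)
Lemma theta7_cnt N : cnt (sol odd odd 1 7 N) + cnt (sol odd odd 2 14 N) =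
  cnt (sol1 odd 8 N) + cnt (sol1 odd 56 N).
Proof.
pose A : set (int * int) := fun p => [/\ hp p, ((p.1 + p.2) %% 4)%Z = 2
  & 2 * (p.1 * p.1 + 7 * (p.2 * p.2)) = N%:Z].
have bdA : bounded A.
  by apply: (@bounded_sqr _ N) => x y [/= _ _ e]; nia.
have -> : cnt (sol odd odd 1 7 N) = cnt A.
  apply/esym/(@cnt_inj (fun p => (`|((p.1 - 7 * p.2) %/ 2)%Z|, `|((p.1 + p.2) %/ 2)%Z|))).
  - move=> [c d] [/= h p e].
    have [m mE] : exists m, c + d = 2 * m by exists ((c + d) %/ 2)%Z; lia.
    have [-> ->] : ((c - 7 * d) %/ 2 = m - 4 * d)%Z /\ ((c + d) %/ 2 = m)%Z by lia.
    have cE : c = 2 * m - d by lia.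
    by rewrite cE in e; split=> /=; lia.
  - move=> [x y] [x' y'] [/= h p _] [/= h' p' _] [] e1 e2.
    by congr (_, _); move: h h'; rewrite /hp /=; lia.
  move=> [n m] [/= n0 m0 on om e].
  pose m' := if ((n - m) %% 4)%Z == 0 then m else - m.
  have m'E : (m' = m \/ m' = - m) /\ ((n - m') %% 4)%Z = 0 by rewrite /m'; case: ifP; lia.
  have [x xE] : exists x, 4 * x = n + 7 * m' by exists ((n + 7 * m') %/ 4)%Z; lia.
  have [y yE] : exists y, 4 * y = m' - n by exists ((m' - n) %/ 4)%Z; lia.
  have e2 : n * n + 7 * (m' * m') = N%:Z by case: m'E => -[] -> _; lia.
  have nE : n = m' - 4 * y by lia.
  have xE' : x = 2 * m' - y by lia.
  have [h|h] := boolP (hp (x, y)).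
    by exists (x, y); [split=> //=; [lia|rewrite xE'; rewrite nE in e2; lia] | congr (_, _) => /=; lia].
  exists (-x, -y); first split=> /=.
  - by move: h; rewrite /hp /=; lia.
  - lia.
  - by rewrite xE'; rewrite nE in e2; lia.
  - congr (_, _) => /=; lia.
rewrite (cnt_split (fun p => (p.1 %% 2)%Z = 1)) //.
have -> : cnt (fun p => A p /\ (p.1 %% 2)%Z = 1) = cnt (sol odd odd 2 14 N).
  apply: (@cnt_inj (fun p => (p.1, `|p.2|))).
  - by move=> [c d] [[/= h p e] c1]; split=> /=; move: h c1; rewrite /hp /=; lia.
  - move=> [x y] [x' y'] [[/= h p _] c1] [[/= h' p' _] c1'] [] /= e1 e2.
    by congr (_, _); move: h h' c1 c1'; rewrite /hp /=; lia.
  move=> [c d] [/= c0 d0 oc od e].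
  pose d' := if ((c + d) %% 4)%Z == 2 then d else - d.
  have d'E : (d' = d \/ d' = - d) /\ ((c + d') %% 4)%Z = 2 by rewrite /d'; case: ifP; lia.
  by exists (c, d'); [do ?split=> /=; rewrite /hp /=; lia | congr (_, _) => /=; lia].
rewrite addrAC F2_addxx add0r.
rewrite cnt_axes; first last.
- by move=> x y [[/= h p e] /= p2] x0; do ?split=> /=; move: h; rewrite /hp /=; lia.
- by move=> p [[]].
- by apply: (bounded_sub bdA) => p [].
congr (_ + _).
  apply: (@cnt_inj (fun p => ((p.1 %/ 2)%Z, 0))).
  - move=> [x y] [[[/= h p e] /= p2] /= y0]; move: h; rewrite /hp /= => h.
    have [c cE] : exists c, x = 2 * c by exists (x %/ 2)%Z; lia.
    have -> : (x %/ 2)%Z = c by lia.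
    by rewrite cE y0 in e; split=> /=; lia.
  - by move=> [x y] [x' y'] [[[/= h p e] /= p2] /= y0] [[[/= h' p' e'] /= p2'] /= y0'] [] /= ?; congr (_, _); lia.
  by move=> [x y] [/= x0 -> p e]; exists (2 * x, 0); [do ?split=> /=; rewrite /hp /=; lia | congr (_, _) => /=; lia].
apply: (@cnt_inj (fun p => ((p.2 %/ 2)%Z, 0))).
- move=> [y x] [[[/= h p e] /= p2] /= y0]; move: h; rewrite /hp /= => h.
  have [c cE] : exists c, x = 2 * c by exists (x %/ 2)%Z; lia.
  have -> : (x %/ 2)%Z = c by lia.
  by rewrite cE y0 in e; split=> /=; lia.
- by move=> [y x] [y' x'] [[[/= h p e] /= p2] /= y0] [[[/= h' p' e'] /= p2'] /= y0'] [] /= ?; congr (_, _); lia.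
by move=> [x y] [/= x0 -> p e]; exists (0, 2 * x); [do ?split=> /=; rewrite /hp /=; lia | congr (_, _) => /=; lia].
Qed.

(** Odd n prime to 5, split by whether n^2 is 1 or 9 mod 20: this makes the two theta series
    homogeneous for exponents mod 20. *)
Definition pm1 : pred nat := fun n => (n %% 10 == 1)%N || (n %% 10 == 9)%N.
Definition pm3 : pred nat := fun n => (n %% 10 == 3)%N || (n %% 10 == 7)%N.

Lemma sol1_split5 k N : (0 < k)%N ->
  cnt (sol1 odd k N) = cnt (sol1 pm1 k N) + cnt (sol1 pm3 k N) + cnt (sol1 odd (25 * k) N).
Proof.
move=> k0; have bd : bounded (sol1 odd k N).
  by apply: (@bounded_sqr _ N) => x y [/= x0 -> _ e]; nia.
rewrite (cnt_split (fun p => (p.1 %% 5)%Z = 0)) // addrC; congr (_ + _); last first.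
  symmetry; apply: (@cnt_inj (fun p => (5 * p.1, 0))).
  - by move=> [x y] [/= x0 y0 p e]; split=> /=; [split=> //=; lia|lia].
  - by move=> [x y] [x' y'] [/= _ -> _ _] [/= _ -> _ _] [] ?; congr (_, _); lia.
  move=> [x y] [[/= x0 y0 p e] x5]; have [z zE] : exists z, x = 5 * z by exists (x %/ 5)%Z; lia.
  by rewrite zE in e; exists (z, 0); [split=> //=; lia|congr (_, _) => /=; lia].
rewrite (cnt_split (fun p => pm1 (absz p.1))); last by apply: (bounded_sub bd) => p [].
by congr (_ + _); apply: eq_cnt => -[x y]; rewrite /sol1 /pm1 /pm3 /=; split=> [[[[x0 -> p e] q] s]|[x0 -> p e]];
  do ?split=> //; lia.
Qed.

(** The class mod 5 fixes the signs of a = 2 x - y = 1 and b = x + 2 y = 3 mod 10. It is needed for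
    k = 5; general k is there for the descent from k to 5 k. *)
Definition setB (k N : nat) : set (int * int) := fun p =>
  [/\ (p.1 %% 2)%Z = 1, (p.2 %% 2)%Z = 1, ((2 * p.1 - p.2) %% 5)%Z = 1
    & k%:Z * (p.1 * p.1 + p.2 * p.2) = N%:Z].

(** Cases on x mod 5, where y = 2 x - 1. For x = 0 or 3 one coordinate is divisible by 5 and its
    sign change cancels everything. For x = 1 and 2 the maps to (y, x) and (-y, -x) leave the
    diagonals, which are the theta terms. For x = 4 the point is divisible by a Gaussian prime of
    norm 5 and descends to 5 k. *)
Lemma setB_step k N : (0 < k)%N -> cnt (setB k N) =
  cnt (sol1 pm1 (2 * k) N) + cnt (sol1 pm3 (2 * k) N) + cnt (setB (5 * k) N).
Proof.
move=> k0; have bd : bounded (setB k N).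
  by apply: (@bounded_sqr _ N) => x y [/= _ _ _ e]; nia.
have bds := bounded_sub bd.
rewrite (cnt_split (fun p => (p.1 %% 5)%Z = 0)) //.
rewrite [X in X + _](@cnt_invol (fun p => 0 < p.1) (fun p => (- p.1, p.2))) ?add0r; first last.
- by move=> [x y] [[/= ? ? ? ?] /= ?]; lia.
- by move=> [x y] _ /=; rewrite opprK.
- by move=> [x y] [[/= ? ? ? ?] /= ?]; do ?split=> /=; lia.
- by apply: bds => p [].
rewrite (cnt_split (fun p => (p.1 %% 5)%Z = 3)); last by apply: bds => p [].
rewrite [X in X + _](@cnt_invol (fun p => 0 < p.2) (fun p => (p.1, - p.2))) ?add0r; first last.
- by move=> [x y] [[[/= ? ? ? ?] /= ?] /= ?]; lia.
- by move=> [x y] _ /=; rewrite opprK.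
- by move=> [x y] [[[/= ? ? ? ?] /= ?] /= ?]; do ?split=> /=; lia.
- by apply: bds => p [[]].
rewrite (cnt_split (fun p => (p.1 %% 5)%Z = 1)); last by apply: bds => p [[]].
rewrite -addrA; congr (_ + _).
  rewrite (cnt_split (fun p => p.1 = p.2)); last by apply: bds => p [[[]]].
  rewrite [X in _ + X](@cnt_invol (fun p => p.1 < p.2) (fun p => (p.2, p.1))) ?addr0; first last.
  - by move=> [x y] [[[[[/= ? ? ? ?] /= ?] /= ?] /= ?] /= ?]; lia.
  - by move=> [x y].
  - by move=> [x y] [[[[[/= ? ? ? ?] /= ?] /= ?] /= ?] /= ?]; do ?split=> /=; lia.
  - by apply: bds => p [[[[]]]].
  apply: (@cnt_inj (fun p => (`|p.1|, 0))).
  - move=> [x y] [[[[[/= ? ? ? e] /= ?] /= ?] /= ?] /= xE]; rewrite /sol1 /pm1.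
    by rewrite -xE in e; split=> /=; lia.
  - by move=> [x y] [x' y'] [[[[[/= ? ? ? ?] /= ?] /= ?] /= ?] /= ?] [[[[[/= ? ? ? ?] /= ?] /= ?] /= ?] /= ?] [] ?; congr (_, _); lia.
  move=> [x y]; rewrite /sol1 /pm1 /= => -[/= x0 -> p e].
  pose x' := if (x %% 5)%Z == 1 then x else - x.
  have x'E : (x' = x \/ x' = - x) /\ (x' %% 5)%Z = 1 by rewrite /x'; case: ifP; lia.
  have e' : k%:Z * (x' * x' + x' * x') = N%:Z by case: x'E => -[] -> _; lia.
  by exists (x', x'); [do ?split=> /=; lia|congr (_, _) => /=; lia].
rewrite (cnt_split (fun p => (p.1 %% 5)%Z = 2)); last by apply: bds => p [[[]]].
congr (_ + _).
  rewrite (cnt_split (fun p => p.1 = - p.2)); last by apply: bds => p [[[[]]]].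
  rewrite [X in _ + X](@cnt_invol (fun p => 0 < p.1 + p.2) (fun p => (- p.2, - p.1))) ?addr0; first last.
  - by move=> [x y] [[[[[[/= ? ? ? ?] /= ?] /= ?] /= ?] /= ?] /= ?]; lia.
  - by move=> [x y] _ /=; rewrite !opprK.
  - by move=> [x y] [[[[[[/= ? ? ? ?] /= ?] /= ?] /= ?] /= ?] /= ?]; do ?split=> /=; lia.
  - by apply: bds => p [[[[[]]]]].
  apply: (@cnt_inj (fun p => (`|p.1|, 0))).
  - move=> [x y] [[[[[[/= ? ? ? e] /= ?] /= ?] /= ?] /= ?] /= xE]; rewrite /sol1 /pm3.
    by rewrite xE in e; split=> /=; lia.
  - by move=> [x y] [x' y'] [[[[[[/= ? ? ? ?] /= ?] /= ?] /= ?] /= ?] /= ?] [[[[[[/= ? ? ? ?] /= ?] /= ?] /= ?] /= ?] /= ?] [] ?; congr (_, _); lia.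
  move=> [x y]; rewrite /sol1 /pm3 /= => -[/= x0 -> p e].
  pose x' := if (x %% 5)%Z == 2 then x else - x.
  have x'E : (x' = x \/ x' = - x) /\ (x' %% 5)%Z = 2 by rewrite /x'; case: ifP; lia.
  have e' : k%:Z * (x' * x' + x' * x') = N%:Z by case: x'E => -[] -> _; lia.
  by exists (x', - x'); [do ?split=> /=; lia|congr (_, _) => /=; lia].
symmetry; apply: (@cnt_inj (fun p => (p.2 - 2 * p.1, - (p.1 + 2 * p.2)))).
- by move=> [x y] [/= ? ? ? ?]; do ?split=> /=; lia.
- by move=> [x y] [x' y'] _ _ [] /= ? ?; congr (_, _); lia.
move=> [u v] [[[[[/= ? ? ? e] /= ?] /= ?] /= ?] /= ?].
have u4 : (u %% 5)%Z = 4 by clear e; lia.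
have [x xE] : exists x, 5 * x = - (2 * u + v) by exists ((- (2 * u + v)) %/ 5)%Z; lia.
have [y yE] : exists y, 5 * y = u - 2 * v by exists ((u - 2 * v) %/ 5)%Z; lia.
have uE : u = y - 2 * x by lia.
have vE : v = - (x + 2 * y) by lia.
by rewrite uE vE in e; exists (x, y); [split=> /=; lia|congr (_, _) => /=; lia].
Qed.

Lemma sum_sqr_pos_mul (k N : nat) (x y : int) : x <> 0 \/ y <> 0 ->
  k%:Z * (x * x + y * y) = N%:Z -> (k <= N)%N.
Proof.
move=> xy0 e; have : 0 < x * x + y * y by nia.
move: (x * x + y * y) e => z e z0; nia.
Qed.

(** Descent: each step multiplies k by 5, and both sides are empty once k > N. By [sol1_split5] the
    right-hand side obeys the same recursion. *)
Lemma setB_cnt k N : (0 < k)%N ->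
  cnt (setB k N) = cnt (sol1 odd (2 * k) N) + cnt (sol1 odd (10 * k) N).
Proof.
move=> k0; have [n] : exists n, (N < k + n)%N by exists N.+1; lia.
elim: n k k0 => [|n IH] k k0 lt_N.
  have lt_Nk : (N < k)%N by rewrite addn0 in lt_N.
  rewrite !cnt0 ?addr0 // => -[x y] /= [] /=.
  - by move=> x0 _ _ e; have := @sum_sqr_pos_mul (10 * k) N x 0; lia.
  - by move=> x0 _ _ e; have := @sum_sqr_pos_mul (2 * k) N x 0; lia.
  - by move=> x2 y2 _ e; have := @sum_sqr_pos_mul k N x y; lia.
rewrite setB_step // IH; [|lia|lia].
rewrite (@sol1_split5 (2 * k)); last by lia.
have -> : (25 * (2 * k) = 10 * (5 * k))%N by lia.
have -> : (2 * (5 * k) = 10 * k)%N by lia.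
by rewrite addrA addrAC.
Qed.

Definition in13 (t : int) := ((t %% 5)%Z == 1) || ((t %% 5)%Z == 3).
Definition in34 (t : int) := ((t %% 5)%Z == 3) || ((t %% 5)%Z == 4).

(** [setE] and [setE'] alternate in a descent: division by a Gaussian prime of norm 5 exchanges x =
    0 and x = 2 mod 4. [in13] and [in34] each contain exactly one of t, -t for t nonzero mod 5. *)
Definition setE (k N : nat) : set (int * int) := fun p =>
  [/\ (p.1 %% 4)%Z = 0, (p.2 %% 2)%Z = 1, in13 (2 * p.1 + p.2)
    & k%:Z * (p.1 * p.1 + p.2 * p.2) = N%:Z].

Definition setE' (k N : nat) : set (int * int) := fun p =>
  [/\ (p.1 %% 4)%Z = 2, (p.2 %% 2)%Z = 1, in34 (2 * p.1 + p.2)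
    & k%:Z * (p.1 * p.1 + p.2 * p.2) = N%:Z].

(** Let t = y - 2 x. If 5 divides t, the point is divisible by 1 + 2 i and descends. If t is not in
    [in13], then y -> -y preserves the conditions and cancels. If it is, x -> -x does so away from x
    = 0, and that axis is the theta term. *)
Lemma setE_step k N : (0 < k)%N -> cnt (setE k N) =
  cnt (sol1 pm1 k N) + cnt (sol1 pm3 k N) + cnt (setE' (5 * k) N).
Proof.
move=> k0; have bd : bounded (setE k N).
  by apply: (@bounded_sqr _ N) => x y [/= _ _ _ e]; nia.
have bds := bounded_sub bd.
rewrite (cnt_split (fun p => ((p.2 - 2 * p.1) %% 5)%Z = 0)) // addrC; congr (_ + _); last first.
  symmetry; apply: (@cnt_inj (fun p => (p.1 - 2 * p.2, 2 * p.1 + p.2))).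
  - by move=> [x y]; rewrite /setE' /setE /in13 /in34 => -[/= ? ? ? ?]; do ?split=> /=; lia.
  - by move=> [x y] [x' y'] _ _ [] /= ? ?; congr (_, _); lia.
  move=> [u v]; rewrite /setE' /setE /in13 /in34 => -[[/= ? ? ? e] ?].
  have [x xE] : exists x, 5 * x = u + 2 * v by exists ((u + 2 * v) %/ 5)%Z; lia.
  have [y yE] : exists y, 5 * y = v - 2 * u by exists ((v - 2 * u) %/ 5)%Z; lia.
  have uE : u = x - 2 * y by lia.
  have vE : v = 2 * x + y by lia.
  by rewrite uE vE in e; exists (x, y); [split=> /=; lia|congr (_, _) => /=; lia].
rewrite (cnt_split (fun p => in13 (p.2 - 2 * p.1))); last by apply: bds => p [].
rewrite [X in _ + X](@cnt_invol (fun p => 0 < p.2) (fun p => (p.1, - p.2))) ?addr0; first last.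
- by move=> [x y] [[[/= ? ? ? ?] /= ?] /= ?]; lia.
- by move=> [x y] _ /=; rewrite opprK.
- by move=> [x y]; rewrite /setE /in13 => -[[[/= ? ? ? ?] /= ?] /= ?]; do ?split=> /=; lia.
- by apply: bds => p [[]].
rewrite (cnt_split (fun p => p.1 = 0)); last by apply: bds => p [[]].
rewrite [X in _ + X](@cnt_invol (fun p => 0 < p.1) (fun p => (- p.1, p.2))) ?addr0; first last.
- by move=> [x y] [[[[/= ? ? ? ?] /= ?] /= ?] ?]; lia.
- by move=> [x y] _ /=; rewrite opprK.
- by move=> [x y]; rewrite /setE /in13 => -[[[[/= ? ? ? ?] /= ?] /= ?] /= ?]; do ?split=> /=; lia.
- by apply: bds => p [[[]]].
have bd1 : bounded (sol1 odd k N).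
  by apply: (@bounded_sqr _ N) => x y [/= x0 -> _ e]; nia.
transitivity (cnt (fun p => sol1 odd k N p /\ (p.1 %% 5)%Z <> 0)).
  apply: (@cnt_inj (fun p => (`|p.2|, 0))).
  - move=> [u v]; rewrite /setE /in13 => -[[[[/= ? ? ? e] /= ?] /= ?] /= u0].
    by rewrite u0 in e; do ?split=> /=; lia.
  - by move=> [u v] [u' v']; rewrite /setE /in13 => -[[[[/= ? ? ? e] /= ?] /= ?] /= u0] -[[[[/= ? ? ? e'] /= ?] /= ?] /= u0'] [] /= ?; congr (_, _); lia.
  move=> [x y] [[/= x0 -> ? e] /= x5].
  pose x' := if in13 x then x else - x.
  have x'E : (x' = x \/ x' = - x) /\ in13 x' by rewrite /x'; case: ifP; rewrite /in13; lia.
  have e' : k%:Z * (x' * x') = N%:Z by case: x'E => -[] -> _; lia.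
  by rewrite /in13 in x'E *; exists (0, x'); [rewrite /setE /in13; do ?split=> /=; lia|congr (_, _) => /=; lia].
rewrite (cnt_split (fun p => pm1 (absz p.1))); last by apply: (bounded_sub bd1) => p [].
by congr (_ + _); apply: eq_cnt => -[x y]; rewrite /sol1 /pm1 /pm3 /=; split=> [[[[x0 -> p e] q] s]|[x0 -> p e]];
  do ?split=> //; lia.
Qed.

(** As for [setE_step], except that x = 2 mod 4 rules out fixed points of x -> -x, so no theta term
    appears. *)
Lemma setE'_step k N : (0 < k)%N -> cnt (setE' k N) = cnt (setE (5 * k) N).
Proof.
move=> k0; have bd : bounded (setE' k N).
  by apply: (@bounded_sqr _ N) => x y [/= _ _ _ e]; nia.
have bds := bounded_sub bd.
rewrite (cnt_split (fun p => ((p.2 - 2 * p.1) %% 5)%Z = 0)) // -[RHS]addr0; congr (_ + _).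
  symmetry; apply: (@cnt_inj (fun p => (2 * p.2 - p.1, - (2 * p.1 + p.2)))).
  - by move=> [x y]; rewrite /setE' /setE /in13 /in34 => -[/= ? ? ? ?]; do ?split=> /=; lia.
  - by move=> [x y] [x' y'] _ _ [] /= ? ?; congr (_, _); lia.
  move=> [x y]; rewrite /setE' /setE /in13 /in34 => -[[/= ? ? ? e] ?].
  have [u uE] : exists u, 5 * u = - (x + 2 * y) by exists ((- (x + 2 * y)) %/ 5)%Z; lia.
  have [v vE] : exists v, 5 * v = 2 * x - y by exists ((2 * x - y) %/ 5)%Z; lia.
  have xE : x = 2 * v - u by lia.
  have yE : y = - (2 * u + v) by lia.
  by rewrite xE yE in e; exists (u, v); [split=> /=; lia|congr (_, _) => /=; lia].
rewrite (cnt_split (fun p => in34 (p.2 - 2 * p.1))); last by apply: bds => p [].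
rewrite [X in _ + X](@cnt_invol (fun p => 0 < p.2) (fun p => (p.1, - p.2))) ?addr0; first last.
- by move=> [x y] [[[/= ? ? ? ?] /= ?] /= ?]; lia.
- by move=> [x y] _ /=; rewrite opprK.
- by move=> [x y]; rewrite /setE' /in34 => -[[[/= ? ? ? ?] /= ?] /= ?]; do ?split=> /=; lia.
- by apply: bds => p [[]].
apply: (@cnt_invol (fun p => 0 < p.1) (fun p => (- p.1, p.2))); first last.
- by move=> [x y] [[[/= ? ? ? ?] /= ?] /= ?]; lia.
- by move=> [x y] _ /=; rewrite opprK.
- by move=> [x y]; rewrite /setE' /in34 => -[[[/= ? ? ? ?] /= ?] /= ?]; do ?split=> /=; lia.
- by apply: bds => p [[]].
Qed.

Lemma setE_cnt k N : (0 < k)%N -> cnt (setE k N) = cnt (sol1 odd k N).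
Proof.
move=> k0; have [n] : exists n, (N < k + n)%N by exists N.+1; lia.
elim: n k k0 => [|n IH] k k0 lt_N.
  have lt_Nk : (N < k)%N by rewrite addn0 in lt_N.
  rewrite !cnt0 ?addr0 // => -[x y] /= [] /=.
  - by move=> x0 _ _ e; have := @sum_sqr_pos_mul k N x 0; lia.
  - by move=> x2 y2 _ e; have := @sum_sqr_pos_mul k N x y; lia.
rewrite setE_step // setE'_step; last by lia.
rewrite IH; [|lia|lia].
by rewrite (@sol1_split5 k) // mulnA.
Qed.

(** With signs a' = 1 and b' = 3 mod 10, a' + b' i is divisible by 2 + i and the quotient u + v i
    runs over [setB 5]. *)
Lemma pm1pm3_cnt N : cnt (sol pm1 pm3 1 1 N) = cnt (sol1 odd 10 N) + cnt (sol1 odd 50 N).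
Proof.
rewrite -(@setB_cnt 5) //; symmetry.
apply: (@cnt_inj (fun p => (`|2 * p.1 - p.2|, `|p.1 + 2 * p.2|))).
- by move=> [u v]; rewrite /setB /sol /pm1 /pm3 => -[/= ? ? ? ?]; split=> /=; lia.
- by move=> [u v] [u' v']; rewrite /setB => -[/= ? ? ? ?] -[/= ? ? ? ?] [] ? ?; congr (_, _); lia.
move=> [a b]; rewrite /setB /sol /pm1 /pm3 => -[/= a0 b0 pa pb e].
pose a' := if (a %% 10)%Z == 1 then a else - a.
have a'E : (a' = a \/ a' = - a) /\ (a' %% 10)%Z = 1 by rewrite /a'; case: ifP; lia.
pose b' := if (b %% 10)%Z == 3 then b else - b.
have b'E : (b' = b \/ b' = - b) /\ (b' %% 10)%Z = 3 by rewrite /b'; case: ifP; lia.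
have e' : a' * a' + b' * b' = N%:Z by case: a'E => -[] -> _; case: b'E => -[] -> _; lia.
have [u uE] : exists u, 5 * u = 2 * a' + b' by exists ((2 * a' + b') %/ 5)%Z; lia.
have [v vE] : exists v, 5 * v = 2 * b' - a' by exists ((2 * b' - a') %/ 5)%Z; lia.
have aE : a' = 2 * u - v by lia.
have bE : b' = u + 2 * v by lia.
rewrite aE bE in e'.
by exists (u, v); [split=> /=; lia|congr (_, _) => /=; lia].
Qed.

(** 4 a^2 + b^2 is the norm of 2 a + b i, which after a choice of signs is divisible by a Gaussian
    prime of norm 5. The two classes allowed by [in13] for 2 u + v = b separate the two products. *)
Lemma pm1pm1_cnt N : cnt (sol pm1 pm1 4 1 N) + cnt (sol pm3 pm3 4 1 N) = cnt (sol1 odd 5 N).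
Proof.
rewrite -(@setE_cnt 5) //.
rewrite (cnt_split (fun p => ((2 * p.1 + p.2) %% 5)%Z = 1) (A := setE 5 N)); last first.
  by apply: (@bounded_sqr _ N) => x y [/= _ _ _ e]; nia.
congr (_ + _); symmetry.
  apply: (@cnt_inj (fun p => (`|p.2 - (p.1 %/ 2)%Z|, `|p.2 + 2 * p.1|))).
  - move=> [u v]; rewrite /setE /sol /pm1 /in13 => -[[/= ? ? ? e] ?].
    have [w wE] : exists w, u = 2 * w by exists (u %/ 2)%Z; lia.
    have -> : (u %/ 2)%Z = w by lia.
    by rewrite wE in e; split=> /=; lia.
  - by move=> [u v] [u' v']; rewrite /setE => -[[/= ? ? ? ?] ?] -[[/= ? ? ? ?] ?] [] ? ?; congr (_, _); lia.
  move=> [a b]; rewrite /setE /sol /pm1 /in13 => -[/= a0 b0 pa pb e].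
  pose a' := if (a %% 10)%Z == 1 then a else - a.
  have a'E : (a' = a \/ a' = - a) /\ (a' %% 10)%Z = 1 by rewrite /a'; case: ifP; lia.
  pose b' := if (b %% 10)%Z == 1 then b else - b.
  have b'E : (b' = b \/ b' = - b) /\ (b' %% 10)%Z = 1 by rewrite /b'; case: ifP; lia.
  have e' : 4 * (a' * a') + b' * b' = N%:Z by case: a'E => -[] -> _; case: b'E => -[] -> _; lia.
  have [w wE] : exists w, 5 * w = b' - a' by exists ((b' - a') %/ 5)%Z; lia.
  have [v vE] : exists v, 5 * v = b' + 4 * a' by exists ((b' + 4 * a') %/ 5)%Z; lia.
  have aE : a' = v - w by lia.
  have bE : b' = v + 4 * w by lia.
  rewrite aE bE in e'.
  by exists (2 * w, v); [do ?split=> /=; lia|congr (_, _) => /=; lia].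
apply: (@cnt_inj (fun p => (`|p.2 - (p.1 %/ 2)%Z|, `|p.2 + 2 * p.1|))).
- move=> [u v]; rewrite /setE /sol /pm3 /in13 => -[[/= ? ? ? e] ?].
  have [w wE] : exists w, u = 2 * w by exists (u %/ 2)%Z; lia.
  have -> : (u %/ 2)%Z = w by lia.
  by rewrite wE in e; split=> /=; lia.
- by move=> [u v] [u' v']; rewrite /setE /in13 => -[[/= ? ? ? ?] ?] -[[/= ? ? ? ?] ?] [] ? ?; congr (_, _); lia.
move=> [a b]; rewrite /setE /sol /pm3 /in13 => -[/= a0 b0 pa pb e].
pose a' := if (a %% 10)%Z == 3 then a else - a.
have a'E : (a' = a \/ a' = - a) /\ (a' %% 10)%Z = 3 by rewrite /a'; case: ifP; lia.
pose b' := if (b %% 10)%Z == 3 then b else - b.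
have b'E : (b' = b \/ b' = - b) /\ (b' %% 10)%Z = 3 by rewrite /b'; case: ifP; lia.
have e' : 4 * (a' * a') + b' * b' = N%:Z by case: a'E => -[] -> _; case: b'E => -[] -> _; lia.
have [w wE] : exists w, 5 * w = b' - a' by exists ((b' - a') %/ 5)%Z; lia.
have [v vE] : exists v, 5 * v = b' + 4 * a' by exists ((b' + 4 * a') %/ 5)%Z; lia.
have aE : a' = v - w by lia.
have bE : b' = v + 4 * w by lia.
rewrite aE bE in e'.
by exists (2 * w, v); [do ?split=> /=; lia|congr (_, _) => /=; lia].
Qed.

(** * The series s and the Hecke recursions *)

(* Sealed, so that the unifier never compares it with F, G or r by unfolding. *)
Lemma s_key : {x : Ft | x = F + G}.
Proof. by exists (F + G). Qed.

Definition s : Ft := sval s_key.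

Lemma s_def : s = F + G. Proof. exact: (svalP s_key). Qed.

Lemma dil_F k : (0 < k)%N -> dil k F = theta odd k.
Proof. by move=> k0; rewrite dil_theta // muln1. Qed.

Lemma G_dil : G = dil 5 F.
Proof. by rewrite dil_F. Qed.

Lemma F_dil3 : (F + dil 3 F) ^+ 4 = F * dil 3 F.
Proof.
transitivity (F ^+ 4 + dil 3 F ^+ 4); first by ring2.
rewrite !dil_F // (@exp2n_theta _ _ 2) // (@exp2n_theta _ _ 2) //.
by apply: fps_eqP => N; rewrite fcoefD !theta_cnt // thetaM_cnt // theta3_cnt.
Qed.

Lemma F_dil7 :
  (F + dil 7 F) ^+ 8 = F * dil 7 F + F ^+ 2 * dil 7 F ^+ 2.
Proof.
transitivity (F ^+ 8 + dil 7 F ^+ 8); first by ring2.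
rewrite !dil_F // (@exp2n_theta _ _ 3) // (@exp2n_theta _ _ 3) //.
rewrite (@exp2n_theta _ _ 1) // (@exp2n_theta _ _ 1) //.
apply: fps_eqP => N; rewrite !fcoefD !theta_cnt // !thetaM_cnt //.
by rewrite theta7_cnt.
Qed.

Lemma G_dil3 : (G + dil 3 G) ^+ 4 = G * dil 3 G.
Proof.
have := congr1 (dil 5) F_dil3; rewrite dilX // dilD dilM //.
by rewrite dil_dil // -(@dil_dil _ 3 5) // -G_dil.
Qed.

Lemma G_dil7 :
  (G + dil 7 G) ^+ 8 = G * dil 7 G + G ^+ 2 * dil 7 G ^+ 2.
Proof.
have := congr1 (dil 5) F_dil7; rewrite dilX // !dilD dilM // [dil 5 (F ^+ 2 * _)]dilM // !dilX //.
by rewrite dil_dil // -(@dil_dil _ 7 5) // -G_dil.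
Qed.

Lemma theta_split5 : F = theta pm1 1 + theta pm3 1 + dil 5 G.
Proof.
rewrite dil_theta //; apply: fps_eqP => N.
by rewrite !fcoefD !theta_cnt // sol1_split5.
Qed.

Lemma pm1_pm3 : theta pm1 1 * theta pm3 1 = dil 5 s ^+ 2 :> Ft.
Proof.
transitivity (G ^+ 2 + dil 5 G ^+ 2); last first.
  by rewrite s_def dilD -G_dil; ring2.
rewrite dil_theta // (@exp2n_theta _ _ 1) // (@exp2n_theta _ _ 1) //.
by apply: fps_eqP => N; rewrite fcoefD !theta_cnt // thetaM_cnt // pm1pm3_cnt.
Qed.

Lemma pm1_pm3_exp5 : theta pm1 1 ^+ 5 + theta pm3 1 ^+ 5 = G.
Proof.
transitivity (theta pm1 1 ^+ (2 ^ 2) * theta pm1 1 + theta pm3 1 ^+ (2 ^ 2) * theta pm3 1 : Ft).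
  by congr (_ + _); rewrite -exprSr.
rewrite !exp2n_theta //; apply: fps_eqP => N.
by rewrite fcoefD theta_cnt // !thetaM_cnt // pm1pm1_cnt.
Qed.

Lemma dil_fixed k (f : Ft) : (1 < k)%N -> fcoef f 0 = 0 -> dil k f = f -> f = 0.
Proof.
move=> k1 f0 fE; apply: fps_eqP => n /=.
elim/ltn_ind: n => -[//|n] IH; rewrite -fE fcoef_dil; case: ifP => // _.
by apply: IH; rewrite ltn_Pdiv.
Qed.

Lemma fcoefM0 (f g : Ft) : fcoef (f * g) 0 = fcoef f 0 * fcoef g 0.
Proof. by rewrite fcoefM big_ord1. Qed.

Lemma fcoefM1 (f g : Ft) :
  fcoef (f * g) 1 = fcoef f 0 * fcoef g 1 + fcoef f 1 * fcoef g 0.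
Proof. by rewrite fcoefM !big_ord_recl big_ord0 addr0. Qed.

Lemma fcoefM2 (f g : Ft) : fcoef (f * g) 2 =
  fcoef f 0 * fcoef g 2 + fcoef f 1 * fcoef g 1 + fcoef f 2 * fcoef g 0.
Proof. by rewrite fcoefM !big_ord_recl big_ord0 addr0 addrA. Qed.

Lemma fcoefX0 (f : Ft) n : fcoef f 0 = 0 -> fcoef (f ^+ n.+1) 0 = 0.
Proof. by move=> f0; rewrite exprS fcoefM0 f0 mul0r. Qed.

Lemma theta0 P a : fcoef (theta P a : Ft) 0 = 0.
Proof. by rewrite /= big_geq. Qed.

Lemma s0 : fcoef s 0 = 0.
Proof. by rewrite s_def fcoefD !theta0 addr0. Qed.

(** [F * G + s ^+ 6] is invariant under x -> x^5 and has no constant term, hence vanishes. With P, Q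
    the theta series of [pm1], [pm3] and e = s(x^5), the invariance is a polynomial identity in P +
    Q and e, since F = P + Q + G(x^5), P Q = e^2 and P^5 + Q^5 = G. *)
Lemma FG_s6 : F * G = s ^+ 6.
Proof.
apply: fadd_eq0; apply: (@dil_fixed 5) => //.
  by rewrite fcoefD fcoefM0 !theta0 mul0r (@fcoefX0 _ 5) ?s0 // addr0.
have e : dil 5 s = G + dil 5 G by rewrite s_def dilD -G_dil.
rewrite dilD dilM // dilX // -G_dil.
set g : Ft := dil 5 G in e *; set D : Ft := theta pm1 1 + theta pm3 1.
have FE : F = D + g by rewrite theta_split5.
(* Newton's formula for P^5 + Q^5 in terms of P + Q and P Q, mod 2. *)
have GE : G = D ^+ 5 + dil 5 s ^+ 2 * D ^+ 3 + dil 5 s ^+ 4 * D.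
  have -> : dil 5 s ^+ 4 = (dil 5 s ^+ 2) ^+ 2 by rewrite -exprM.
  rewrite -[LHS]pm1_pm3_exp5.
  by rewrite -pm1_pm3 /D; ring2.
have sE : s = D + dil 5 s by rewrite {1}s_def e FE; ring2.
move: (dil 5 s) e sE GE => x e sE GE.
have gE : g = G + x by rewrite e; ring2.
by rewrite sE FE gE GE; ring2.
Qed.

Lemma theta_split2 a : (0 < a)%N -> theta predT a = theta odd a + theta predT (4 * a) :> Ft.
Proof.
move=> a0; apply: fps_eqP => N; rewrite fcoefD !theta_cnt //; last by lia.
rewrite (cnt_split (fun p => (p.1 %% 2)%Z = 1)); last first.
  by apply: (@bounded_sqr _ N) => x y [/= x0 -> _ e]; nia.
congr (_ + _).
  by apply: eq_cnt => -[x y]; rewrite /sol1 /=; split=> [[[x0 -> p e] q]|[x0 -> p e]]; do ?split=> //; lia.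
symmetry; apply: (@cnt_inj (fun p => (2 * p.1, 0))).
- by move=> [x y] [/= x0 y0 p e]; split=> /=; [split=> //=; lia|lia].
- by move=> [x y] [x' y'] [/= _ -> _ _] [/= _ -> _ _] [] ?; congr (_, _); lia.
move=> [x y] [[/= x0 y0 p e] x2]; have [z zE] : exists z, x = 2 * z by exists (x %/ 2)%Z; lia.
by rewrite zE in e; exists (z, 0); [split=> //=; lia|congr (_, _) => /=; lia].
Qed.

(** The even n contribute a^4 to a theta series a over all n > 0, so its odd part is a + a^4. Since
    r = a + a^2 + c + c^2, the sum r^2 + r telescopes. *)
Lemma r_eq : r ^+ 2 + r = s.
Proof.
rewrite /r s_def /F /G; set a := theta predT 1; set c := theta predT 5.
have -> : theta predT 2 = a ^+ 2 by rewrite (@exp2n_theta _ _ 1).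
have -> : theta predT 10 = c ^+ 2 by rewrite (@exp2n_theta _ _ 1).
have -> : theta odd 1 = a + a ^+ 4.
  by rewrite {1}/a theta_split2 // (@exp2n_theta _ _ 2) // -addrA faddff addr0.
have -> : theta odd 5 = c + c ^+ 4.
  by rewrite {1}/c theta_split2 // (@exp2n_theta _ _ 2) // -addrA faddff addr0.
ring2.
Qed.

Lemma r0 : fcoef r 0 = 0.
Proof. by rewrite !fcoefD !theta0 !addr0. Qed.

Lemma s_low n : (n < 8)%N -> fcoef s n = ((n == 1) || (n == 5))%N%:R.
Proof.
by move: n; do 8?[case=> [_|]] => //; rewrite s_def /= /index_iota unlock; apply: val_inj.
Qed.

Lemma fcoef_s1 : fcoef s 1 = 1.
Proof. by rewrite s_low. Qed.

(** [s * r ^+ 4] is a root of T^2 + s T + s^6, whose roots are [G] and [F]. Its coefficient at x is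
    0 while that of [F] is 1, which decides. *)
Lemma G_r : G = s * r ^+ 4.
Proof.
have rr4 : r ^+ 8 = r ^+ 4 + s ^+ 4 by rewrite -r_eq; ring2.
have [] // : (G + s * r ^+ 4) = 0 \/ (G + s * r ^+ 4 + s) = 0.
- apply: fmul_eq0.
  transitivity (G ^+ 2 + s * G + s ^+ 2 * (r ^+ 8 + r ^+ 4)); first by ring2.
  have sG : G ^+ 2 + s * G = s ^+ 6 by rewrite -FG_s6 s_def; ring2.
  by rewrite rr4 sG; ring2.
- exact: fadd_eq0.
move=> h; have : fcoef (s * r ^+ 4) 1 = 1.
  have -> : s * r ^+ 4 = F by apply: fadd_eq0; rewrite -h s_def; ring2.
  by rewrite /= /index_iota unlock; apply: val_inj.
rewrite fcoefM1 s0 mul0r add0r.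
by rewrite (@fcoefX0 _ 3) ?r0 // mulr0.
Qed.

Lemma F_r : F = s * (r + 1) ^+ 4.
Proof.
have -> : F = s + G by rewrite s_def; ring2.
by rewrite G_r; ring2.
Qed.

(** * Recursions for Hecke operators drawn from theta identities *)

Section HeckeRelations.
Variable p : nat.
Hypothesis p0 : (0 < p)%N.

Lemma dilXM (f g : Ft) n : dil p (f ^+ n * g) = dil p f ^+ n * dil p g.
Proof. by rewrite dilM // dilX. Qed.

(** Let B = A(x^p). The identity is symmetric: A^4 = B^4 + A B is used under U_p, where powers of B
    come out as powers of A by the projection formula, and B^4 = A^4 + A B is used on the [dil]
    side. The three variants below work alike. *)
Lemma T_rel4 (A f : Ft) : (A + dil p A) ^+ 4 = A * dil p A ->
  hecke_T p (A ^+ 4 * f) = A * hecke_T p (A * f) + A ^+ 4 * hecke_T p f.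
Proof.
move=> e; have eA : A ^+ 4 = dil p A ^+ 4 + A * dil p A by rewrite -e; ring2.
have eB : dil p A ^+ 4 = A ^+ 4 + A * dil p A by rewrite -e; ring2.
rewrite !hecke_TE dilXM // [dil p (A * f)]dilM // eB.
have -> : A ^+ 4 * f = dil p (A ^+ 4) * f + dil p A * (A * f).
  by rewrite {1}eA dilX //; ring2.
by rewrite UD !U_dilM //; ring2.
Qed.

Lemma T_rel4s (A f : Ft) :
  (A + dil p A) ^+ 4 = A * dil p A + A ^+ 2 * dil p A ^+ 2 ->
  hecke_T p (A ^+ 4 * f) =
    A ^+ 2 * hecke_T p (A ^+ 2 * f) + A * hecke_T p (A * f) + A ^+ 4 * hecke_T p f.
Proof.
move=> e; have eA : A ^+ 4 = dil p A ^+ 4 + A * dil p A + A ^+ 2 * dil p A ^+ 2.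
  by rewrite -addrA -e; ring2.
have eB : dil p A ^+ 4 = A ^+ 4 + A * dil p A + A ^+ 2 * dil p A ^+ 2.
  by rewrite -addrA -e; ring2.
rewrite !hecke_TE !dilXM // [dil p (A * f)]dilM // eB.
have -> : A ^+ 4 * f = dil p (A ^+ 4) * f + dil p A * (A * f) + dil p (A ^+ 2) * (A ^+ 2 * f).
  by rewrite {1}eA !dilX //; ring2.
by rewrite !UD !U_dilM //; ring2.
Qed.

Lemma T_rel8 (A f : Ft) :
  (A + dil p A) ^+ 8 = A * dil p A + A ^+ 2 * dil p A ^+ 2 ->
  hecke_T p (A ^+ 8 * f) =
    A ^+ 2 * hecke_T p (A ^+ 2 * f) + A * hecke_T p (A * f) + A ^+ 8 * hecke_T p f.
Proof.
move=> e; have eA : A ^+ 8 = dil p A ^+ 8 + A * dil p A + A ^+ 2 * dil p A ^+ 2.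
  by rewrite -addrA -e; ring2.
have eB : dil p A ^+ 8 = A ^+ 8 + A * dil p A + A ^+ 2 * dil p A ^+ 2.
  by rewrite -addrA -e; ring2.
rewrite !hecke_TE !dilXM // [dil p (A * f)]dilM // eB.
have -> : A ^+ 8 * f = dil p (A ^+ 8) * f + dil p A * (A * f) + dil p (A ^+ 2) * (A ^+ 2 * f).
  by rewrite {1}eA !dilX //; ring2.
by rewrite !UD !U_dilM //; ring2.
Qed.

Lemma T_rel8s (A f : Ft) :
  (A + dil p A) ^+ 8 = A * dil p A + (A * dil p A + A ^+ 2 * dil p A ^+ 2) * (A + dil p A) ^+ 4 ->
  hecke_T p (A ^+ 8 * f) =
    A ^+ 2 * hecke_T p (A ^+ 6 * f) + A * hecke_T p (A ^+ 5 * f)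
    + A ^+ 6 * hecke_T p (A ^+ 2 * f) + (A + A ^+ 5) * hecke_T p (A * f)
    + A ^+ 8 * hecke_T p f.
Proof.
move=> e; set B : Ft := dil p A in e *.
have eA : A ^+ 8 = B ^+ 8 + (A * B + (A * B + A ^+ 2 * B ^+ 2) * (A + B) ^+ 4).
  by rewrite -e; ring2.
have eB : B ^+ 8 = A ^+ 8 + (A * B + (A * B + A ^+ 2 * B ^+ 2) * (A + B) ^+ 4).
  by rewrite -e; ring2.
rewrite !hecke_TE !dilXM // [dil p (A * f)]dilM // -/B eB.
have -> : A ^+ 8 * f = dil p (A ^+ 8) * f + dil p A * (A * f) + dil p (A ^+ 2) * (A ^+ 6 * f)
   + dil p A * (A ^+ 5 * f) + dil p (A ^+ 6) * (A ^+ 2 * f) + dil p (A ^+ 5) * (A * f).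
  by rewrite {1}eA !dilX // -/B; ring2.
by rewrite !UD !U_dilM //; ring2.
Qed.

Lemma T_1 : hecke_T p (1 : Ft) = 0.
Proof.
rewrite hecke_TE dil1 // -{1}(dil1 _ p0) U_dil // faddff //.
Qed.

Lemma T_exp2n (f : Ft) k : odd p -> hecke_T p (f ^+ (2 ^ k)) = hecke_T p f ^+ (2 ^ k).
Proof.
move=> od; elim: k => // k IH; rewrite expnSr !exprM T_sqr // IH //.
Qed.
End HeckeRelations.

(** If p n is the square of an odd number, then n = p z^2 with z odd. So U_p F = F(x^p), and the two
    halves of T_p cancel. *)
Lemma T_F p : prime p -> odd p -> hecke_T p F = 0.
Proof.
move=> pr od; have p0 := prime_gt0 pr; rewrite hecke_TE.
have -> : hecke_U p F = dil p F; last by rewrite faddff.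
rewrite dil_F //; apply: fps_eqP => N.
rewrite -[LHS]/(fcoef F (p * N)%N) !theta_cnt //; symmetry.
apply: (@cnt_inj (fun q => (p%:Z * q.1, 0))).
- move=> [x y] [/= x0 _ ox e]; split=> //=; [nia| |lia].
  by rewrite abszM oddM od.
- by move=> [x y] [x' y'] [/= _ -> _ _] [/= _ -> _ _] [] ?; congr (_, _); nia.
move=> [x y] [/= x0 y0 ox e].
have /dvdnP [z zE] : (p %| absz x)%N.
  have: (p %| absz x ^ 2)%N by apply/dvdnP; exists N; lia.
  by rewrite Euclid_dvdX // => /andP [].
exists (z%:Z, 0); last by rewrite y0; congr (_, _) => /=; lia.
have xE : x = p%:Z * z%:Z by lia.
have {ox} : odd z by move: ox; rewrite zE oddM => /andP [].
rewrite xE in e x0 => oz.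
have z0 : 0 < z%:Z by case: z {zE xE e} oz x0 => //; rewrite mulr0.
split=> //=; apply: (@mulfI _ p%:Z); first by lia.
by rewrite PoszM mul1r in e; rewrite -e [RHS]mulrACA -!mulrA.
Qed.

Lemma T_dil_coprime p k (f : Ft) : (0 < p)%N -> (0 < k)%N -> coprime p k ->
  hecke_T p (dil k f) = dil k (hecke_T p f).
Proof.
move=> p0 k0 co; rewrite !hecke_TE U_dil_coprime // dilD.
by rewrite !dil_dil // mulnC.
Qed.

Lemma T_s p : prime p -> odd p -> p != 5 -> hecke_T p s = 0.
Proof.
move=> pr od p5; rewrite s_def TD G_dil T_dil_coprime ?prime_gt0 //.
  by rewrite T_F // dil0 addr0.
by rewrite prime_coprime // dvdn_prime2.
Qed.

Lemma dilMX k (f g : Ft) n : (0 < k)%N -> dil k (f * g ^+ n) = dil k f * dil k g ^+ n.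
Proof. by move=> k0; rewrite dilM // dilX. Qed.

(** Adding the identities for [F] = s (r + 1)^4 and [G] = s r^4 gives (s + s3)^4 = s s3 (1 + u^4),
    with u = r + r(x^3). As s + s3 = u^2 + u, cancelling 1 + u^4 leaves u^4 = s s3. *)
Lemma s_T3 : (s + dil 3 s) ^+ 4 = s * dil 3 s + s ^+ 2 * dil 3 s ^+ 2.
Proof.
set u : Ft := r + dil 3 r; set s3 : Ft := dil 3 s.
have s3E : s3 = dil 3 r ^+ 2 + dil 3 r by rewrite /s3 -r_eq dilD dilX.
have tE : s + s3 = u ^+ 2 + u by rewrite -r_eq s3E /u; ring2.
have t4 : (s + s3) ^+ 4 = s * s3 * (1 + u ^+ 4).
  transitivity ((F + dil 3 F) ^+ 4 + (G + dil 3 G) ^+ 4).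
    by rewrite /s3 s_def dilD; ring2.
  by rewrite F_dil3 G_dil3 F_r G_r !dilMX // dilD dil1 // -/s3 /u; ring2.
have u4 : u ^+ 4 = s * s3.
  apply: (@fmulI (1 + u ^+ 4)).
    move/(congr1 (fun f => fcoef f 0)); rewrite fcoefD (@fcoefX0 _ 3) ?addr0.
      by move/eqP; rewrite oner_eq0.
    by rewrite fcoefD fcoef_dil dvdn0 div0n r0 addr0.
  by rewrite [RHS]mulrC -t4 tE; ring2.
by rewrite t4 u4; ring2.
Qed.

(** Same elimination as for [s_T3]. After cancelling 1 + u^4, the relation between u and w = s s7
    factors as (1 + u^4 + w)(u^8 + w u^4 + w) = 0, and the first factor has constant term 1. *)
Lemma s_T7 : (s + dil 7 s) ^+ 8 =
  s * dil 7 s + (s * dil 7 s + s ^+ 2 * dil 7 s ^+ 2) * (s + dil 7 s) ^+ 4.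
Proof.
set u : Ft := r + dil 7 r; set s7 : Ft := dil 7 s.
have s7E : s7 = dil 7 r ^+ 2 + dil 7 r by rewrite /s7 -r_eq dilD dilX.
have tE : s + s7 = u ^+ 2 + u by rewrite -r_eq s7E /u; ring2.
have u0 : fcoef u 0 = 0 by rewrite fcoefD fcoef_dil dvdn0 div0n r0 addr0.
have nz1 (f : Ft) : fcoef f 0 = 0 -> 1 + f <> 0.
  move=> f0 /(congr1 (fun f => fcoef f 0)); rewrite fcoefD f0 addr0.
  by move/eqP; rewrite oner_eq0.
set w := s * s7.
have t8 : (s + s7) ^+ 8 = (1 + u ^+ 4) * (w + w ^+ 2 * (1 + u ^+ 4)).
  transitivity ((F + dil 7 F) ^+ 8 + (G + dil 7 G) ^+ 8).
    by rewrite /s7 s_def dilD; ring2.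
  by rewrite F_dil7 G_dil7 F_r G_r !dilMX // dilD dil1 // -/s7 /w /u; ring2.
have E1 : u ^+ 12 + u ^+ 8 = w + w ^+ 2 * (1 + u ^+ 4).
  apply: (@fmulI (1 + u ^+ 4)); first by apply: nz1; rewrite (@fcoefX0 _ 3).
  by rewrite -t8 tE; ring2.
have E2 : u ^+ 8 + w * u ^+ 4 + w = 0.
  have [] // : 1 + (u ^+ 4 + w) = 0 \/ u ^+ 8 + w * u ^+ 4 + w = 0.
    apply: fmul_eq0; transitivity (u ^+ 12 + u ^+ 8 + (w + w ^+ 2 * (1 + u ^+ 4))).
      by ring2.
    by rewrite E1 faddff.
  move/nz1; case; rewrite fcoefD (@fcoefX0 _ 3) // add0r /w.
  by rewrite fcoefM0 s0 mul0r.
apply: fadd_eq0; rewrite tE (_ : s ^+ 2 * s7 ^+ 2 = w ^+ 2); last by rewrite /w; ring2.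
transitivity ((u ^+ 8 + w * u ^+ 4 + w) * (u ^+ 8 + w * u ^+ 4 + 1)); first by ring2.
by rewrite E2 mul0r.
Qed.

Lemma fcoefX2 (f : Ft) n : fcoef (f ^+ 2) n = if odd n then 0 else fcoef f n./2.
Proof. by rewrite sqr_dil fcoef_dil dvdn2 -divn2; case: odd. Qed.

Lemma fcoef_s3 n : (n < 8)%N -> fcoef (s ^+ 3) n = ((n == 3) || (n == 7))%N%:R.
Proof.
move=> lt_n; rewrite exprSr mulrC fcoefM.
transitivity (\sum_(i < n.+1) ((i == 1 :> nat) || (i == 5 :> nat))%N%:R *
    (if odd (n - i) then 0 else (((n - i)./2 == 1) || ((n - i)./2 == 5))%N%:R) : 'F_2).
  apply: eq_bigr => i _; rewrite s_low ?fcoefX2 ?s_low //; last by have := ltn_ord i; lia.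
  by have := ltn_ord i; lia.
by move: n lt_n; do 8?[case=> [_|]] => //; rewrite !big_ord_recl big_ord0; apply: val_inj.
Qed.

Lemma T3_s4 (f : Ft) : hecke_T 3 (s ^+ 4 * f) =
  s ^+ 2 * hecke_T 3 (s ^+ 2 * f) + s * hecke_T 3 (s * f) + s ^+ 4 * hecke_T 3 f.
Proof. by apply: T_rel4s => //; exact: s_T3. Qed.

Lemma T7_s8 (f : Ft) : hecke_T 7 (s ^+ 8 * f) =
    s ^+ 2 * hecke_T 7 (s ^+ 6 * f) + s * hecke_T 7 (s ^+ 5 * f)
    + s ^+ 6 * hecke_T 7 (s ^+ 2 * f) + (s + s ^+ 5) * hecke_T 7 (s * f)
    + s ^+ 8 * hecke_T 7 f.
Proof. by apply: T_rel8s => //; exact: s_T7. Qed.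

Lemma fcoefT p (f : Ft) n : fcoef (hecke_T p f) n =
  fcoef f (p * n) + (if (p %| n)%N then fcoef f (n %/ p) else 0).
Proof. by []. Qed.

(** The recursion does not determine this initial value Z. Frobenius gives T3 (s^6) = Z^2 and the
    recursion gives s Z, so Z is 0 or s; the coefficient at x decides. *)
Lemma T3_s3 : hecke_T 3 (s ^+ 3) = s.
Proof.
set Z := hecke_T 3 (s ^+ 3); have Ts : hecke_T 3 s = 0 by apply: T_s.
have T2 : hecke_T 3 (s ^+ 2) = 0 by rewrite T_sqr // Ts expr2 mul0r.
have T4 : hecke_T 3 (s ^+ 4) = 0 by rewrite (@T_exp2n 3 _ _ 2) // Ts expr0n.
have Z2 : Z ^+ 2 = s * Z.
  rewrite /Z -T_sqr // -exprM (_ : 3 * 2 = 4 + 2)%N // exprD T3_s4 T2 mulr0 addr0.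
  by rewrite -exprD T4 mulr0 add0r -exprS.
have [Z0|] : Z = 0 \/ Z + s = 0.
  by apply: fmul_eq0; rewrite mulrDr -expr2 Z2 mulrC faddff.
  have := congr1 (fun f => fcoef f 1) Z0; rewrite /Z fcoefT (_ : 3 %| 1 = false)%N //.
  by rewrite addr0 muln1 fcoef_s3 // => /eqP; rewrite oner_eq0.
exact: fadd_eq0.
Qed.

Lemma T7_s357 : [/\ hecke_T 7 (s ^+ 3) = s, hecke_T 7 (s ^+ 5) = s ^+ 3
  & hecke_T 7 (s ^+ 7) = s].
Proof.
have Ts : hecke_T 7 s = 0 by apply: T_s.
have T2 : hecke_T 7 (s ^+ 2) = 0 by rewrite T_sqr // Ts expr2 mul0r.
have T4 : hecke_T 7 (s ^+ 4) = 0 by rewrite (@T_exp2n 7 _ _ 2) // Ts expr0n.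
have T8 : hecke_T 7 (s ^+ 8) = 0 by rewrite (@T_exp2n 7 _ _ 3) // Ts expr0n.
have T1 : hecke_T 7 (1 : Ft) = 0 by exact: T_1.
have Tq (f : Ft) : hecke_T 7 (f ^+ 2) = hecke_T 7 f ^+ 2 by rewrite T_sqr.
set Z := hecke_T 7 (s ^+ 3).
have s_nz : s <> 0.
  by move/(congr1 (fun f => fcoef f 1)); rewrite fcoef_s1 => /eqP; rewrite oner_eq0.
have T6 : hecke_T 7 (s ^+ 6) = Z ^+ 2 by rewrite (_ : s ^+ 6 = (s ^+ 3) ^+ 2) ?Tq // -exprM.
have T5 : hecke_T 7 (s ^+ 5) = s * Z ^+ 2.
  have := T7_s8 1; rewrite !mulr1 T8 T6 T2 T1 Ts => e.
  by apply: (fmulI s_nz); apply: fadd_eq0; rewrite {}[RHS]e; ring2.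
have T10 : hecke_T 7 (s ^+ 10) = s ^+ 2 * Z ^+ 4.
  by rewrite (_ : s ^+ 10 = (s ^+ 5) ^+ 2) ?Tq -?exprM // T5; ring2.
have TT7 : hecke_T 7 (s ^+ 7) = s * Z ^+ 4 + (1 + s ^+ 4) * Z.
  have := T7_s8 (s ^+ 2); rewrite -!exprD -exprS T10 T8 T4 T2 -/Z => e.
  by apply: (fmulI s_nz); apply: fadd_eq0; rewrite -[RHS](faddff (s ^+ 2 * Z ^+ 4)) {1}e; ring2.
have T9 : hecke_T 7 (s ^+ 9) = s ^+ 2 * (s * Z ^+ 4 + (1 + s ^+ 4) * Z) + s * Z ^+ 2 + s ^+ 6 * Z.
  by have := T7_s8 s; rewrite -!exprSr -expr2 TT7 T6 T2 Ts -/Z => ->; ring2.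
have Z4 : Z ^+ 4 = s ^+ 3 * Z.
  have := T7_s8 (s ^+ 4); rewrite -!exprD -exprS T10 T9 T6 T5 T4.
  have -> : hecke_T 7 (s ^+ (8 + 4)) = Z ^+ 4.
    by rewrite (_ : 8 + 4 = 3 * 2 ^ 2)%N // exprM (@T_exp2n 7 _ _ 2).
  by move=> ->; ring2.
have [n1 n2] : fcoef Z 1 = 1 /\ fcoef Z 0 = 0.
  rewrite /Z !fcoefT (_ : 7 %| 1 = false)%N // dvdn0 div0n !muln0 muln1.
  by rewrite !fcoef_s3 // !addr0.
have ZE : Z = s.
  have [Z0|] : Z = 0 \/ (Z + s) * (Z ^+ 2 + Z * s + s ^+ 2) = 0.
  - apply: fmul_eq0; transitivity (Z ^+ 4 + s ^+ 3 * Z); first by ring2.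
    by rewrite Z4 faddff.
  - by move: n1; rewrite Z0 => /esym/eqP; rewrite oner_eq0.
  case/fmul_eq0; first exact: fadd_eq0.
  (* The factor Z^2 + Z s + s^2 has coefficient 1 + 1 + 1 = 1 at x^2, so it is not 0. *)
  have e2 (f : Ft) : fcoef (f ^+ 2) 2 = fcoef f 1 by rewrite fcoefX2.
  move/(congr1 (fun f => fcoef f 2)); rewrite !fcoefD !e2 n1 fcoef_s1.
  rewrite fcoefM2 n2 s0 n1 fcoef_s1 mul0r mulr0 mulr1 add0r addr0.
  by move/eqP; rewrite F2_addxx add0r oner_eq0.
by rewrite T5 TT7 ZE; split=> //; ring2.
Qed.

(** * Classes of exponents, orders of vanishing and evaluation of polynomials *)

Definition hmod (m a : nat) (f : Ft) := forall n, fcoef f n != 0 -> n = a %[mod m].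

Lemma homD m a f g : hmod m a f -> hmod m a g -> hmod m a (f + g).
Proof.
move=> hf hg n; rewrite fcoefD => nz.
case: (eqVneq (fcoef f n) 0) => [f0|/hf //]; apply: hg; move: nz.
by rewrite f0 add0r.
Qed.

Lemma homM m a b f g : hmod m a f -> hmod m b g -> hmod m (a + b) (f * g).
Proof.
move=> hf hg n; rewrite fcoefM => nz.
have [i] : exists i : 'I_n.+1, fcoef f i * fcoef g (n - i) != 0.
  apply: contrapT => no; move/negP: nz; apply; apply/eqP; apply: big1 => i _.
  by apply/eqP; apply: contrapT => nzi; apply: no; exists i; apply/negP.
rewrite mulf_eq0 negb_or => /andP [/hf fi /hg gi].
by rewrite -(subnKC (leq_ord i)) -modnDm fi gi modnDm.
Qed.

Lemma hom1 m : hmod m 0 1.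
Proof. by move=> [|n] //=; rewrite eqxx. Qed.

Lemma homX m a k f : hmod m a f -> hmod m (k * a) (f ^+ k).
Proof.
move=> hf; elim: k => [|k IH]; first exact: hom1.
by rewrite exprS mulSn; apply: homM.
Qed.

Lemma hom_mod m a b f : hmod m a f -> a = b %[mod m] -> hmod m b f.
Proof. by move=> hf ab n /hf ->. Qed.

Lemma hom_disj m a b f : hmod m a f -> hmod m b f -> a <> b %[mod m] -> f = 0.
Proof.
move=> ha hb ne; apply: fps_eqP => n; apply/eqP/negPn/negP => nz.
by apply: ne; rewrite -(ha n nz) -(hb n nz).
Qed.

Lemma hom_theta m a b (P : pred nat) :
  (forall n, P n -> b * n ^ 2 = a %[mod m])%N -> hmod m a (theta P b).
Proof.
move=> hP n nz; apply: contrapT => ne; move/negP: nz; apply; apply/eqP.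
rewrite /= big1 // => i Pi; case: eqP => // e; case: ne.
by rewrite -e; apply: hP.
Qed.

Lemma odd_sqr8 n : odd n -> (n ^ 2 %% 8 = 1)%N.
Proof.
move=> od; have nE : (n = 2 * n./2 + 1)%N by lia.
have : ~~ odd (n./2 * n./2.+1) by rewrite oddM oddS; case: odd.
set k := n./2 in nE *; rewrite nE -mulnn => ev.
have [t tE] : exists t, (k * k.+1 = t * 2)%N by exists (k * k.+1 %/ 2)%N; rewrite divnK ?dvdn2.
have -> : ((2 * k + 1) * (2 * k + 1) = t * 8 + 1)%N by lia.
by rewrite modnMDl.
Qed.

Lemma hom_G : hmod 40 5 G.
Proof. by apply: hom_theta => n od; have := odd_sqr8 od; lia. Qed.

Lemma hom_g : hmod 40 25 (dil 5 G).
Proof. by rewrite dil_theta //; apply: hom_theta => n od; have := odd_sqr8 od; lia. Qed.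

Lemma hom_F : hmod 8 1 F.
Proof. by apply: hom_theta => n /odd_sqr8; rewrite mul1n. Qed.

Lemma hom_pm1 : hmod 20 1 (theta pm1 1).
Proof.
apply: hom_theta => n; rewrite mul1n /pm1 -mulnn => h.
have [q] : exists q, n = (10 * q + 1)%N \/ n = (10 * q + 9)%N by exists (n %/ 10)%N; lia.
case=> ->.
  have -> : ((10 * q + 1) * (10 * q + 1) = (5 * q * q + q) * 20 + 1)%N by lia.
  by rewrite modnMDl.
have -> : ((10 * q + 9) * (10 * q + 9) = (5 * q * q + 9 * q + 4) * 20 + 1)%N by lia.
by rewrite modnMDl.
Qed.

Lemma hom_pm3 : hmod 20 9 (theta pm3 1).
Proof.
apply: hom_theta => n; rewrite mul1n /pm3 -mulnn => h.
have [q] : exists q, n = (10 * q + 3)%N \/ n = (10 * q + 7)%N by exists (n %/ 10)%N; lia.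
case=> ->.
  have -> : ((10 * q + 3) * (10 * q + 3) = (5 * q * q + 3 * q) * 20 + 9)%N by lia.
  by rewrite modnMDl.
have -> : ((10 * q + 7) * (10 * q + 7) = (5 * q * q + 7 * q + 2) * 20 + 9)%N by lia.
by rewrite modnMDl.
Qed.

Lemma hom_dvd d m a f : (d %| m)%N -> hmod m a f -> hmod d a f.
Proof. by move=> dm hf n /hf e; rewrite -(modn_dvdm n dm) e modn_dvdm. Qed.

Lemma hom_s : hmod 4 1 s.
Proof.
rewrite s_def; apply: homD; first exact: (hom_dvd _ hom_F).
exact: (hom_mod (hom_dvd _ hom_G)).
Qed.

Definition fval (v : nat) (f : Ft) :=
  fcoef f v = 1 /\ forall i, (i < v)%N -> fcoef f i = 0.

Lemma fvalM a b f g : fval a f -> fval b g -> fval (a + b) (f * g).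
Proof.
move=> [fa f0] [gb g0]; split=> [|i lt_i].
  by rewrite (fcoefM_low f0 g0) // eqxx fa gb mulr1.
by rewrite (fcoefM_low f0 g0) 1?ltnW // ltn_eqF.
Qed.

Lemma fval1 : fval 0 1.
Proof. by []. Qed.

Lemma fvalX a f n : fval a f -> fval (n * a) (f ^+ n).
Proof.
move=> vf; elim: n => [|n IH]; first exact: fval1.
by rewrite exprS mulSn; apply: fvalM.
Qed.

Lemma fvalD a b f g : fval a f -> fval b g -> (a < b)%N -> fval a (f + g).
Proof.
move=> [fa f0] [_ g0] ab; split=> [|i lt_i]; rewrite fcoefD.
  by rewrite fa g0 ?addr0.
by rewrite f0 // g0 ?addr0 // (ltn_trans lt_i).
Qed.

Lemma val_theta b : (0 < b)%N -> fval b (theta odd b).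
Proof.
move=> b0; split=> [|i].
  rewrite theta_cnt // (cnt1 (p0 := (1, 0))) //; first by split=> //=; lia.
  move=> [x y] [/= x0 -> _ e']; congr (_, _).
  have xx : x * x = 1 by apply: (@mulfI _ b%:Z); lia.
  by nia.
move=> lt_i; rewrite theta_cnt // cnt0 // => -[x y] [/= x0 _ _ e'].
have xx : 0 < x * x by rewrite mulr_gt0.
by move: (x * x) xx e' => z; nia.
Qed.

Lemma val_F : fval 1 F. Proof. exact: val_theta. Qed.
Lemma val_G : fval 5 G. Proof. exact: val_theta. Qed.

Lemma val_s : fval 1 s.
Proof. by rewrite s_def; exact: (fvalD val_F val_G). Qed.

Lemma val_r : fval 1 r.
Proof.
split=> [|[|//]]; last by rewrite r0.
have := fcoef_s1; rewrite -r_eq fcoefD expr2 fcoefM1 r0.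
by rewrite mul0r mulr0 !add0r.
Qed.

Lemma val_indep (f : nat -> Ft) (v : nat -> nat) :
  (forall m n, (m < n)%N -> (v m < v n)%N) -> (forall n, fval (v n) (f n)) ->
  forall N (c : nat -> 'F_2), \sum_(k < N) c k *: f k = 0 ->
  forall k, (k < N)%N -> c k = 0.
Proof.
move=> mono vf N c sum0; elim/ltn_ind => k IH lt_k.
have := congr1 (fun f => fcoef f (v k)) sum0; rewrite fcoef_sum.
rewrite (bigD1 (Ordinal lt_k)) //= big1 ?addr0 ?(proj1 (vf k)) ?mulr1 // => i ne_i.
rewrite -val_eqE /= in ne_i; have [lt_ik|lt_ki|e] := ltngtP i k.
- by rewrite IH ?mul0r.
- by rewrite (proj2 (vf i)) ?mulr0 // mono.
- by rewrite e eqxx in ne_i.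
Qed.

(* Evaluation is sealed: otherwise a failing conversion test between two values
   unfolds both of them down to sums of coefficients. *)
Lemma ev_key : {e : Ft -> {poly 'F_2} -> Ft | forall A p, e A p = horner_alg A p}.
Proof. by exists (fun A p => horner_alg A p). Qed.

Definition ev : Ft -> {poly 'F_2} -> Ft := sval ev_key.

Lemma ev_def A p : ev A p = horner_alg A p. Proof. exact: (svalP ev_key). Qed.

Lemma evD A p q : ev A (p + q) = ev A p + ev A q. Proof. by rewrite !ev_def rmorphD. Qed.
Lemma evM A p q : ev A (p * q) = ev A p * ev A q. Proof. by rewrite !ev_def rmorphM. Qed.
Lemma evX A : ev A 'X = A. Proof. by rewrite ev_def horner_algX. Qed.
Lemma ev0 A : ev A 0 = 0. Proof. by rewrite ev_def rmorph0. Qed.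
Lemma ev1 A : ev A 1 = 1. Proof. by rewrite ev_def rmorph1. Qed.
Lemma evE A p n : ev A (p ^+ n) = ev A p ^+ n. Proof. by rewrite !ev_def rmorphXn. Qed.
Lemma evXn A n : ev A 'X^n = A ^+ n. Proof. by rewrite evE evX. Qed.
Lemma evC A c : ev A c%:P = c *: 1. Proof. by rewrite ev_def horner_algC. Qed.

Lemma evZ A c p : ev A (c *: p) = c *: ev A p.
Proof. by rewrite -mul_polyC evM evC mulr_algl. Qed.

Lemma ev_sum A n (g : nat -> 'F_2) :
  ev A (\sum_(i < n) g i *: 'X^i) = \sum_(i < n) g i *: A ^+ i.
Proof.
rewrite (big_morph (ev A) (@evD A) (ev0 A)); apply: eq_bigr => i _.
by rewrite evZ evXn.
Qed.

Lemma evS A (p : {poly 'F_2}) n : (size p <= n)%N -> ev A p = \sum_(i < n) p`_i *: A ^+ i.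
Proof.
move=> le_n; rewrite -(@ev_sum A n (fun i => p`_i)); congr ev.
rewrite -poly_def; apply/polyP => i; rewrite coef_poly; case: ltnP => // le_i.
by rewrite nth_default // (leq_trans le_n).
Qed.

Lemma ev_comp A p q : ev A (p \Po q) = ev (ev A q) p.
Proof.
elim/poly_ind: p => [|p c IH]; first by rewrite comp_poly0 !ev0.
rewrite comp_polyD comp_polyM comp_polyX comp_polyC !evD !evM IH evX.
by rewrite !evC.
Qed.

Lemma ev_inj A p : fval 1 A -> ev A p = 0 -> p = 0.
Proof.
move=> vA; rewrite (evS A (leqnn _)) => /val_indep ind.
have {}ind k : (k < size p)%N -> p`_k = 0.
  by apply: (ind id) => // n; have := fvalX n vA; rewrite muln1.
apply/polyP => i; rewrite coef0; case: (ltnP i (size p)) => [/ind //|].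
exact: nth_default.
Qed.

(* The automorphism r -> r + 1 of F_2[r] is not visible on power series; it is
   applied to polynomial relations between F, G and s. *)
Lemma ev_r_conj p : ev r p = 0 -> ev (r + 1) p = 0.
Proof. by move/(ev_inj val_r) ->; rewrite ev0. Qed.

(** * K consists of odd polynomials in s *)

Lemma UZ p (a : 'F_2) (f : Ft) : hecke_U p (a *: f) = a *: hecke_U p f.
Proof. exact: fps_eqP. Qed.

Lemma TZ p (a : 'F_2) (f : Ft) : hecke_T p (a *: f) = a *: hecke_T p f.
Proof. by apply: fps_eqP => n /=; case: ifP; rewrite mulrDr ?mulr0. Qed.

Lemma U_1 p : (0 < p)%N -> hecke_U p (1 : Ft) = 1.
Proof. by move=> p0; rewrite -{1}(dil1 _ p0) U_dil. Qed.

Lemma U5_sum n (c : nat -> 'F_2) (f : nat -> Ft) :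
  hecke_U 5 (\sum_(i < n) c i *: f i) = \sum_(i < n) c i *: hecke_U 5 (f i).
Proof.
rewrite (big_morph _ (UD 5) (U0 _ 5)); apply: eq_bigr => i _; exact: UZ.
Qed.

Lemma U5_F : hecke_U 5 F = G.
Proof.
rewrite G_dil; have := T_F (p := 5) isT isT; rewrite hecke_TE.
exact: fadd_eq0.
Qed.

Lemma U5_s : hecke_U 5 s = s.
Proof. by rewrite s_def UD U5_F G_dil U_dil // -G_dil addrC. Qed.

Lemma U5_G (f : Ft) : hecke_U 5 (G * f) = F * hecke_U 5 f.
Proof. by rewrite G_dil U_dilM. Qed.

Definition dU k : Ft := hecke_U 5 (s ^+ k) + s ^+ k.

(** s^6 = G s + G^2 = F s + F^2. The first form is used under U5, which turns [G] into [F], and the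
    second outside, so both halves obey the same recursion over F_2[F]. *)
Lemma dU_rec k : dU (k + 6) = F * dU k.+1 + F ^+ 2 * dU k.
Proof.
have sG : s ^+ 6 = G * s + G * G by rewrite -FG_s6 s_def; ring2.
have sF : s ^+ 6 = F * s + F ^+ 2 by rewrite -FG_s6 s_def; ring2.
have e : s ^+ (k + 6) = G * s ^+ k.+1 + G * (G * s ^+ k).
  by rewrite exprD sG exprS; move: (s ^+ k) => x; ring2.
rewrite /dU {1}e UD !U5_G exprD sF.
move: (hecke_U 5 (s ^+ k)) (hecke_U 5 (s ^+ k.+1)) => x y; rewrite [s ^+ k.+1]exprS.
by move: (s ^+ k) => z; ring2.
Qed.

Lemma dU_sqr k : dU (k * 2) = dU k ^+ 2.
Proof. by rewrite /dU exprM U_sqr //; ring2. Qed.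

Lemma dU0 : dU 0 = 0. Proof. by rewrite /dU expr0 U_1 // faddff. Qed.
Lemma dU1 : dU 1 = 0. Proof. by rewrite /dU expr1 U5_s faddff. Qed.
Lemma dU2 : dU 2 = 0. Proof. by rewrite (dU_sqr 1) dU1 expr2 mul0r. Qed.
Lemma dU4 : dU 4 = 0. Proof. by rewrite (dU_sqr 2) dU2 expr2 mul0r. Qed.
Lemma dU3 : dU 3 = 0.
Proof.
apply: (@fexp_eq0 _ 2); rewrite -dU_sqr (dU_rec 0) dU1 dU0.
by rewrite !mulr0 addr0.
Qed.

Lemma val_neq0 v f : fval v f -> f <> 0.
Proof. by case=> fv _ f0; move: fv; rewrite f0 => /esym/eqP; rewrite oner_eq0. Qed.

(** Frobenius and the recursion give [dU 5 ^+ 2 = F * dU 5]; the coefficient at x, that of s^5 at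
    x^5, excludes 0. *)
Lemma dU5 : dU 5 = F.
Proof.
have d10 : dU 5 ^+ 2 = F * dU 5.
  by rewrite -dU_sqr (dU_rec 4) dU4 mulr0 addr0.
have [d0|] : dU 5 = 0 \/ dU 5 + F = 0; last exact: fadd_eq0.
  by apply: fmul_eq0; rewrite mulrDr -expr2 d10 mulrC faddff.
have [s5 s5'] := fvalX 5 val_s.
have : fcoef (dU 5) 1 = 1 by rewrite /dU fcoefD (s5' 1%N) // addr0.
by rewrite d0 => /esym/eqP; rewrite oner_eq0.
Qed.

Lemma dU_poly k : exists P : {poly 'F_2}, dU k = ev F P /\
  if (k %% 6 == 5)%N then (3 * size P)%N = k.+1 else (3 * size P < k.+1)%N.
Proof.
elim/ltn_ind: k => k IH; have [lt_k|ge_k] := ltnP k 6; last first.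
  have [P0 [e0 h0]] := IH (k - 6)%N ltac:(lia).
  have [P1 [e1 h1]] := IH (k - 6).+1 ltac:(lia).
  exists ('X * P1 + 'X^2 * P0); split.
    by rewrite -{1}(subnK ge_k) dU_rec e0 e1 evD [ev F ('X * P1)]evM [ev F ('X^2 * P0)]evM evX evXn.
  have s1 : (size ('X * P1)%R <= (size P1).+1)%N.
    by rewrite mulrC (leq_trans (size_polyMleq _ _)) // size_polyX addn2.
  have s2 : (size ('X^2 * P0)%R <= (size P0).+2)%N.
    by rewrite mulrC (leq_trans (size_polyMleq _ _)) // size_polyXn addn3.
  have h1' : (3 * size P1 <= (k - 6).+2)%N by move: h1; case: ifP => _; lia.
  case: ifP => k5.
    have k5' : ((k - 6) %% 6 == 5)%N by lia.
    rewrite k5' in h0; have P0n : P0 != 0 by rewrite -size_poly_eq0; lia.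
    have s2' : size ('X^2 * P0)%R = (size P0).+2.
      by rewrite mulrC size_mulXn.
    by rewrite addrC size_polyDl s2'; lia.
  have k5' : ((k - 6) %% 6 == 5)%N = false by lia.
  rewrite k5' /= in h0.
  have : (size ('X * P1 + 'X^2 * P0)%R <= maxn (size P1).+1 (size P0).+2)%N.
    by rewrite (leq_trans (size_polyD _ _)) // geq_max !leq_max s1 s2 orbT.
  move: (size _) (size P1) (size P0) h0 h1' => x y z h0 h1'.
  by have [_|_] := leqP y.+1 z.+2; lia.
have [->|k5] := eqVneq k 5%N; first by exists 'X; rewrite evX dU5 size_polyX.
exists 0; rewrite ev0 size_poly0; split; last by case: ifP => //; lia.
by move: k lt_k k5 {IH}; do 5?[case=> [*|]]; rewrite ?dU0 ?dU1 ?dU2 ?dU3 ?dU4 //; case.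
Qed.

(** The second clause is about degree n = 5 mod 6. By [dU_poly] the top term s^n gives a higher
    power of [F] than any s^i with i < n odd, so P cannot vanish. Oddness matters: it forces i <= n
    - 2. *)
Lemma pow_sum_poly (p : {poly 'F_2}) : exists P : {poly 'F_2},
  hecke_U 5 (ev s p) = ev s p + ev F P
  /\ ((forall i, ~~ odd i -> p`_i = 0) -> (size p %% 6)%N = 0%N -> P = 0 -> p = 0).
Proof.
pose Pk k := xget (0 : {poly 'F_2}) [set P | dU k = ev F P /\
  if (k %% 6 == 5)%N then (3 * size P)%N = k.+1 else (3 * size P < k.+1)%N]%classic.
have PkP k : dU k = ev F (Pk k) /\
    if (k %% 6 == 5)%N then (3 * size (Pk k))%N = k.+1 else (3 * size (Pk k) < k.+1)%N.
  exact: (xgetPex (0 : {poly 'F_2}) (dU_poly k)).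
exists (\sum_(i < size p) p`_i *: Pk i); split.
  rewrite (evS s (leqnn _)) (big_morph (ev F) (@evD F) (ev0 F)) U5_sum -big_split /=.
  apply: eq_bigr => i _; rewrite evZ -(proj1 (PkP i)) -scalerDr; congr (_ *: _).
  by rewrite /dU; ring2.
move=> odd_p; case def_n : (size p) => [|n] n6; first by move/eqP: def_n; rewrite size_poly_eq0 => /eqP.
rewrite big_ord_recr /= => sum0.
have pn : p`_n = 1.
  case: (F2_cases p`_n) => // p0; have : lead_coef p = 0 by rewrite lead_coefE def_n.
  by move/eqP; rewrite lead_coef_eq0 -size_poly_eq0 def_n.
have [_] := PkP n; have -> : (n %% 6 == 5)%N by lia.
move=> szn; exfalso.
have szsum : (size (\sum_(i < n) p`_i *: Pk i)%R < size (Pk n))%N.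
  rewrite -[X in (_ < X)%N]prednK; last by lia.
  rewrite ltnS; apply: (leq_trans (size_sum _ _ _)); apply/bigmax_leqP => i _.
  have [ev_i|od_i] := boolP (odd i); last by rewrite odd_p // scale0r size_poly0.
  apply: (leq_trans (size_scale_leq _ _)).
  have [_] := PkP i; have := ltn_ord i.
  have on : odd n by lia.
  case: ifP; lia.
have : size (\sum_(i < n) p`_i *: Pk i + p`_n *: Pk n) = size (Pk n).
  by rewrite pn scale1r addrC size_polyDl.
by rewrite sum0 size_poly0; lia.
Qed.

Definition oddp (p : {poly 'F_2}) := forall i, ~~ odd i -> p`_i = 0.
Definition evenp (p : {poly 'F_2}) := forall i, odd i -> p`_i = 0.

Lemma ev_sqr A p : ev A (p \Po 'X^2) = ev A p ^+ 2.
Proof.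
rewrite ev_comp evXn [RHS]sqr_dil sqr_dil; elim/poly_ind: p => [|p c IH]; first by rewrite !ev0 dil0.
rewrite !evD !evM !evX IH !evC dilD dilM //; congr (_ + _).
by case: (F2_cases c) => ->; rewrite ?scale0r ?dil0 // scale1r dil1.
Qed.

Lemma ev_even_odd A p :
  ev A p = ev A (even_poly p) ^+ 2 + A * ev A (odd_poly p) ^+ 2.
Proof.
by rewrite -[in LHS](poly_even_odd p) evD evM !ev_sqr evX [_ * A]mulrC.
Qed.

Lemma hom2_sqr (f : Ft) : hmod 2 0 (f ^+ 2).
Proof. by rewrite sqr_dil => n; rewrite fcoef_dil; case: ifP => [|_]; rewrite ?eqxx // dvdn2 => ev _; lia. Qed.

Lemma ev_decomp p : exists A B, ev r p = ev s A + r * ev s B.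
Proof.
elim/poly_ind: p => [|p c [A [B e]]].
  by exists 0, 0; rewrite !ev0 mulr0 addr0.
exists ('X * B + c%:P), (A + B).
rewrite !evD !evM evX e evC [ev s c%:P]evC [ev s 'X]evX -r_eq.
by move: (ev s A) (ev s B) (c *: 1) => a b d; ring2.
Qed.

Definition PS : {poly 'F_2} := 'X^2 + 'X.

Lemma ev_PS : ev r PS = s.
Proof. by rewrite evD evXn evX r_eq. Qed.

Lemma ev_PS1 : ev (r + 1) PS = s.
Proof. by rewrite evD evXn evX -r_eq; ring2. Qed.

(** Under r -> r + 1, which fixes s, the relation changes by [ev s B]; hence B = 0, then A = 0. *)
Lemma ev_free A B : ev s A + r * ev s B = 0 -> A = 0 /\ B = 0.
Proof.
move=> e; have := @ev_r_conj (A \Po PS + 'X * (B \Po PS)).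
rewrite !evD !evM !ev_comp !evX ev_PS ev_PS1 => /(_ e).
rewrite mulrDl mul1r addrA e add0r => /(ev_inj val_s) B0; split=> //.
by apply: (ev_inj val_s); move: e; rewrite B0 ev0 mulr0 addr0.
Qed.

Lemma oddp_comp p : oddp ('X * (p \Po 'X^2)).
Proof.
move=> [|i] oi; first by rewrite coefXM.
by rewrite coefXM /= coef_comp_poly_Xn // dvdn2; case: ifP => // h; exfalso; move: oi h => /=; case: odd.
Qed.

Lemma oddpD p q : oddp p -> oddp q -> oddp (p + q).
Proof. by move=> hp hq i oi; rewrite coefD hp // hq // addr0. Qed.

Lemma evenp_comp p : evenp (p \Po 'X^2).
Proof. by move=> i oi; rewrite coef_comp_poly_Xn // dvdn2 oi. Qed.

Lemma evenpD p q : evenp p -> evenp q -> evenp (p + q).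
Proof. by move=> hp hq i oi; rewrite coefD hp // hq // addr0. Qed.

(** s r = G + s^2 + s^3 trades r for [G], whose exponents are odd like those of s. Writing A and B
    through squares splits s f into a part [od] with odd exponents and a part [ee] with even ones.
    As f is odd, [od] = 0; freeness over F_2[s] then kills the even part of B and ties the even part
    of A to the odd part of B. *)
Lemma M_odd_decomp f : M_odd f ->
  exists A B, [/\ oddp A, evenp B & f = ev s A + G * ev s B].
Proof.
case=> -[p _ pE] odd_f; have {}pE : f = ev r p by rewrite -pE ev_def.
have hf : hmod 2 1 f.
  move=> n nz; have : odd n by apply: contraNT nz => /odd_f ->.
  by rewrite !modn2 => ->.
have [A [B e]] := ev_decomp p; rewrite -pE in e.
have sr : s * r = G + s ^+ 2 + s ^+ 3 by rewrite G_r -r_eq; ring2.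
have AE := ev_even_odd s A; have BE := ev_even_odd s B.
have [[a0 a0d] [a1 a1d]] : (exists a, a = ev s (even_poly A)) /\ exists a, a = ev s (odd_poly A).
  by clear; split; [exists (ev s (even_poly A)) | exists (ev s (odd_poly A))].
have [[b0 b0d] [b1 b1d]] : (exists b, b = ev s (even_poly B)) /\ exists b, b = ev s (odd_poly B).
  by clear; split; [exists (ev s (even_poly B)) | exists (ev s (odd_poly B))].
rewrite -a0d -a1d in AE; rewrite -b0d -b1d in BE.
pose od := s * a0 ^+ 2 + G * b0 ^+ 2 + s ^+ 3 * b0 ^+ 2 + s ^+ 3 * b1 ^+ 2.
pose ee := s * s * a1 ^+ 2 + s ^+ 2 * b0 ^+ 2 + G * s * b1 ^+ 2 + (s ^+ 2) ^+ 2 * b1 ^+ 2.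
have sf : s * f = od + ee.
  transitivity (s * ev s A + s * r * ev s B); first by rewrite e mulrDr mulrA.
  by rewrite sr AE BE /od /ee; ring2.
have h1s : hmod 2 1 s := hom_dvd (isT : 2 %| 4)%N hom_s.
have h1G : hmod 2 1 G := hom_mod (hom_dvd (isT : 2 %| 40)%N hom_G) (erefl : 5 = 1 %[mod 2])%N.
have h3s : hmod 2 1 (s ^+ 3) := hom_mod (homX (k := 3) h1s) (erefl : 3 * 1 = 1 %[mod 2])%N.
have hsq g h : hmod 2 1 g -> hmod 2 1 (g * h ^+ 2).
  by move=> hg; have := homM hg (@hom2_sqr h); rewrite addn0.
have hsq0 g h : hmod 2 0 g -> hmod 2 0 (g * h ^+ 2).
  by move=> hg; have := homM hg (@hom2_sqr h); rewrite addn0.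
have h2 g h : hmod 2 1 g -> hmod 2 1 h -> hmod 2 0 (g * h).
  by move=> hg hh; apply: (hom_mod (homM hg hh)).
have od0 : od = 0.
  apply: (@hom_disj 2 1 0) => //.
    by rewrite /od; do 3?[apply: homD]; apply: hsq.
  have -> : od = s * f + ee by rewrite sf; ring2.
  apply: homD; first exact: h2.
  by rewrite /ee; do 3?[apply: homD]; apply: hsq0; rewrite ?expr2; (exact: h2 || rewrite -expr2; exact: hom2_sqr).
have /ev_free [a0E b0E] : ev s ((even_poly A \Po 'X^2) + 'X * (even_poly B \Po 'X^2) +
    'X^2 * (odd_poly B \Po 'X^2)) + r * ev s (even_poly B \Po 'X^2) = 0.
  apply: (fmulI (val_neq0 val_s)); rewrite mulr0 -od0.
  rewrite !evD evM [ev s ('X^2 * _)]evM evX evXn !ev_sqr -a0d -b0d -b1d.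
  transitivity (s * a0 ^+ 2 + s ^+ 2 * b0 ^+ 2 + s ^+ 3 * b1 ^+ 2 + s * r * b0 ^+ 2); first by ring2.
  by rewrite sr /od; ring2.
have b00 : b0 = 0 by apply: (@fexp_eq0 _ 2); rewrite b0d -ev_sqr b0E ev0.
have a0b1 : a0 ^+ 2 = s ^+ 2 * b1 ^+ 2.
  have := congr1 (ev s) a0E; rewrite b0E mulr0 addr0 evD [ev s ('X^2 * _)]evM evXn !ev_sqr ev0.
  by rewrite -a0d -b1d; apply: fadd_eq0.
exists ('X * (odd_poly A \Po 'X^2) + 'X * (('X * odd_poly B) \Po 'X^2)), (odd_poly B \Po 'X^2).
split; [by apply: oddpD; exact: oddp_comp | exact: evenp_comp |].
rewrite evD !evM !ev_sqr evM evX -a1d -b1d e AE BE a0b1 b00.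
transitivity (s ^+ 2 * b1 ^+ 2 + s * a1 ^+ 2 + s * r * b1 ^+ 2); first by ring2.
by rewrite sr; ring2.
Qed.

Definition PF : {poly 'F_2} := PS * ('X + 1) ^+ 4.

Lemma ev_PF : ev r PF = F.
Proof. by rewrite evM evE evD evX ev1 ev_PS -F_r. Qed.

Lemma ev_PF1 : ev (r + 1) PF = G.
Proof. by rewrite evM evE evD evX ev1 ev_PS1 G_r; ring2. Qed.

Lemma evSl A (Q : {poly 'F_2}) n : (size Q <= n.+1)%N ->
  ev A Q = Q`_0 *: 1 + \sum_(k < n) Q`_k.+1 *: A ^+ k.+1.
Proof. by move/(evS A) ->; rewrite big_ord_recl expr0. Qed.

(** A^k + B^k has order k for k > 0, so these sums are independent and only the constant of Q is
    free. *)
Lemma ev_indep2 A B (Q : {poly 'F_2}) : fval 1 A -> fval 5 B ->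
  ev A Q = ev B Q -> Q = (Q`_0)%:P.
Proof.
move=> vA vB e; have [n szQ] : exists n, (size Q <= n.+1)%N by exists (size Q).
have sum0 : \sum_(k < n) Q`_k.+1 *: (A ^+ k.+1 + B ^+ k.+1) = 0.
  have := faddff (ev A Q); rewrite {2}e (evSl A szQ) (evSl B szQ).
  move=> e2; under eq_bigr => k _ do rewrite scalerDr.
  by rewrite big_split; move: e2; rewrite addrACA faddff add0r.
have ind := @val_indep (fun k => A ^+ k.+1 + B ^+ k.+1) S _ _ n (fun k => Q`_k.+1) sum0.
apply/polyP => -[|i]; rewrite coefC //=.
have [lt_i|le_i] := ltnP i n; last by rewrite nth_default // (leq_trans szQ).
apply: ind; [by [] | move=> k | exact: lt_i].
have := fvalD (fvalX k.+1 vA) (fvalX k.+1 vB); rewrite muln1; apply.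
by rewrite -{1}[k.+1]muln1 ltn_pmul2l.
Qed.

(** With f = a + G b, invariance under U5 makes s b = (F + G) b a polynomial Q in [F]. The
    automorphism r -> r + 1 fixes s b and exchanges [F] and [G], so Q(F) = Q(G). Then Q is constant,
    hence 0, and b = 0. *)
Lemma K_poly f : K f -> exists A, oddp A /\ f = ev s A.
Proof.
case=> /M_odd_decomp [A [B [oA eB fE]]] /fadd_eq0 Uf.
have [PA [eA _]] := pow_sum_poly A; have [PB [e2 _]] := pow_sum_poly B.
have sB : s * ev s B = ev F (PA + 'X * PB).
  rewrite fE UD U5_G eA e2 in Uf; rewrite evD evM evX.
  move: Uf; move: (ev s A) (ev s B) (ev F PA) (ev F PB) => a b c d Uf.
  apply: fadd_eq0; transitivity (a + c + F * (b + d) + (a + G * b)); first by rewrite s_def; ring2.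
  by rewrite Uf faddff.
have sB' : s * ev s B = ev G (PA + 'X * PB).
  apply: fadd_eq0; have := @ev_r_conj (PS * (B \Po PS) + ((PA + 'X * PB) \Po PF)).
  have evr x : ev x (PS * (B \Po PS) + ((PA + 'X * PB) \Po PF)) =
      ev x PS * ev (ev x PS) B + ev (ev x PF) (PA + 'X * PB).
    by rewrite [LHS]evD (@evM x PS (B \Po PS)) !ev_comp.
  by rewrite !evr ev_PS ev_PS1 ev_PF ev_PF1; apply; rewrite sB faddff.
have /(ev_indep2 val_F val_G) QE : ev F (PA + 'X * PB) = ev G (PA + 'X * PB) by rewrite -sB.
move: (_`_0) QE => c QE.
have q0 : c = 0.
  have := congr1 (fun f => fcoef f 0) sB; rewrite QE evC fcoefM0 s0 mul0r.
  by rewrite fcoefZ mulr1 => <-.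
have /fmul_eq0 [s_0|B0] : s * ev s B = 0 by rewrite sB QE q0 ev0.
  by case: (val_neq0 val_s).
by exists A; split=> //; rewrite fE B0 mulr0 addr0.
Qed.

Lemma odd_fps_ev A : oddp A -> odd_fps (ev s A).
Proof.
move=> oA n ev_n; rewrite (evS s (leqnn _)) fcoef_sum big1 // => i _.
rewrite fcoefZ; have [oi|ei] := boolP (odd i); last by rewrite oA // mul0r.
apply/eqP; rewrite mulf_eq0; apply/orP; right; apply/negPn/negP => nz.
have := homX (k := i) (hom_dvd (isT : 2 %| 4)%N hom_s) nz; rewrite muln1 !modn2 oi.
by rewrite (negbTE ev_n).
Qed.

Lemma poly_K A : oddp A -> hecke_U 5 (ev s A) = ev s A -> K (ev s A).
Proof.
move=> oA UA; split; last by rewrite UA faddff.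
split; last exact: odd_fps_ev.
by exists (A \Po PS) => //; rewrite -ev_def ev_comp ev_PS.
Qed.

Lemma K_size A : oddp A -> hecke_U 5 (ev s A) = ev s A -> A != 0 -> (size A %% 6 != 0)%N.
Proof.
move=> oA UA; have [P [e h]] := pow_sum_poly A.
apply: contraNN => /eqP sz; apply/eqP; apply: h => //.
apply: (ev_inj val_F); move: e; rewrite UA -{1}[ev s A]addr0.
by move/addrI.
Qed.

(** * The projection pr and a basis of K *)

(** The subgroup of the units mod 20 generated by 3. It contains 7, so multiplication by 3 or 7
    preserves both this set and its complement. *)
Definition inH (n : nat) := (n %% 20 \in [:: 1; 3; 7; 9])%N.

Definition pr (f : Ft) : Ft := Fps (fun n => if inH n then fcoef f n else 0).

Lemma prD (f g : Ft) : pr (f + g) = pr f + pr g.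
Proof. by apply: fps_eqP => n /=; case: ifP; rewrite ?addr0. Qed.

Lemma prZ a (f : Ft) : pr (a *: f) = a *: pr f.
Proof. by apply: fps_eqP => n /=; case: ifP; rewrite ?mulr0. Qed.

Lemma pr0 : pr 0 = 0.
Proof. by apply: fps_eqP => n /=; case: ifP. Qed.

Lemma inH_mod n : inH (n %% 20) = inH n.
Proof. by rewrite /inH modn_mod. Qed.

Lemma inH37 p n : (p == 3) || (p == 7) -> inH (p * n) = inH n.
Proof.
move=> p37; rewrite /inH -modnMmr; move: (ltn_pmod n (isT : 0 < 20)%N).
by move: (n %% 20)%N; case/orP: p37 => /eqP ->; do 20?[case=> //].
Qed.

Lemma pr_T p (f : Ft) : (p == 3) || (p == 7) -> pr (hecke_T p f) = hecke_T p (pr f).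
Proof.
move=> p37; apply: fps_eqP => n; rewrite /= inH37 //.
case: (boolP (p %| n)%N) => [/dvdnP [m ->]|_]; last by case: ifP; rewrite ?addr0.
have p0 : (0 < p)%N by case/orP: p37 => /eqP ->.
by rewrite mulnK // [in inH (m * p)]mulnC inH37 //; case: ifP; rewrite ?addr0.
Qed.

Lemma pr_hmod a f : hmod 20 a f -> ~~ inH a -> pr f = 0.
Proof.
move=> hf na; apply: fps_eqP => n /=; case: ifP => // h.
by apply/eqP/negPn/negP => /hf e; move: na; rewrite -inH_mod -e inH_mod h.
Qed.

Lemma pr_mul (f g : Ft) : hmod 20 0 g -> pr (g * f) = g * pr f.
Proof.
move=> hg; apply: fps_eqP => n; rewrite [LHS]/= !fcoefM.
case: ifP => hn; [apply: eq_bigr => i _|symmetry; apply: big1 => i _] => /=;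
  (have [->|/hg gi] := eqVneq (fcoef g i) 0; first by rewrite !mul0r);
  have -> : inH (n - i) = inH n by
    [rewrite -inH_mod -[in RHS]inH_mod -[in RHS](subnK (leq_ord i)) -modnDmr gi mod0n addn0].
  by rewrite hn.
by rewrite hn mulr0.
Qed.

Lemma pr_val v f : inH v -> fval v f -> fval v (pr f).
Proof.
by move=> hv [f1 f0]; split=> [|i lt_i] /=; [rewrite hv | rewrite f0 ?if_same].
Qed.

Definition u : Ft := G ^+ 4.

Lemma hmod_G20 : hmod 20 5 G.
Proof. exact: (hom_dvd (isT : 20 %| 40)%N hom_G). Qed.

Lemma hmod_u : hmod 20 0 u.
Proof. exact: (hom_mod (homX (k := 4) hmod_G20)). Qed.

(* Such relations trade G * ev s b for ev s a modulo the kernel of pr, in a way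
   compatible with U5; they allow multiplication by u to be lifted to K. *)
Definition kapp (a b : {poly 'F_2}) :=
  pr (ev s a + G * ev s b) = 0 /\
  hecke_U 5 (ev s a + G * ev s b) = ev s a + F * ev s b.

Lemma kappD a b a' b' : kapp a b -> kapp a' b' -> kapp (a + a') (b + b').
Proof.
case=> [p1 u1] [p2 u2]; have e : ev s (a + a') + G * ev s (b + b') =
    (ev s a + G * ev s b) + (ev s a' + G * ev s b').
  by rewrite !evD mulrDr addrACA.
split; rewrite e; first by rewrite prD p1 p2 addr0.
by rewrite UD u1 u2 !evD mulrDr addrACA.
Qed.

Lemma u_sG : u = s ^+ 3 * G + s ^+ 8 + s ^+ 12.
Proof.
have sG : G ^+ 2 = s * G + s ^+ 6 by rewrite -FG_s6 s_def; ring2.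
transitivity ((G ^+ 2) ^+ 2); first by rewrite /u -exprM.
rewrite sG; transitivity (s ^+ 2 * G ^+ 2 + s ^+ 12); first by ring2.
by rewrite sG; ring2.
Qed.

Lemma F4_sF : F ^+ 4 = s ^+ 3 * F + s ^+ 8 + s ^+ 12.
Proof.
have sG : F ^+ 2 = s * F + s ^+ 6 by rewrite -FG_s6 s_def; ring2.
transitivity ((F ^+ 2) ^+ 2); first by rewrite -exprM.
rewrite sG; transitivity (s ^+ 2 * F ^+ 2 + s ^+ 12); first by ring2.
by rewrite sG; ring2.
Qed.

Lemma U5_u (f : Ft) : hecke_U 5 (u * f) = F ^+ 4 * hecke_U 5 f.
Proof. by rewrite /u G_dil -dilX // U_dilM. Qed.

(** The coefficients are those of multiplication by [u] on the basis 1, G over F_2[s]: u = s^12 +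
    s^8 + s^3 G and u G = s^9 + (s^12 + s^8 + s^4) G. The same formulas hold for F^4 and [F], whence
    the U5 clause. *)
Lemma kappG a b : kapp a b ->
  kapp (('X^12 + 'X^8) * a + 'X^9 * b) ('X^3 * a + ('X^12 + 'X^8 + 'X^4) * b).
Proof.
have evP x : ev s (('X^12 + 'X^8) * a + 'X^9 * b) + x * ev s ('X^3 * a + ('X^12 + 'X^8 + 'X^4) * b)
   = (s ^+ 12 + s ^+ 8) * ev s a + s ^+ 9 * ev s b + x * (s ^+ 3 * ev s a + (s ^+ 12 + s ^+ 8 + s ^+ 4) * ev s b).
  by rewrite [ev s (_ + 'X^9 * b)]evD [ev s (_ * a + _ * b)]evD [ev s (_ * a)]evM
     [ev s ('X^9 * b)]evM [ev s ('X^3 * a)]evM [ev s (_ * b)]evM !evD !evXn.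
have sG : G ^+ 2 = s * G + s ^+ 6 by rewrite -FG_s6 s_def; ring2.
have sF : F ^+ 2 = s * F + s ^+ 6 by rewrite -FG_s6 s_def; ring2.
move=> [p1 u1]; rewrite /kapp !evP; move: (ev s a) (ev s b) p1 u1 => x y p1 u1.
have -> : (s ^+ 12 + s ^+ 8) * x + s ^+ 9 * y + G * (s ^+ 3 * x + (s ^+ 12 + s ^+ 8 + s ^+ 4) * y)
    = u * (x + G * y).
  transitivity ((s ^+ 3 * G + s ^+ 8 + s ^+ 12) * x + s ^+ 3 * (s * G + s ^+ 6) * y + (s ^+ 8 + s ^+ 12) * G * y).
    by ring2.
  by rewrite -sG u_sG; ring2.
split; first by rewrite pr_mul ?p1 ?mulr0 //; exact: hmod_u.
rewrite U5_u u1.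
transitivity ((s ^+ 3 * F + s ^+ 8 + s ^+ 12) * x + s ^+ 3 * F ^+ 2 * y + (s ^+ 8 + s ^+ 12) * F * y).
  by rewrite F4_sF; ring2.
by rewrite sF; ring2.
Qed.

Lemma U5_GsX b : hecke_U 5 (G * s ^+ b) = F * (s ^+ b + dU b).
Proof. by rewrite U5_G; congr (_ * _); rewrite /dU; ring2. Qed.

Lemma U5_sX b : hecke_U 5 (s ^+ b) = s ^+ b + dU b.
Proof. by rewrite /dU; ring2. Qed.

Lemma dU_small : [/\ dU 6 = 0, dU 7 = 0, dU 8 = 0, dU 9 = 0 & dU 10 = F ^+ 2 /\ dU 11 = F ^+ 3].
Proof.
have d6 : dU 6 = 0 by rewrite (dU_rec 0) dU1 dU0 !mulr0 addr0.
split=> //.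
- by rewrite (dU_rec 1) dU2 dU1 !mulr0 addr0.
- by rewrite (dU_rec 2) dU2 dU3 !mulr0 addr0.
- by rewrite (dU_rec 3) dU3 dU4 !mulr0 addr0.
- by rewrite (dU_rec 4) (dU_rec 5) dU5 dU4 d6; split; ring2.
Qed.

(** P, Q, e, g, G have exponents 1, 9, 5, 5, 5 mod 20. Each series is rewritten by s = P + Q + e, F
    = P + Q + g and P Q = e^2 as a sum of monomials of classes 5, 11, 13, 15, 17 or 19, all outside
    [inH]. *)
Lemma kap_pr : [/\ pr G = 0, pr (s ^+ 7 + G * s ^+ 2) = 0, pr (s ^+ 9 + G * s ^+ 4) = 0,
  pr (G * s ^+ 6) = 0 & pr (G * s ^+ 8) = 0 /\ pr (s ^+ 11 + G * s ^+ 10) = 0].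
Proof.
have hP := hom_pm1; have hQ := hom_pm3; have hG := hmod_G20.
have hg : hmod 20 5 (dil 5 G) := hom_mod (hom_dvd (isT : 20 %| 40)%N hom_g) (erefl : 25 = 5 %[mod 20])%N.
have PQ := pm1_pm3; have GE := pm1_pm3_exp5; have FE := theta_split5.
have e5 : dil 5 s = G + dil 5 G by rewrite s_def dilD -G_dil.
have he : hmod 20 5 (dil 5 s) by rewrite e5; apply: homD.
have sE : s = theta pm1 1 + theta pm3 1 + dil 5 s.
  by rewrite e5 {1}s_def {1}FE; move: (dil 5 G) => g; ring2.
move: (theta pm1 1) (theta pm3 1) (dil 5 s) (dil 5 G) hP hQ he hg PQ GE FE sE {e5}.
move=> P Q e g hP hQ he hg PQ GE FE sE.
have pz a f : hmod 20 a f -> ~~ inH a -> pr f = 0 by exact: pr_hmod.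
have sG : s ^+ 6 = s * G + G ^+ 2 by rewrite -FG_s6 s_def; ring2.
have s8 : s ^+ 8 = P ^+ 8 + Q ^+ 8 + e ^+ 8 by rewrite sE; ring2.
do ?split.
- exact: (pz 5%N).
- have -> : s ^+ 7 + G * s ^+ 2 = s * G ^+ 2.
    by rewrite exprSr sG; ring2.
  rewrite {1}sE !mulrDl !prD.
  rewrite (pz _ _ (homM hP (homX (k := 2) hG))) // (pz _ _ (homM hQ (homX (k := 2) hG))) //.
  by rewrite (pz _ _ (homM he (homX (k := 2) hG))) // !addr0.
- have -> : s ^+ 9 + G * s ^+ 4 = P ^+ 7 * e ^+ 2 + Q ^+ 7 * e ^+ 2 + P ^+ 8 * e + Q ^+ 8 * e + e ^+ 9 + G * e ^+ 4.
    have z0 : P * Q + e ^+ 2 = 0 by rewrite PQ faddff.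
    transitivity (P ^+ 7 * e ^+ 2 + Q ^+ 7 * e ^+ 2 + P ^+ 8 * e + Q ^+ 8 * e + e ^+ 9 + G * e ^+ 4
      + (P * Q + e ^+ 2) * (P ^+ 7 + Q ^+ 7) + (P * Q + e ^+ 2) ^+ 4 * (P + Q)).
      by rewrite sE -GE; ring2.
    by rewrite z0 expr0n !mul0r !addr0.
  rewrite !prD (pz _ _ (homM (homX (k := 7) hP) (homX (k := 2) he))) //.
  rewrite (pz _ _ (homM (homX (k := 7) hQ) (homX (k := 2) he))) //.
  rewrite (pz _ _ (homM (homX (k := 8) hP) he)) // (pz _ _ (homM (homX (k := 8) hQ) he)) //.
  by rewrite (pz _ _ (homX (k := 9) he)) // (pz _ _ (homM hG (homX (k := 4) he))) // !addr0.
- have -> : G * s ^+ 6 = F * G ^+ 2 by rewrite -FG_s6; ring2.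
  rewrite {1}FE !mulrDl !prD.
  rewrite (pz _ _ (homM hP (homX (k := 2) hG))) // (pz _ _ (homM hQ (homX (k := 2) hG))) //.
  by rewrite (pz _ _ (homM hg (homX (k := 2) hG))) // !addr0.
- rewrite s8 !mulrDr !prD.
  rewrite (pz _ _ (homM hG (homX (k := 8) hP))) // (pz _ _ (homM hG (homX (k := 8) hQ))) //.
  by rewrite (pz _ _ (homM hG (homX (k := 8) he))) // !addr0.
- have -> : s ^+ 11 + G * s ^+ 10 = P ^+ 6 * G + Q ^+ 6 * G + P ^+ 4 * g ^+ 2 * G
     + Q ^+ 4 * g ^+ 2 * G + e ^+ 4 * g ^+ 2 * G.
    have z0 : P * Q + e ^+ 2 = 0 by rewrite PQ faddff.
    transitivity (s ^+ 4 * F ^+ 2 * G).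
      transitivity (s ^+ 10 * F); first by rewrite s_def; ring2.
      by rewrite (exprD s 4 6) -FG_s6; ring2.
    transitivity ((P ^+ 6 + Q ^+ 6 + P ^+ 4 * g ^+ 2
     + Q ^+ 4 * g ^+ 2 + e ^+ 4 * g ^+ 2 + (P ^+ 2 + Q ^+ 2) * (P * Q + e ^+ 2) ^+ 2) * G).
      by congr (_ * _); rewrite sE FE; ring2.
    by rewrite z0 expr0n mulr0 addr0; ring2.
  rewrite !prD (pz _ _ (homM (homX (k := 6) hP) hG)) // (pz _ _ (homM (homX (k := 6) hQ) hG)) //.
  rewrite (pz _ _ (homM (homM (homX (k := 4) hP) (homX (k := 2) hg)) hG)) //.
  rewrite (pz _ _ (homM (homM (homX (k := 4) hQ) (homX (k := 2) hg)) hG)) //.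
  by rewrite (pz _ _ (homM (homM (homX (k := 4) he) (homX (k := 2) hg)) hG)) // !addr0.
Qed.

Lemma kapp_base m : (m < 6)%N -> exists a b, [/\ oddp a, evenp b,
  size b = m.*2.+1, (size a <= m.*2 + 6)%N & kapp a b].
Proof.
have [d6 d7 d8 d9 [d10 d11]] := dU_small.
have oX k : odd k -> oddp 'X^k by move=> ok i; rewrite coefXn; case: eqP => // ->; rewrite ok.
have eX k : ~~ odd k -> evenp 'X^k by move=> ok i; rewrite coefXn; case: eqP => // ->; rewrite (negbTE ok).
have o0 : oddp 0 by move=> i; rewrite coef0.
have [p1 p2 p3 p4 [p5 p6]] := kap_pr.
case: m => [|[|[|[|[|[|//]]]]]] _.
- exists 0, 1; rewrite size_poly0 size_poly1; split=> //; first exact: (eX 0%N).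
  rewrite /kapp ev0 ev1 mulr1 add0r; split=> //.
  by rewrite -[G]mulr1 -[X in G * X](expr0 s) U5_GsX dU0 expr0 addr0 add0r.
- exists 'X^7, 'X^2; rewrite !size_polyXn; split=> //; [exact: oX|exact: eX|].
  rewrite /kapp !evXn; split=> //.
  by rewrite UD (U5_sX 7) (U5_GsX 2) d7 dU2 !addr0.
- exists 'X^9, 'X^4; rewrite !size_polyXn; split=> //; [exact: oX|exact: eX|].
  rewrite /kapp !evXn; split=> //.
  by rewrite UD (U5_sX 9) (U5_GsX 4) d9 dU4 !addr0.
- exists 0, 'X^6; rewrite !size_polyXn size_poly0; split=> //; first exact: eX.
  rewrite /kapp !evXn ev0 !add0r; split=> //.
  by rewrite U5_GsX d6 addr0.
- exists 0, 'X^8; rewrite !size_polyXn size_poly0; split=> //; first exact: eX.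
  rewrite /kapp !evXn ev0 !add0r; split=> //.
  by rewrite U5_GsX d8 addr0.
- exists 'X^11, 'X^10; rewrite !size_polyXn; split=> //; [exact: oX|exact: eX|].
  rewrite /kapp !evXn; split=> //.
  have e11 : hecke_U 5 (s ^+ 11) = s ^+ 11 + F ^+ 3 by rewrite U5_sX d11.
  have e10 : hecke_U 5 (G * s ^+ 10) = F * (s ^+ 10 + F ^+ 2) by rewrite U5_GsX d10.
  apply: (etrans (UD 5 _ _)); apply: (etrans (congr2 +%R e11 e10)).
  by clear; move: (s ^+ 11) (s ^+ 10) F => x y f; ring2.
Qed.

Lemma oddpMX (n : nat) p : ~~ odd n -> oddp p -> oddp ('X^n * p).
Proof.
move=> en op i oi; rewrite coefXnM; case: ltnP => // le_n.
by rewrite op // oddB // (negbTE en) addbF.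
Qed.

Lemma oddpMX_odd (n : nat) p : odd n -> evenp p -> oddp ('X^n * p).
Proof.
move=> en op i oi; rewrite coefXnM; case: ltnP => // le_n.
by rewrite op // oddB // en (negbTE oi).
Qed.

Lemma evenpMX (n : nat) p : ~~ odd n -> evenp p -> evenp ('X^n * p).
Proof.
move=> en op i oi; rewrite coefXnM; case: ltnP => // le_n.
by rewrite op // oddB // (negbTE en) oi.
Qed.

Lemma evenpMX_odd (n : nat) p : odd n -> oddp p -> evenp ('X^n * p).
Proof.
move=> en op i oi; rewrite coefXnM; case: ltnP => // le_n.
by rewrite op // oddB // en oi.
Qed.

Lemma size_XnM n (p : {poly 'F_2}) : p != 0 -> size ('X^n * p)%R = (n + size p)%N.
Proof. by move=> p0; rewrite mulrC size_mulXn. Qed.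

Lemma size_XnM_leq n (p : {poly 'F_2}) : (size ('X^n * p)%R <= n + size p)%N.
Proof.
have [->|/size_XnM -> //] := eqVneq p 0; by rewrite mulr0 size_poly0.
Qed.

(** The base relations have b of degrees 0, 2, ..., 10, and multiplication by [u] adds 12. The bound
    on the size of a keeps 'X^12 b dominant in the new b. *)
Lemma kapp_lead m : exists a b, [/\ oddp a, evenp b,
  size b = m.*2.+1, (size a <= m.*2 + 6)%N & kapp a b].
Proof.
elim/ltn_ind: m => m IH; have [/kapp_base //|m6] := ltnP m 6.
have [a [b [oa eb szb sza ab]]] := IH (m - 6)%N ltac:(lia).
have b0 : b != 0 by rewrite -size_poly_eq0 szb.
exists (('X^12 + 'X^8) * a + 'X^9 * b), ('X^3 * a + ('X^12 + 'X^8 + 'X^4) * b).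
have h1 := size_XnM_leq 12 a; have h2 := size_XnM_leq 8 a.
have h3 := size_XnM_leq 9 b; have h4 := size_XnM_leq 3 a.
have h5 := size_XnM 12 b0; have h6 := size_XnM_leq 8 b; have h7 := size_XnM_leq 4 b.
split; last exact: kappG.
- by rewrite mulrDl; do 2?[apply: oddpD]; [exact: oddpMX|exact: oddpMX|exact: oddpMX_odd].
- by rewrite !mulrDl; do 3?[apply: evenpD]; [exact: evenpMX_odd|exact: evenpMX|exact: evenpMX|exact: evenpMX].
- have -> : 'X^3 * a + ('X^12 + 'X^8 + 'X^4) * b = 'X^12 * b + ('X^8 * b + 'X^4 * b + 'X^3 * a).
    by rewrite !mulrDl addrC -!addrA.
  rewrite size_polyDl; first by rewrite h5; lia.
  rewrite h5; apply: leq_ltn_trans (size_polyD _ _) _; rewrite gtn_max; apply/andP; split; last by lia.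
  by apply: leq_ltn_trans (size_polyD _ _) _; rewrite gtn_max; lia.
rewrite mulrDl; apply: leq_trans (size_polyD _ _) _; rewrite geq_max; apply/andP; split; last by lia.
by apply: leq_trans (size_polyD _ _) _; rewrite geq_max; lia.
Qed.

Lemma poly_addff (p : {poly 'F_2}) : p + p = 0.
Proof. by apply/polyP => i; rewrite coefD coef0 F2_addxx. Qed.

Lemma lead_coef1 (p : {poly 'F_2}) : p != 0 -> lead_coef p = 1.
Proof. by rewrite -lead_coef_eq0; case: (F2_cases (lead_coef p)) => ->; rewrite ?eqxx. Qed.

Lemma size_cancel (p q : {poly 'F_2}) : p != 0 -> size p = size q ->
  (size (p + q)%R < size p)%N.
Proof.
move=> p0 szpq; have q0 : q != 0 by rewrite -size_poly_eq0 -szpq size_poly_eq0.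
have szp : (0 < size p)%N by rewrite size_poly_gt0.
rewrite -[X in (_ < X)%N](prednK szp) ltnS; apply/leq_sizeP => i le_i; rewrite coefD.
have [->|ne] := eqVneq i (size p).-1.
  by rewrite -lead_coefE {1}szpq -lead_coefE !lead_coef1 // F2_addxx.
have lt_i : (size p <= i)%N by lia.
by rewrite !nth_default ?addr0 // -szpq.
Qed.

Lemma size_evenp (p : {poly 'F_2}) : p != 0 -> evenp p -> odd (size p).
Proof.
move=> p0 ep; have := lead_coef1 p0; rewrite lead_coefE.
case: (size p) (size_poly_gt0 p) => [|n] /=; rewrite ?p0 // => _ pn.
by apply/negP => /ep pn0; move/eqP: pn; rewrite pn0 eq_sym oner_eq0.
Qed.

Lemma kapp_ex b : evenp b -> exists a, [/\ oddp a, (size a <= size b + 5)%N & kapp a b].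
Proof.
have [n] := ubnP (size b); elim: n b => // n IH b lt_n eb.
have [->|b0] := eqVneq b 0.
  exists 0; split; [by move=> i; rewrite coef0|by rewrite size_poly0|].
  by split; rewrite !ev0 !mulr0 addr0 ?pr0 ?U0.
have ob := size_evenp b0 eb.
have [a1 [b1 [oa1 eb1 szb1 sza1 ab1]]] := kapp_lead (size b)./2.
have szE : size b = size b1 by rewrite szb1; lia.
have lt_sz := size_cancel b0 szE.
have [a2 [oa2 sza2 ab2]] := IH (b + b1) (leq_trans lt_sz (lt_n : (size b <= n)%N)) (evenpD eb eb1).
exists (a2 + a1); split; first exact: oddpD.
  by apply: leq_trans (size_polyD _ _) _; rewrite geq_max; lia.
by have := kappD ab2 ab1; rewrite -addrA poly_addff addr0.
Qed.

Definition inK (A : {poly 'F_2}) := oddp A /\ hecke_U 5 (ev s A) = ev s A.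

(** u f = (s^12 + s^8) f + G s^3 f, and [kapp_ex] replaces the last term by a polynomial a in s
    without changing [pr]. Its size is at most size A + 8, so 'X^12 A stays the leading part. *)
Lemma lift_ex A : A != 0 -> inK A ->
  exists A', [/\ inK A', size A' = (size A + 12)%N & pr (ev s A') = u * pr (ev s A)].
Proof.
move=> A0 [oA UA]; have eB : evenp ('X^3 * A) by exact: evenpMX_odd.
have [a [oa sza [pa ua]]] := kapp_ex eB; rewrite size_XnM // in sza.
exists ('X^12 * A + 'X^8 * A + a).
have evA' : ev s ('X^12 * A + 'X^8 * A + a) = s ^+ 12 * ev s A + s ^+ 8 * ev s A + ev s a.
  by rewrite 2!evD (@evM _ 'X^12) (@evM _ 'X^8) !evXn.
have evB : ev s ('X^3 * A) = s ^+ 3 * ev s A by rewrite (@evM _ 'X^3) evXn.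
rewrite evB in pa ua.
have evE : ev s ('X^12 * A + 'X^8 * A + a) = u * ev s A + (ev s a + G * (s ^+ 3 * ev s A)).
  by rewrite evA' u_sG; move: (ev s A) (ev s a) => x y; ring2.
split; last by rewrite evE prD pr_mul ?pa ?addr0 //; exact: hmod_u.
  split; first by do 2?[apply: oddpD] => //; exact: oddpMX.
  rewrite evE UD U5_u ua UA F4_sF u_sG; move: (ev s A) (ev s a) => x y.
  by ring2.
have h1 := size_XnM 12 A0; have h2 := size_XnM 8 A0.
rewrite -addrA size_polyDl; first by rewrite h1 addnC.
apply: leq_ltn_trans (size_polyD _ _) _; rewrite gtn_max h1 h2.
by have := size_poly_gt0 A; rewrite A0; lia.
Qed.

Definition isc (c : nat) := c \in [:: 1; 3; 7; 9]%N.

Definition vb (j c : nat) : Ft := u ^+ j * pr (s ^+ c).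

Lemma vb_ex j c : isc c -> exists A,
  [/\ inK A, size A = ((12 * j + c).+1)%N & pr (ev s A) = vb j c].
Proof.
move=> hc; elim: j => [|j [A [kA szA prA]]]; last first.
  have A0 : A != 0 by rewrite -size_poly_eq0 szA.
  have [A' [kA' szA' prA']] := lift_ex A0 kA; exists A'; split=> //.
    by rewrite szA' szA; lia.
  by rewrite prA' prA /vb exprS mulrA.
exists 'X^c; rewrite size_polyXn muln0 add0n evXn /vb expr0 mul1r; split=> //.
have [_ d7 _ d9 _] := dU_small; split.
  by move=> i; rewrite coefXn; case: eqP => // ->; move: hc; rewrite /isc !inE => /or4P [] /eqP ->.
rewrite evXn U5_sX; suff -> : dU c = 0 by rewrite addr0.
by move: hc; rewrite /isc !inE => /or4P [] /eqP ->; [exact: dU1|exact: dU3|exact: d7|exact: d9].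
Qed.

Lemma val_u : fval 20 u. Proof. exact: (fvalX 4 val_G). Qed.

Lemma val_vb j c : isc c -> fval (20 * j + c)%N (vb j c).
Proof.
move=> hc; rewrite mulnC; apply: (@fvalM _ _ (u ^+ j) (pr (s ^+ c))).
  exact: fvalX val_u.
apply: pr_val; last by have := fvalX c val_s; rewrite muln1.
by move: hc; rewrite /isc !inE => /or4P [] /eqP ->.
Qed.

(** * Initial values of the recursions, by computation *)

(* Polynomials in s are computed with as lists of coefficients. *)
Definition b2f (b : bool) : Ft := if b then 1 else 0.

Fixpoint evb (l : seq bool) : Ft := if l is b :: l' then b2f b + s * evb l' else 0.

Fixpoint xorl (l1 l2 : seq bool) : seq bool :=
  match l1, l2 with
  | b1 :: l1', b2 :: l2' => xorb b1 b2 :: xorl l1' l2'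
  | [::], _ => l2
  | _, [::] => l1
  end.

Definition shl n (l : seq bool) : seq bool := nseq n false ++ l.

Arguments shl : simpl never.

Lemma b2f_xor b1 b2 : b2f (xorb b1 b2) = b2f b1 + b2f b2.
Proof. by case: b1; case: b2; rewrite /b2f /= ?addr0 ?add0r ?faddff. Qed.

Lemma evb_xor l1 l2 : evb (xorl l1 l2) = evb l1 + evb l2.
Proof.
elim: l1 l2 => [|b1 l1 IH] [|b2 l2]; rewrite /= ?add0r ?addr0 //.
by rewrite b2f_xor IH mulrDr addrACA.
Qed.

Arguments xorl : simpl never.

Lemma evb_shl n l : evb (shl n l) = s ^+ n * evb l.
Proof.
elim: n => [|n IH]; first by rewrite expr0 mul1r.
by rewrite -[LHS]/(0 + s * evb (shl n l)) IH add0r exprS mulrA.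
Qed.

Lemma evb_zero l : all negb l -> evb l = 0.
Proof. by elim: l => //= -[] //= l IH /IH ->; rewrite add0r mulr0. Qed.

Lemma evb_eq l1 l2 : all negb (xorl l1 l2) -> evb l1 = evb l2.
Proof. by move/evb_zero; rewrite evb_xor; exact: fadd_eq0. Qed.

(* The state t0 .. t3 holds T3 (s^k) .. T3 (s^(k+3)), advanced by T3_s4. *)
Fixpoint T3go (l : seq bool) (t0 t1 t2 t3 : seq bool) : seq bool :=
  if l is b :: l' then
    let t4 := xorl (shl 2 t2) (xorl (shl 1 t1) (shl 4 t0)) in
    xorl (if b then t0 else [::]) (T3go l' t1 t2 t3 t4)
  else [::].

Definition T3l l := T3go l [::] [::] [::] [:: false; true].

Lemma T3goP l k t0 t1 t2 t3 :
  evb t0 = hecke_T 3 (s ^+ k) -> evb t1 = hecke_T 3 (s ^+ k.+1) ->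
  evb t2 = hecke_T 3 (s ^+ k.+2) -> evb t3 = hecke_T 3 (s ^+ k.+3) ->
  evb (T3go l t0 t1 t2 t3) = hecke_T 3 (s ^+ k * evb l).
Proof.
elim: l k t0 t1 t2 t3 => [|b l IH] k t0 t1 t2 t3 e0 e1 e2 e3.
  by rewrite /= mulr0 T0.
have e4 : evb (xorl (shl 2 t2) (xorl (shl 1 t1) (shl 4 t0))) = hecke_T 3 (s ^+ k.+4).
  rewrite !evb_xor !evb_shl e0 e1 e2 -(add4n k) exprD T3_s4 -exprD -exprS.
  by rewrite add2n expr1 addrA.
rewrite [T3go _ _ _ _ _]/= evb_xor (IH k.+1 _ _ _ _ e1 e2 e3 e4) [evb (b :: l)]/=.
rewrite mulrDr TD mulrA -exprSr; congr (_ + _).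
by case: b; rewrite /b2f ?mulr1 ?e0 // mulr0 T0.
Qed.

Lemma T3lP l : evb (T3l l) = hecke_T 3 (evb l).
Proof.
have Ts : hecke_T 3 s = 0 by apply: T_s.
rewrite -[evb l]mul1r -(expr0 s); apply: T3goP.
- by rewrite expr0 T_1.
- by rewrite expr1 Ts.
- by rewrite T_sqr // Ts expr0n.
- by rewrite T3_s3 /evb /b2f mulr0 addr0 mulr1 add0r.
Qed.

Fixpoint T7go (l : seq bool) (t0 t1 t2 t3 t4 t5 t6 t7 : seq bool) : seq bool :=
  if l is b :: l' then
    let t8 := xorl (shl 2 t6) (xorl (shl 1 t5) (xorl (shl 6 t2)
      (xorl (xorl (shl 1 t1) (shl 5 t1)) (shl 8 t0)))) in
    xorl (if b then t0 else [::]) (T7go l' t1 t2 t3 t4 t5 t6 t7 t8)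
  else [::].

Definition T7l l := T7go l [::] [::] [::] [:: false; true] [::]
  [:: false; false; false; true] [:: false; false; true] [:: false; true].

Lemma T7goP l k t0 t1 t2 t3 t4 t5 t6 t7 :
  evb t0 = hecke_T 7 (s ^+ k) -> evb t1 = hecke_T 7 (s ^+ (1 + k)) ->
  evb t2 = hecke_T 7 (s ^+ (2 + k)) -> evb t3 = hecke_T 7 (s ^+ (3 + k)) ->
  evb t4 = hecke_T 7 (s ^+ (4 + k)) -> evb t5 = hecke_T 7 (s ^+ (5 + k)) ->
  evb t6 = hecke_T 7 (s ^+ (6 + k)) -> evb t7 = hecke_T 7 (s ^+ (7 + k)) ->
  evb (T7go l t0 t1 t2 t3 t4 t5 t6 t7) = hecke_T 7 (s ^+ k * evb l).
Proof.
elim: l k t0 t1 t2 t3 t4 t5 t6 t7 => [|b l IH] k t0 t1 t2 t3 t4 t5 t6 t7 e0 e1 e2 e3 e4 e5 e6 e7.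
  by rewrite /= mulr0 T0.
have e8 : evb (xorl (shl 2 t6) (xorl (shl 1 t5) (xorl (shl 6 t2)
      (xorl (xorl (shl 1 t1) (shl 5 t1)) (shl 8 t0))))) = hecke_T 7 (s ^+ (8 + k)).
  rewrite !evb_xor !evb_shl e0 e1 e2 e5 e6 [s ^+ (8 + k)]exprD T7_s8.
  by rewrite -!exprD -exprS expr1 !addrA mulrDl !addrA.
have sft m : (m + k.+1 = m.+1 + k)%N by rewrite addnS.
have := IH k.+1 t1 t2 t3 t4 t5 t6 t7 _ e1; rewrite !sft => /(_ _ e2 e3 e4 e5 e6 e7 e8) e.
rewrite [T7go _ _ _ _ _ _ _ _ _]/= evb_xor e [evb (b :: l)]/=.
rewrite mulrDr TD mulrA -exprSr; congr (_ + _).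
by case: b {e}; rewrite /b2f ?mulr1 ?e0 // mulr0 T0.
Qed.

Lemma T7lP l : evb (T7l l) = hecke_T 7 (evb l).
Proof.
have Ts : hecke_T 7 s = 0 by apply: T_s.
have [T3 T5 T7] := T7_s357.
have T2 : hecke_T 7 (s ^+ 2) = 0 by rewrite T_sqr // Ts expr0n.
have T4 : hecke_T 7 (s ^+ 4) = 0 by rewrite (@T_exp2n 7 _ _ 2) // Ts expr0n.
have T6 : hecke_T 7 (s ^+ 6) = s ^+ 2 by rewrite (_ : 6 = 3 * 2)%N // exprM T_sqr // T3.
rewrite -[evb l]mul1r -(expr0 s); apply: T7goP; rewrite ?addn0.
- by rewrite expr0 T_1.
- by rewrite expr1 Ts.
- by rewrite T2.
- by rewrite T3 /evb /b2f mulr0 addr0 mulr1 add0r.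
- by rewrite T4.
- by rewrite T5 /evb /b2f mulr0 addr0 mulr1 !add0r; ring2.
- by rewrite T6 /evb /b2f mulr0 addr0 mulr1 !add0r expr2.
- by rewrite T7 /evb /b2f mulr0 addr0 mulr1 add0r.
Qed.

Definition prz (ab : seq bool * seq bool) := pr (evb ab.1 + G * evb ab.2) = 0.

(* Multiplication of a + G b by u, in terms of (a, b). *)
Definition stepk (ab : seq bool * seq bool) : seq bool * seq bool :=
  let: (a, b) := ab in
  (xorl (xorl (shl 12 a) (shl 8 a)) (shl 9 b),
   xorl (shl 3 a) (xorl (shl 12 b) (xorl (shl 8 b) (shl 4 b)))).

Definition mono n : seq bool := rcons (nseq n false) true.

Lemma evb_mono n : evb (mono n) = s ^+ n.
Proof.
rewrite /mono -cats1 -/(shl n [:: true]) evb_shl /= mulr0 addr0 /b2f.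
exact: mulr1.
Qed.

Lemma stepkP ab : prz ab -> prz (stepk ab).
Proof.
case: ab => a b; rewrite /prz /stepk /fst /snd => p0; rewrite !evb_xor !evb_shl.
move: (evb a) (evb b) p0 => x y p0.
have sG : G ^+ 2 = s * G + s ^+ 6 by rewrite -FG_s6 s_def; ring2.
have -> : s ^+ 12 * x + s ^+ 8 * x + s ^+ 9 * y + G * (s ^+ 3 * x + (s ^+ 12 * y + (s ^+ 8 * y + s ^+ 4 * y)))
    = u * (x + G * y).
  transitivity ((s ^+ 3 * G + s ^+ 8 + s ^+ 12) * x + s ^+ 3 * (s * G + s ^+ 6) * y + (s ^+ 8 + s ^+ 12) * G * y).
    by ring2.
  by rewrite -sG u_sG; ring2.
by rewrite pr_mul ?p0 ?mulr0 //; exact: hmod_u.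
Qed.

Definition ktab0 : seq (seq bool * seq bool) :=
  [:: ([::], mono 0); (mono 7, mono 2); (mono 9, mono 4); ([::], mono 6);
      ([::], mono 8); (mono 11, mono 10)].

Fixpoint ktab n := if n is n'.+1 then ktab0 ++ map stepk (ktab n') else [::].

Lemma ktabP n ab : ab \in ktab n -> prz ab.
Proof.
have [p1 p2 p3 p4 [p5 p6]] := kap_pr.
elim: n ab => // n IH ab; rewrite mem_cat => /orP [|/mapP [cd /IH h ->]]; last exact: stepkP.
by rewrite !inE /prz; do 5?[case/orP]; move/eqP=> ->; rewrite /fst /snd !evb_mono ?expr0 ?mulr1 ?add0r.
Qed.

(** Gaussian elimination on b: with [tab] sorted by decreasing degree of b', each row removes the
    coefficient of b at its own top degree. Correctness holds for any order; the order only serves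
    to reach b = 0, which is tested separately. *)
Fixpoint kred (tab : seq (seq bool * seq bool)) (a b : seq bool) :=
  if tab is (a', b') :: tab' then
    if nth false b (size b').-1 then kred tab' (xorl a a') (xorl b b') else kred tab' a b
  else (a, b).

Lemma kredP tab a b : (forall ab, ab \in tab -> prz ab) ->
  pr (evb (kred tab a b).1 + G * evb (kred tab a b).2) = pr (evb a + G * evb b).
Proof.
elim: tab a b => [//|[a' b'] tab IH] a b h /=.
have htab ab : ab \in tab -> prz ab by move=> hab; apply: h; rewrite inE hab orbT.
case: ifP => _; rewrite IH //.
have := h (a', b') (mem_head _ _); rewrite /prz /fst /snd => p0.
by rewrite !evb_xor mulrDr addrACA [LHS]prD p0 addr0.
Qed.

Definition lift_red tab (a : seq bool) :=
  kred tab (xorl (shl 12 a) (shl 8 a)) (shl 3 a).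

Lemma lift_redP tab a : (forall ab, ab \in tab -> prz ab) ->
  all negb (lift_red tab a).2 -> pr (evb (lift_red tab a).1) = u * pr (evb a).
Proof.
move=> htab /evb_zero b0; have := kredP (xorl (shl 12 a) (shl 8 a)) (shl 3 a) htab.
rewrite -/(lift_red tab a) b0 mulr0 addr0 => ->.
rewrite -pr_mul; last exact: hmod_u.
rewrite u_sG evb_xor !evb_shl; congr pr; move: (evb a) => x; ring2.
Qed.

(** Twelve rounds provide rows for the even degrees up to 142. The largest one required is 12 * 7 +
    9 + 3 = 96, for s^3 times the lift with j = 7 and c = 9. *)
Definition liftb (a : seq bool) := (lift_red (rev (ktab 12)) a).1.
Definition liftb_ok (a : seq bool) := all negb (lift_red (rev (ktab 12)) a).2.

Lemma liftbP a : liftb_ok a -> pr (evb (liftb a)) = u * pr (evb a).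
Proof. by apply: lift_redP => ab; rewrite mem_rev; exact: ktabP. Qed.

Fixpoint Hb j c : seq bool := if j is j'.+1 then liftb (Hb j' c) else mono c.

Definition cs := [:: 1; 3; 7; 9]%N.

Lemma Hb_ok : all (fun j => all (fun c => liftb_ok (Hb j c)) cs) (iota 0 8).
Proof. by vm_compute. Qed.

Lemma HbP j c : (j <= 8)%N -> isc c -> pr (evb (Hb j c)) = vb j c.
Proof.
elim: j => [|j IH] lt_j hc; first by rewrite /= evb_mono /vb expr0 mul1r.
have ok : liftb_ok (Hb j c).
  by have /allP /(_ j) := Hb_ok; rewrite mem_iota => /(_ lt_j) /allP /(_ c hc).
have e := liftbP ok; rewrite (IH (ltnW lt_j) hc) in e.
by apply: (etrans e); rewrite /vb exprS mulrA.
Qed.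

Definition sumH c (l : seq nat) : seq bool := foldr (fun j acc => xorl (Hb j c) acc) [::] l.

Lemma sumHP c l : isc c -> all (fun j => j <= 8)%N l ->
  pr (evb (sumH c l)) = \sum_(j <- l) vb j c.
Proof.
move=> hc; elim: l => [|j l IH] /= => [_|/andP [hj hl]]; first by rewrite big_nil pr0.
by rewrite evb_xor prD big_cons HbP // IH.
Qed.

(** The equality is tested between polynomials in s, before any projection. The bounds by 8 keep
    every index within the range of [HbP]. *)
Definition chk (T : seq bool -> seq bool) c c1 c2 (b1 b2 : seq (seq nat)) :=
  all (fun j => all negb (xorl (T (Hb j c)) (xorl (sumH c1 (nth [::] b1 j)) (sumH c2 (nth [::] b2 j))))
    && all (fun j => j <= 8)%N (nth [::] b1 j) && all (fun j => j <= 8)%N (nth [::] b2 j))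
    (iota 0 (size b1)).

Lemma chkP p T c c1 c2 b1 b2 j : (p == 3) || (p == 7) ->
  (forall l, evb (T l) = hecke_T p (evb l)) -> isc c -> isc c1 -> isc c2 ->
  (size b1 <= 8)%N -> chk T c c1 c2 b1 b2 -> (j < size b1)%N ->
  hecke_T p (vb j c) = \sum_(i <- nth [::] b1 j) vb i c1 + \sum_(i <- nth [::] b2 j) vb i c2.
Proof.
move=> p37 TP hc h1 h2 sz /allP /(_ j) hj lt_j; move: hj; rewrite mem_iota => /(_ lt_j).
case/andP => /andP [/evb_eq e l1] l2.
rewrite -HbP //; last by rewrite (leq_trans _ sz) // ltnW.
by rewrite -pr_T // -TP e evb_xor prD !sumHP.
Qed.

(* Entry j of base3_cd (resp. base7_cd) lists the exponents i such that u^i D_d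
   occurs in T3 (u^j D_c) (resp. T7 (u^j D_c)). *)
Definition base3_13 : seq (seq nat) := [:: [::]; [::]; [::]; [:: 1]].
Definition base3_17 : seq (seq nat) := [:: [::]; [:: 0]; [::]; [:: 1; 2]].
Definition base3_31 : seq (seq nat) := [:: [:: 0]; [:: 1]; [:: 1; 2]; [:: 1; 2; 3]].
Definition base3_39 : seq (seq nat) := [:: [::]; [:: 0]; [::]; [:: 1; 2]].
Definition base3_71 : seq (seq nat) := [:: [::]; [::]; [:: 1]; [:: 2]].
Definition base3_79 : seq (seq nat) := [:: [::]; [:: 0]; [::]; [:: 2]].
Definition base3_93 : seq (seq nat) := [:: [:: 0]; [:: 1]; [:: 2]; [:: 1; 3]].
Definition base3_97 : seq (seq nat) := [:: [:: 0]; [:: 1]; [:: 1; 2]; [:: 1; 2; 3]].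
Definition base7_13 : seq (seq nat) := [:: [::]; [:: 0]; [::]; [:: 2]; [:: 1]; [:: 4]; [:: 3]; [:: 6]].
Definition base7_17 : seq (seq nat) := [:: [::]; [:: 0]; [:: 0]; [:: 2]; [:: 1]; [:: 4]; [:: 3; 4]; [:: 1; 3; 6]].
Definition base7_31 : seq (seq nat) := [:: [:: 0]; [:: 1]; [:: 1; 2]; [:: 2; 3]; [:: 1; 2; 4]; [:: 1; 3; 5]; [:: 2; 4; 5; 6]; [:: 1; 2; 3; 4; 5; 6; 7]].
Definition base7_39 : seq (seq nat) := [:: [::]; [:: 0]; [:: 0]; [:: 0; 2]; [:: 1]; [:: 4]; [:: 1; 3; 4]; [:: 3; 4; 6]].
Definition base7_71 : seq (seq nat) := [:: [:: 0]; [:: 1]; [:: 2]; [:: 3]; [:: 2; 4]; [:: 1; 3; 5]; [:: 2; 4; 6]; [:: 1; 3; 5; 7]].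
Definition base7_79 : seq (seq nat) := [:: [::]; [::]; [:: 0]; [::]; [::]; [::]; [:: 4]; [:: 3]].
Definition base7_93 : seq (seq nat) := [:: [::]; [::]; [:: 1]; [:: 2]; [:: 1]; [::]; [:: 1; 5]; [:: 4; 6]].
Definition base7_97 : seq (seq nat) := [:: [:: 0]; [:: 1]; [:: 0; 1; 2]; [:: 1; 2; 3]; [:: 1; 2; 4]; [:: 3; 5]; [:: 1; 5; 6]; [:: 1; 3; 4; 6; 7]].

Lemma chk3 : [&& chk T3l 1 3 7 base3_13 base3_17, chk T3l 3 1 9 base3_31 base3_39,
  chk T3l 7 1 9 base3_71 base3_79 & chk T3l 9 3 7 base3_93 base3_97].
Proof. by vm_compute. Qed.

Lemma chk7 : [&& chk T7l 1 3 7 base7_13 base7_17, chk T7l 3 1 9 base7_31 base7_39,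
  chk T7l 7 1 9 base7_71 base7_79 & chk T7l 9 3 7 base7_93 base7_97].
Proof. by vm_compute. Qed.

Local Open Scope nat_scope.

(** * Base 4 weights *)

Section Digits.
Variable w : nat -> nat.

Fixpoint digf k n := if k is k'.+1 then 2 * digf k' (n %/ 4) + w (n %% 4) else 0.
Definition dig n := digf n n.

Hypothesis w0 : w 0 = 0.

Lemma digf0 k : digf k 0 = 0.
Proof. by elim: k => //= k IH; rewrite div0n mod0n IH w0. Qed.

Lemma digf_fuel k k' n : n <= k -> n <= k' -> digf k n = digf k' n.
Proof.
elim: k k' n => [|k IH] [|k'] n //=; rewrite ?leqn0.
- by move=> /eqP -> _; rewrite div0n mod0n digf0 w0.
- by move=> _ /eqP ->; rewrite div0n mod0n digf0 w0.
by move=> h h'; rewrite (IH k') //; lia.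
Qed.

Lemma digE a n : a < 4 -> dig (4 * n + a) = 2 * dig n + w a.
Proof.
move=> lt_a; have [z|nz] := eqVneq (4 * n + a) 0.
  have [-> ->] : n = 0 /\ a = 0 by lia.
  by rewrite /dig /= w0.
rewrite /dig; case def_n : (4 * n + a) nz => [//|m] _ /=.
rewrite -def_n (_ : (4 * n + a) %/ 4 = n); last by lia.
rewrite (_ : (4 * n + a) %% 4 = a); last by lia.
by rewrite (@digf_fuel m n n) //; lia.
Qed.
End Digits.

(* The pair (h n, O n), ordered lexicographically by le2, is subadditive in n and
   determines n. *)
Definition E := dig (fun d => d %% 2).
Definition O := dig (fun d => d %/ 2).
Definition h n := E n + O n.

Lemma EE a n : a < 4 -> E (4 * n + a) = 2 * E n + a %% 2.
Proof. exact: digE. Qed.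

Lemma OE a n : a < 4 -> O (4 * n + a) = 2 * O n + a %/ 2.
Proof. exact: digE. Qed.

Lemma base4 n : exists m a, [/\ a < 4, n = 4 * m + a & (0 < n -> m < n)].
Proof. by exists (n %/ 4), (n %% 4); split; lia. Qed.

Definition le2 a b c d := (a < c) || ((a == c) && (b <= d)).

Ltac digits4 a := case: a => [|[|[|[|//]]]] //.

(** Carries never raise the pair: 1 + 1 = 2 turns two units of [E] into one of [O], lowering h, and
    2 + 2 = 4 turns two units of [O] into two of [E], keeping h but lowering O. The second case is
    why the order is lexicographic. *)
Lemma h_subadd i m : le2 (h (i + m)) (O (i + m)) (h i + h m) (O i + O m).
Proof.
have [n] := ubnP (i + m); elim: n i m => // n IH i m lt_n.
have [i' [a [a4 iE lti]]] := base4 i; have [m' [b [b4 mE ltm]]] := base4 m.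
have [z|nz] := eqVneq (i + m) 0.
  have [-> ->] : i = 0 /\ m = 0 by lia.
  by [].
have h1 := IH i' m' ltac:(lia).
have [ab|ab] := ltnP (a + b) 4.
  have -> : i + m = 4 * (i' + m') + (a + b) by lia.
  rewrite iE mE /h !EE ?OE //; move: h1; rewrite /le2 /h.
  by move: a4 b4 ab; clear; digits4 a; digits4 b; lia.
have h2 := IH (i' + m') 1 ltac:(lia).
have -> : i + m = 4 * (i' + m' + 1) + (a + b - 4) by lia.
rewrite iE mE /h !EE ?OE //; [|lia|lia].
have [e1 o1] : E 1 = 1 /\ O 1 = 0 by [].
move: h1 h2; rewrite /le2 /h e1 o1.
by move: a4 b4 ab; clear; digits4 a; digits4 b; lia.
Qed.

Lemma h_inj i j : h i = h j -> O i = O j -> i = j.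
Proof.
have [n] := ubnP i; elim: n i j => // n IH i j lt_n.
have [i' [a [a4 iE lti]]] := base4 i; have [j' [b [b4 jE ltj]]] := base4 j.
rewrite iE jE /h !EE ?OE // => e1 e2.
have [i0|i0] := posnP i.
  have [i'0 a0] : i' = 0 /\ a = 0 by lia.
  have [z|nz] := posnP j; first by lia.
  exfalso; rewrite i'0 a0 in e1 e2; have [E0 O0] : E 0 = 0 /\ O 0 = 0 by [].
  rewrite E0 O0 in e1 e2.
  have hj' : E j' + O j' = 0 by lia.
  have pos k : E k + O k = 0 -> k = 0.
    clear; elim/ltn_ind: k => k IH; have [k' [c [c4 kE ltk]]] := base4 k.
    rewrite kE EE ?OE // => z; have [->|k0] := posnP k'; first by lia.
    by have := IH k' ltac:(lia) ltac:(lia); lia.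
  by have := pos _ hj'; lia.
have := IH i' j' ltac:(lia); rewrite /h => IH'.
have [ea eb] : a %% 2 = b %% 2 /\ a %/ 2 = b %/ 2 by lia.
by rewrite IH' //; lia.
Qed.

Lemma EO_surj e o : exists j, E j = e /\ O j = o.
Proof.
have [n] := ubnP (e + o); elim: n e o => // n IH e o lt_n.
have [z|nz] := posnP (e + o).
  have [-> ->] : e = 0 /\ o = 0 by lia.
  by exists 0.
have [j [Ej Oj]] := IH (e %/ 2) (o %/ 2) ltac:(lia).
exists (4 * j + (e %% 2 + 2 * (o %% 2))).
by rewrite EE ?OE; [split; rewrite ?Ej ?Oj; lia|lia|lia].
Qed.

Lemma E4 n : E (4 * n) = 2 * E n.
Proof. by rewrite -[4 * n]addn0 EE // mod0n addn0. Qed.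

Lemma O4 n : O (4 * n) = 2 * O n.
Proof. by rewrite -[4 * n]addn0 OE // div0n addn0. Qed.

(* Statements about q = 2 ^ k are transported from q to 4 q, starting from
   q = 1 and q = 2. *)
Lemma pow2_ind (P : nat -> Prop) : P 1 -> P 2 -> (forall q, P q -> P (4 * q)) ->
  forall k, P (2 ^ k).
Proof.
move=> P1 P2 PS; elim/ltn_ind => -[|[|k]] IH //.
by rewrite !expnS mulnA; apply: PS; apply: IH.
Qed.

Ltac pow2 k := pattern (2 ^ k);
  match goal with |- ?P _ => refine (@pow2_ind P _ _ _ k) end; cbv beta.

Lemma h_top k j : j < 2 ^ k -> E (2 ^ k + j) = E (2 ^ k) + E j /\ O (2 ^ k + j) = O (2 ^ k) + O j.
Proof.
move: j; pow2 k.
- by case.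
- by case=> [|[|]].
move=> q IH j lt_j; have [j' [a [a4 jE _]]] := base4 j.
have -> : 4 * q + j = 4 * (q + j') + a by lia.
have [h1 h2] := IH j' ltac:(lia).
by rewrite jE !EE ?OE // E4 O4 h1 h2; lia.
Qed.

(** Bit k belongs to [E] for even k and to [O] for odd k, with value x = 2^floor(k/2). *)
Lemma h_pow k : exists x, 0 < x /\
  ([/\ E (2 ^ k) = x, O (2 ^ k) = 0, E (2 ^ k.+1) = 0 & O (2 ^ k.+1) = x] \/
   [/\ E (2 ^ k) = 0, O (2 ^ k) = x, E (2 ^ k.+1) = 2 * x & O (2 ^ k.+1) = 0]).
Proof.
elim: k => [|k [x [x0 [[e1 e2 e3 e4]|[e1 e2 e3 e4]]]]]; first by exists 1; split=> //; left.
  exists x; split=> //; right; split=> //.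
    by rewrite !expnS mulnA E4 e1.
  by rewrite !expnS mulnA O4 e2.
exists (2 * x); split; first by lia.
left; split=> //.
  by rewrite !expnS mulnA E4 e1.
by rewrite !expnS mulnA O4 e2.
Qed.

(** Only the bits k and k + 1 of x matter, and equality requires bit k of x to be set. In the
    recursions an index x + 2^(k+2) is read as (x + 3 2^k) + 2^k to extract a coefficient of the
    second term. *)
Lemma h_add3 k x : x < 4 * 2 ^ k ->
  le2 (h x + h (2 ^ k)) (O x + O (2 ^ k)) (h (x + 3 * 2 ^ k)) (O (x + 3 * 2 ^ k)) /\
  (~~ odd (x %/ 2 ^ k) ->
   le2 (h x + h (2 ^ k)) (O x + O (2 ^ k)).+1 (h (x + 3 * 2 ^ k)) (O (x + 3 * 2 ^ k))).
Proof.
move: x; pow2 k.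
- by do 4?[case=> //].
- by do 8?[case=> //].
move=> q IH x lt_x; have [x' [a [a4 xE _]]] := base4 x.
have q0 : 0 < q by lia.
have [h1 h2] := IH x' ltac:(lia).
have -> : x %/ (4 * q) = x' %/ q.
  by rewrite divnMA xE; congr (_ %/ _); lia.
have -> : x + 3 * (4 * q) = 4 * (x' + 3 * q) + a by lia.
rewrite xE /h !EE ?OE // E4 O4; move: h1 h2; rewrite /le2 /h => h1 h2.
by split=> [|/h2 h3]; lia.
Qed.

Lemma h_carry k j : j < 4 * 2 ^ k -> odd (j %/ 2 ^ k) ->
  le2 (h (j + 2 ^ k)) (O (j + 2 ^ k)).+1 (h j + h (2 ^ k)) (O j + O (2 ^ k)).
Proof.
move: j; pow2 k.
- by do 4?[case=> //].
- by do 8?[case=> //].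
move=> q IH x lt_x; have [x' [a [a4 xE _]]] := base4 x.
have -> : x %/ (4 * q) = x' %/ q.
  by rewrite divnMA xE; congr (_ %/ _); lia.
have -> : x + (4 * q) = 4 * (x' + q) + a by lia.
move=> od; have := IH x' ltac:(lia) od.
by rewrite xE /h !EE ?OE // E4 O4 /le2 /h; lia.
Qed.

(** For even k, bit k belongs to [E], which is the same for x and j. For odd k it is the top
    possible bit of [O j], and O x < O j. [bit_decE] is the analogue with [E] decreasing. *)
Lemma bit_decO k x j : j < 4 * 2 ^ k -> E x = E j -> (O x).+1 = O j ->
  odd (x %/ 2 ^ k) -> odd (j %/ 2 ^ k).
Proof.
move: x j; pow2 k.
- move=> x j lt_j eE eO; rewrite !divn1.
  have [x' [a [a4 xE _]]] := base4 x; have [j' [b [b4 jE _]]] := base4 j.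
  by rewrite xE jE !EE ?OE // in eE eO; rewrite xE jE; lia.
- move=> x j lt_j eE eO.
  have [x' [a [a4 xE _]]] := base4 x; have [j' [b [b4 jE _]]] := base4 j.
  rewrite xE jE !EE ?OE // in eE eO; rewrite xE jE.
  have [j'0|j'1] : j' = 0 \/ j' = 1 by lia.
    have [E0 O0] : E 0 = 0 /\ O 0 = 0 by [].
    by rewrite j'0 in eO *; rewrite O0 in eO; lia.
  have [E1 O1] : E 1 = 1 /\ O 1 = 0 by [].
  by rewrite j'1 in eO *; rewrite O1 in eO; lia.
move=> q IH x j lt_j eE eO.
have [x' [a [a4 xE _]]] := base4 x; have [j' [b [b4 jE _]]] := base4 j.
have -> : x %/ (4 * q) = x' %/ q by rewrite divnMA xE; congr (_ %/ _); lia.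
have -> : j %/ (4 * q) = j' %/ q by rewrite divnMA jE; congr (_ %/ _); lia.
rewrite xE jE !EE ?OE // in eE eO.
have [b2|b2] := leqP 2 b.
  have [e1 e2] : E x' = E j' /\ O x' = O j' by lia.
  by rewrite (@h_inj x' j') // /h e1 e2.
by apply: IH; lia.
Qed.

Lemma bit_decE k x j : j < 4 * 2 ^ k -> (E x).+1 = E j -> O x = O j ->
  O j = 0 -> odd (x %/ 2 ^ k) -> O (2 ^ k) = 0 -> odd (j %/ 2 ^ k).
Proof.
move: x j; pow2 k => //.
- move=> x j lt_j eE eO _; rewrite !divn1.
  have [x' [a [a4 xE _]]] := base4 x; have [j' [b [b4 jE _]]] := base4 j.
  rewrite xE jE !EE ?OE // in eE eO; rewrite xE jE.
  have j'0 : j' = 0 by lia.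
  have [E0 O0] : E 0 = 0 /\ O 0 = 0 by [].
  by rewrite j'0 in eE *; rewrite E0 in eE; lia.
move=> q IH x j lt_j eE eO oj; rewrite O4.
have [x' [a [a4 xE _]]] := base4 x; have [j' [b [b4 jE _]]] := base4 j.
have -> : x %/ (4 * q) = x' %/ q by rewrite divnMA xE; congr (_ %/ _); lia.
have -> : j %/ (4 * q) = j' %/ q by rewrite divnMA jE; congr (_ %/ _); lia.
rewrite xE jE !EE ?OE // in eE eO oj.
have [b2|b2] := eqVneq (b %% 2) 1.
  have [e1 e2] : E x' = E j' /\ O x' = O j' by lia.
  by rewrite (@h_inj x' j') // /h e1 e2.
by move=> ox oq; apply: (IH x' j'); lia.
Qed.

Local Open Scope ring_scope.

(** * Recursive families of polynomials *)

From mathcomp Require Import ring.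

Local Notation pseq := (nat -> {poly 'F_2}).

Definition nz (p : {poly 'F_2}) i := p`_i != 0.

Lemma nzD (p q : {poly 'F_2}) i : nz (p + q) i -> nz p i \/ nz q i.
Proof.
rewrite /nz coefD => h; case: (eqVneq p`_i 0) => [p0|]; last by left.
by right; move: h; rewrite p0 add0r.
Qed.

Lemma nzXM n p i : nz ('X^n * p) i -> (n <= i)%N /\ nz p (i - n).
Proof. by rewrite /nz coefXnM; case: ltnP => //; rewrite eqxx. Qed.

Lemma nz0P (p : {poly 'F_2}) i : ~ nz p i -> p`_i = 0.
Proof. by move/negP; rewrite negbK => /eqP. Qed.

(* The case k = 0 is the recursion satisfied by the coefficients of T3 (resp. T7 for
   rec8); the others follow by squaring. *)
Definition rec4 (t : pseq) := forall k j,
  t (j + 2 ^ k.+2)%N = 'X^(2 ^ k.+2) * t j + 'X^(2 ^ k) * t (j + 2 ^ k)%N.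

Definition rec8 (t t' : pseq) := forall k j,
  t (j + 2 ^ k.+3)%N = 'X^(2 ^ k.+3) * t j + 'X^(2 ^ k.+1) * t (j + 2 ^ k.+1)%N
    + 'X^(2 ^ k) * t' (j + 2 ^ k)%N.

Lemma polyXn2 (x : {poly 'F_2}) : x *+ 2 = 0.
Proof. by rewrite mulr2n poly_addff. Qed.

Lemma XpowS k : 'X^(2 ^ k.+1) = 'X^(2 ^ k) ^+ 2 :> {poly 'F_2}.
Proof. by rewrite expnSr exprM. Qed.

Lemma rec4_of (t : pseq) :
  (forall j, t (j + 4)%N = 'X^4 * t j + 'X * t (j + 1)%N) -> rec4 t.
Proof.
move=> t4; elim=> [|k IH] j; first by rewrite expr1 t4.
have e1 : (j + 2 ^ k.+3 = j + 2 ^ k.+2 + 2 ^ k.+2)%N by rewrite [in LHS]expnS; lia.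
have e2 : (j + 2 ^ k.+2 + 2 ^ k = j + 2 ^ k + 2 ^ k.+2)%N by lia.
have e3 : (j + 2 ^ k.+1 = j + 2 ^ k + 2 ^ k)%N by rewrite expnS; lia.
rewrite e1 !IH e2 IH e3 !XpowS;
move: ('X^(2 ^ k)) (t (j + 2 ^ k + 2 ^ k)%N) (t (j + 2 ^ k)%N) (t j) => a z y x.
transitivity (a ^+ 2 ^+ 2 ^+ 2 * x + a ^+ 2 * z + (a ^+ 5 * y) *+ 2); first by ring.
by rewrite polyXn2 addr0.
Qed.

Lemma rec8_of (t : pseq) :
  (forall j, t (j + 8)%N = 'X^8 * t j + 'X^2 * t (j + 2)%N + 'X * t (j + 1)%N) -> rec8 t t.
Proof.
move=> t8; elim=> [|k IH] j; first by rewrite expr1 t8.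
have s1 : (2 ^ k.+1 = 2 * 2 ^ k)%N by rewrite expnS.
have s2 : (2 ^ k.+2 = 4 * 2 ^ k)%N by rewrite !expnS; lia.
have s3 : (2 ^ k.+3 = 8 * 2 ^ k)%N by rewrite !expnS; lia.
have s4 : (2 ^ k.+4 = 16 * 2 ^ k)%N by rewrite !expnS; lia.
have e1 : (j + 2 ^ k.+4 = j + 2 ^ k.+3 + 2 ^ k.+3)%N by lia.
have e2 : (j + 2 ^ k.+3 + 2 ^ k = j + 2 ^ k + 2 ^ k.+3)%N by lia.
have e3 : (j + 2 ^ k.+3 + 2 ^ k.+1 = j + 2 ^ k.+1 + 2 ^ k.+3)%N by lia.
have e4 : (j + 2 ^ k.+2 = j + 2 ^ k.+1 + 2 ^ k.+1)%N by lia.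
have e5 : (j + 2 ^ k + 2 ^ k.+1 = j + 2 ^ k.+1 + 2 ^ k)%N by lia.
have e6 : (j + 2 ^ k.+1 = j + 2 ^ k + 2 ^ k)%N by lia.
rewrite e1 !IH e3 e2 !IH e5 e4 -e6 !XpowS.
move: ('X^(2 ^ k)) (t (j + 2 ^ k.+1 + 2 ^ k.+1)%N) (t (j + 2 ^ k.+1 + 2 ^ k)%N)
  (t (j + 2 ^ k.+1)%N) (t (j + 2 ^ k)%N) (t j) => a x y z w v.
transitivity (a ^+ 2 ^+ 2 ^+ 2 ^+ 2 * v + a ^+ 2 ^+ 2 * x + a ^+ 2 * z +
  (a ^+ 10 * z + a ^+ 9 * w + a ^+ 3 * y) *+ 2); first by ring.
by rewrite polyXn2 addr0.
Qed.

Lemma top_bit m n : (2 ^ m <= n)%N -> exists k j, n = (j + 2 ^ (k + m))%N /\ (j < 2 ^ (k + m))%N.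
Proof.
move=> le_n; have n0 : (0 < n)%N by apply: leq_trans le_n; rewrite expn_gt0.
have /andP [lo hi] := trunc_log_bounds (isT : 1 < 2)%N n0.
have le_m : (m <= trunc_log 2 n)%N by rewrite trunc_log_max.
exists (trunc_log 2 n - m)%N, (n - 2 ^ trunc_log 2 n)%N.
by rewrite subnK // subnK //; split=> //; rewrite expnS in hi; lia.
Qed.

(* Induction on j by removing its top binary digit. *)
Lemma rec4_supp (t : pseq) (R : nat -> nat -> bool) : rec4 t ->
  (forall j i, (j < 4)%N -> nz (t j) i -> R i j) ->
  (forall k i j, (j < 2 ^ k.+2)%N -> R i j -> R (i + 2 ^ k.+2)%N (j + 2 ^ k.+2)%N) ->
  (forall k i j, (j < 2 ^ k.+2)%N -> R i (j + 2 ^ k)%N -> R (i + 2 ^ k)%N (j + 2 ^ k.+2)%N) ->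
  forall j i, nz (t j) i -> R i j.
Proof.
move=> t4 base R1 R2; elim/ltn_ind => j IH i; have [lt4|ge4] := ltnP j 4; first exact: base.
have [k [j0 [jE lt_j0]]] := @top_bit 2 j ge4; rewrite addn2 in jE lt_j0.
have q0 : (2 ^ k < 2 ^ k.+2)%N by rewrite ltn_exp2l.
rewrite jE t4 => /nzD [] /nzXM [le_i nzi]; rewrite -(subnK le_i).
  by apply: R1 => //; apply: IH nzi; rewrite jE; lia.
by apply: R2 => //; apply: IH nzi; rewrite jE; lia.
Qed.

Lemma rec8_supp (t t' : pseq) (R R' : nat -> nat -> bool) : rec8 t t' ->
  (forall j i, nz (t' j) i -> R' i j) ->
  (forall j i, (j < 8)%N -> nz (t j) i -> R i j) ->
  (forall k i j, (j < 2 ^ k.+3)%N -> R i j -> R (i + 2 ^ k.+3)%N (j + 2 ^ k.+3)%N) ->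
  (forall k i j, (j < 2 ^ k.+3)%N -> R i (j + 2 ^ k.+1)%N -> R (i + 2 ^ k.+1)%N (j + 2 ^ k.+3)%N) ->
  (forall k i j, (j < 2 ^ k.+3)%N -> R' i (j + 2 ^ k)%N -> R (i + 2 ^ k)%N (j + 2 ^ k.+3)%N) ->
  forall j i, nz (t j) i -> R i j.
Proof.
move=> t8 tR' base R1 R2 R3; elim/ltn_ind => j IH i.
have [lt8|ge8] := ltnP j 8; first exact: base.
have [k [j0 [jE lt_j0]]] := @top_bit 3 j ge8; rewrite addn3 in jE lt_j0.
have q1 : (2 ^ k.+1 < 2 ^ k.+3)%N by rewrite ltn_exp2l.
rewrite jE t8 => /nzD [/nzD []|] /nzXM [le_i nzi]; rewrite -(subnK le_i).
- by apply: R1 => //; apply: IH nzi; rewrite jE; lia.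
- by apply: R2 => //; apply: IH nzi; rewrite jE; lia.
- by apply: R3 => //; apply: tR' nzi.
Qed.

(* Same as rec8_supp for t = t', where the bound on the third term is inductive. *)
Lemma rec8_supp_diag (t : pseq) (R : nat -> nat -> bool) : rec8 t t ->
  (forall j i, (j < 8)%N -> nz (t j) i -> R i j) ->
  (forall k i j, (j < 2 ^ k.+3)%N -> R i j -> R (i + 2 ^ k.+3)%N (j + 2 ^ k.+3)%N) ->
  (forall k i j, (j < 2 ^ k.+3)%N -> R i (j + 2 ^ k.+1)%N -> R (i + 2 ^ k.+1)%N (j + 2 ^ k.+3)%N) ->
  (forall k i j, (j < 2 ^ k.+3)%N -> R i (j + 2 ^ k)%N -> R (i + 2 ^ k)%N (j + 2 ^ k.+3)%N) ->
  forall j i, nz (t j) i -> R i j.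
Proof.
move=> t8 base R1 R2 R3; elim/ltn_ind => j IH i.
have [lt8|ge8] := ltnP j 8; first exact: base.
have [k [j0 [jE lt_j0]]] := @top_bit 3 j ge8; rewrite addn3 in jE lt_j0.
have q1 : (2 ^ k.+1 < 2 ^ k.+3)%N by rewrite ltn_exp2l.
have q2 : (2 ^ k < 2 ^ k.+3)%N by rewrite ltn_exp2l //; lia.
rewrite jE t8 => /nzD [/nzD []|] /nzXM [le_i nzi]; rewrite -(subnK le_i).
- by apply: R1 => //; apply: IH nzi; rewrite jE; lia.
- by apply: R2 => //; apply: IH nzi; rewrite jE; lia.
- by apply: R3 => //; apply: IH nzi; rewrite jE; lia.
Qed.

(** The excess of (a, b) over (c, d) is the guaranteed drop of (h, O) from j to i. [hR] controls h
    alone, for entries without a usable bound on O. *)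
Definition kR a b c d i j : bool := le2 (h i + a) (O i + b) (h j + c) (O j + d).
Definition hR a c i j : bool := (h i + a <= h j + c)%N.

Lemma hO_top k j : (j < 2 ^ k)%N ->
  h (j + 2 ^ k) = (h j + h (2 ^ k))%N /\ O (j + 2 ^ k) = (O j + O (2 ^ k))%N.
Proof. by move=> /h_top [e1 e2]; rewrite addnC /h e1 e2; lia. Qed.

Lemma hO4 n : h (4 * n) = (2 * h n)%N /\ O (4 * n) = (2 * O n)%N.
Proof. by rewrite /h E4 O4; lia. Qed.

Lemma hO_pow2 k : h (2 ^ k.+2) = (2 * h (2 ^ k))%N /\ O (2 ^ k.+2) = (2 * O (2 ^ k))%N.
Proof. by rewrite !expnS mulnA; exact: hO4. Qed.

(** Room for the third term of [rec8]: there the top digit 2^(k+3) has to pay for two shifts by 2^k,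
    and two units of O are left over. *)
Lemma hO_pow3 k : le2 (2 * h (2 ^ k)) (2 * O (2 ^ k)).+2 (h (2 ^ k.+3)) (O (2 ^ k.+3)).
Proof.
have [e1 e2] := hO_pow2 k.+1; have [x [x0 h2]] := h_pow k.
rewrite e1 e2 /le2 /h; case: h2 => -[-> -> -> ->]; lia.
Qed.

Lemma kR_cl1 a b c d k i j : (j < 2 ^ k)%N ->
  kR a b c d i j -> kR a b c d (i + 2 ^ k)%N (j + 2 ^ k)%N.
Proof.
move=> /hO_top [e1 e2]; have := h_subadd i (2 ^ k); rewrite /kR e1 e2 /le2; lia.
Qed.

(** By subadditivity a shift by q costs (h, O) of q once for i and once for j; the removed top digit
    2^k must pay for both. *)
Lemma kR_shift a b a' b' c d q k i j : (j < 2 ^ k)%N ->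
  le2 (2 * h q + a') (2 * O q + b') (h (2 ^ k) + a) (O (2 ^ k) + b) ->
  kR a b c d i (j + q)%N -> kR a' b' c d (i + q)%N (j + 2 ^ k)%N.
Proof.
move=> /hO_top [e1 e2]; have := h_subadd i q; have := h_subadd j q.
rewrite /kR e1 e2 /le2; lia.
Qed.

Lemma hR_cl1 a c k i j : (j < 2 ^ k)%N ->
  hR a c i j -> hR a c (i + 2 ^ k)%N (j + 2 ^ k)%N.
Proof.
move=> /hO_top [e1 e2]; have := h_subadd i (2 ^ k); rewrite /hR e1 /le2; lia.
Qed.

Lemma hR_shift a a' c q k i j : (j < 2 ^ k)%N -> (2 * h q + a' <= h (2 ^ k) + a)%N ->
  hR a c i (j + q)%N -> hR a' c (i + q)%N (j + 2 ^ k)%N.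
Proof.
move=> /hO_top [e1 e2]; have := h_subadd i q; have := h_subadd j q.
rewrite /hR e1 /le2; lia.
Qed.

Lemma kR_rec4 (t : pseq) a b c d : rec4 t ->
  (forall j i, (j < 4)%N -> nz (t j) i -> kR a b c d i j) ->
  forall j i, nz (t j) i -> kR a b c d i j.
Proof.
move=> t4 base; apply: (rec4_supp t4 base) => k i j lt_j; first exact: kR_cl1.
by apply: (kR_shift lt_j); have [-> ->] := hO_pow2 k; rewrite /le2; lia.
Qed.

Lemma hR_rec4 (t : pseq) a c : rec4 t ->
  (forall j i, (j < 4)%N -> nz (t j) i -> hR a c i j) ->
  forall j i, nz (t j) i -> hR a c i j.
Proof.
move=> t4 base; apply: (rec4_supp t4 base) => k i j lt_j; first exact: hR_cl1.
by apply: (hR_shift lt_j); have [-> _] := hO_pow2 k; lia.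
Qed.

Lemma kR_rec8 (t : pseq) a b c d : rec8 t t ->
  (forall j i, (j < 8)%N -> nz (t j) i -> kR a b c d i j) ->
  forall j i, nz (t j) i -> kR a b c d i j.
Proof.
move=> t8 base; apply: (rec8_supp_diag t8 base) => k i j lt_j; first exact: kR_cl1.
  by apply: (kR_shift lt_j); have [-> ->] := hO_pow2 k.+1; rewrite /le2; lia.
by apply: (kR_shift lt_j); have := hO_pow3 k; rewrite /le2; lia.
Qed.

Lemma hR_rec8 (t : pseq) a c : rec8 t t ->
  (forall j i, (j < 8)%N -> nz (t j) i -> hR a c i j) ->
  forall j i, nz (t j) i -> hR a c i j.
Proof.
move=> t8 base; apply: (rec8_supp_diag t8 base) => k i j lt_j; first exact: hR_cl1.
  by apply: (hR_shift lt_j); have [-> _] := hO_pow2 k.+1; lia.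
by apply: (hR_shift lt_j); have := hO_pow3 k; rewrite /le2; lia.
Qed.

Lemma EO0 : E 0 = 0%N /\ O 0 = 0%N. Proof. by []. Qed.

Lemma EO_inj i j : E i = E j -> O i = O j -> i = j.
Proof. by move=> e o; apply: h_inj; rewrite /h ?e ?o. Qed.

Lemma lt_decE j x : O j = 0%N -> O x = 0%N -> (E x).+1 = E j -> (x < j)%N.
Proof.
elim/ltn_ind: j x => j IH x.
have [x' [a [a4 xE _]]] := base4 x; have [j' [b [b4 jE ltj]]] := base4 j.
rewrite xE jE !EE ?OE // => oj ox e.
have [j0|j0] := posnP j.
  have [j'0 b0] : j' = 0%N /\ b = 0%N by lia.
  by rewrite j'0 b0 (proj1 EO0) in e; lia.
have [b1|b1] := eqVneq b 1%N.
  have -> : x' = j' by apply: EO_inj; lia.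
  by lia.
have : (x' < j')%N by apply: IH; lia.
by lia.
Qed.

Lemma lt_decO j x : E x = E j -> (O x).+1 = O j -> (x < j)%N.
Proof.
elim/ltn_ind: j x => j IH x.
have [x' [a [a4 xE _]]] := base4 x; have [j' [b [b4 jE ltj]]] := base4 j.
rewrite xE jE !EE ?OE // => e o.
have [j0|j0] := posnP j.
  have [j'0 b0] : j' = 0%N /\ b = 0%N by lia.
  by rewrite j'0 b0 (proj2 EO0) in o; lia.
have [b1|b1] := leqP 2 b.
  have -> : x' = j' by apply: EO_inj; lia.
  by lia.
have : (x' < j')%N by apply: IH; lia.
by lia.
Qed.

Lemma EO_add i m : O i = 0%N -> E m = 0%N -> E (i + m) = E i /\ O (i + m) = O m.
Proof.
have [n] := ubnP (i + m); elim: n i m => // n IH i m lt_n.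
have [i' [a [a4 iE lti]]] := base4 i; have [m' [b [b4 mE ltm]]] := base4 m.
have [z|nz] := posnP (i + m).
  by have [-> ->] : i = 0%N /\ m = 0%N by lia.
move=> oi em; have [e1 o1] : a = (a %% 2)%N /\ b = (2 * (b %/ 2))%N.
  by rewrite iE mE !(EE, OE) // in oi em; lia.
have [e2 o2] := IH i' m' ltac:(lia) ltac:(by rewrite iE OE // in oi; lia)
  ltac:(by rewrite mE EE // in em; lia).
have -> : (i + m = 4 * (i' + m') + (a + b))%N by lia.
by rewrite iE mE !EE ?OE ?e2 ?o2; lia.
Qed.

(** Here k is odd, and the bound on [O x] says that bit k of x is clear, so nothing is carried. *)
Lemma EO_addpow k x : E (2 ^ k) = 0%N -> (O x < O (2 ^ k))%N ->
  E (x + 2 ^ k) = E x /\ O (x + 2 ^ k) = (O x + O (2 ^ k))%N.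
Proof.
move: x; pow2 k => //.
- move=> x _ ox; have [x' [a [a4 xE _]]] := base4 x.
  have [E2 O2] : E 2 = 0%N /\ O 2 = 1%N by [].
  rewrite xE !OE // O2 in ox; rewrite xE.
  have -> : (4 * x' + a + 2 = 4 * x' + (a + 2))%N by lia.
  by rewrite O2 !EE ?OE; lia.
move=> q IH x; rewrite E4 O4 => eq ox; have [x' [a [a4 xE _]]] := base4 x.
rewrite xE !OE // in ox; rewrite xE.
have -> : (4 * x' + a + 4 * q = 4 * (x' + q) + a)%N by lia.
have [e1 o1] := IH x' ltac:(lia) ltac:(lia).
by rewrite !EE ?OE ?e1 ?o1; lia.
Qed.

Lemma coef_shift (n i : nat) (p : {poly 'F_2}) : ('X^n * p)`_(i + n) = p`_i.
Proof. by rewrite coefXnM ltnNge leq_addl /= addnK. Qed.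

Lemma O_pow_case k : O (2 ^ k) = 0%N \/ E (2 ^ k) = 0%N.
Proof. by have [x [_ [[_ o _ _]|[e _ _ _]]]] := h_pow k; [left|right]. Qed.

Lemma top4 j : (4 <= j)%N -> exists k j0, j = (j0 + 2 ^ k.+2)%N /\ (j0 < 2 ^ k.+2)%N.
Proof. by move/(@top_bit 2) => [k [j0]]; rewrite addn2; exists k, j0. Qed.

Lemma top8 j : (8 <= j)%N -> exists k j0, j = (j0 + 2 ^ k.+3)%N /\ (j0 < 2 ^ k.+3)%N.
Proof. by move/(@top_bit 3) => [k [j0]]; rewrite addn3; exists k, j0. Qed.

(** Remove the top digit: j = j0 + 2^(k+2), with k even since O j = 0. If j0 = 0, the second term of
    [rec4] supplies the coefficient; if j0 > 0, the first one does, and the support bound excludes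
    the second. *)
Lemma lead_b (b : pseq) : rec4 b -> (forall j i, nz (b j) i -> kR 1 0 0 0 i j) ->
  b 0%N = 0 -> (b 1%N)`_0 = 1 ->
  forall j x, O j = 0%N -> (E x).+1 = E j -> O x = 0%N -> (b j)`_x = 1.
Proof.
move=> b4 bR b0 b1; elim/ltn_ind => j IH x oj ex ox.
have lt_xj := lt_decE oj ox ex.
have [lt4|/top4 [k [j0 [jE lt_j0]]]] := ltnP j 4.
  move: j lt4 oj ex lt_xj {IH} => [|[|[|[|//]]]] // _ _ _.
  by case: x {ox} => [_|[]].
have q0 : (0 < 2 ^ k)%N by rewrite expn_gt0.
have q4 : (2 ^ k.+2 = 4 * 2 ^ k)%N by rewrite !expnS; lia.
have [hQ OQ] := hO_top lt_j0; have [hq Oq] := hO_pow2 k.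
rewrite -jE in hQ OQ; have EQ : E j = (E j0 + E (2 ^ k.+2))%N by move: hQ; rewrite /h; lia.
have Oq0 : O (2 ^ k) = 0%N by lia.
have [w [w0 [[e1 _ _ _]|[_ o1 _ _]]]] := h_pow k; last by lia.
have Eq4 : E (2 ^ k.+2) = (2 * E (2 ^ k))%N by move: hq; rewrite /h; lia.
have [j00|j0p] := posnP j0.
  have [x' [ex' ox']] := EO_surj (E (2 ^ k)).-1 0.
  have lt_x' : (x' < 2 ^ k)%N by apply: lt_decE => //; lia.
  have [hx Ox] := hO_top lt_x'.
  have E0 : E j0 = 0%N by rewrite j00.
  have -> : x = (x' + 2 ^ k)%N by apply: EO_inj; move: hx; rewrite /h; lia.
  rewrite jE j00 b4 b0 mulr0 add0r coef_shift add0n; apply: IH; lia.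
have Ej0 : (0 < E j0)%N.
  rewrite lt0n; apply/negP => /eqP z; have := @EO_inj j0 0.
  by rewrite (proj1 EO0) (proj2 EO0) => /(_ z) h0; lia.
have [x0 [ex0 ox0]] := EO_surj (E j0).-1 0.
have lt_x0 : (x0 < j0)%N by apply: lt_decE; lia.
have lt_x0Q : (x0 < 2 ^ k.+2)%N by lia.
have [hx Ox] := hO_top lt_x0Q.
have -> : x = (x0 + 2 ^ k.+2)%N by apply: EO_inj; move: hx; rewrite /h; lia.
rewrite jE b4 coefD coef_shift (IH j0); [|lia|lia|lia|lia].
have -> : (x0 + 2 ^ k.+2 = x0 + 3 * 2 ^ k + 2 ^ k)%N by lia.
rewrite coef_shift nz0P ?addr0 // => /bR.
have lt4x0 : (x0 < 4 * 2 ^ k)%N by lia.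
have [a1 a2] := h_add3 lt4x0; have sb := h_subadd j0 (2 ^ k).
(* If bit k of x0 is set, it is set in j0 too and j0 + 2^k loses weight through a carry; if it is
   clear, x0 + 3 2^k weighs strictly more. Either way the bound fails by one unit. *)
have [od|ev] := boolP (odd (x0 %/ 2 ^ k)).
  have odj : odd (j0 %/ 2 ^ k) by apply: (@bit_decE k x0) => //; lia.
  have lt4j0 : (j0 < 4 * 2 ^ k)%N by lia.
  by move: (h_carry lt4j0 odj) a1; rewrite /kR /le2 /h; lia.
by move: (a2 ev) sb; rewrite /kR /le2 /h; lia.
Qed.

Lemma rec4_shift (c : pseq) q : rec4 c -> rec4 (fun j => 'X^q * c (j + q)%N).
Proof.
move=> c4 k j; have -> : (j + 2 ^ k.+2 + q = j + q + 2 ^ k.+2)%N by lia.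
by rewrite c4 addnAC mulrDr !mulrA ![_ * 'X^q]mulrC.
Qed.

(** The plain bound is not strict and does not keep the second term of [rec4] away from the diagonal
    coefficient; this refinement, strict by one unit of O, does. Induction passes from k to k + 2,
    hence the two base cases. *)
Lemma bound_c (c : pseq) : rec4 c -> (forall j i, nz (c j) i -> kR 0 0 0 0 i j) ->
  (forall j i, (j < 4)%N -> nz (c (j + 1)%N) i -> kR 0 1 2 0 (i + 1)%N j) ->
  (forall j i, (j < 4)%N -> nz (c (j + 2)%N) i -> kR 0 1 2 2 (i + 2)%N j) ->
  forall k j i, nz (c (j + 2 ^ k)%N) i ->
    kR 0 1 (2 * h (2 ^ k)) (2 * O (2 ^ k)) (i + 2 ^ k)%N j.
Proof.
move=> c4 cR base1 base2; elim/ltn_ind => -[|[|k]] IH j i nzi.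
- have := @kR_rec4 _ 0 1 2 0 (rec4_shift 1 c4) _ j (i + 1)%N; apply.
    by move=> j' i' lt_j /nzXM [le_i nz']; rewrite -(subnK le_i); apply: base1.
  by rewrite /nz coef_shift.
- have := @kR_rec4 _ 0 1 2 2 (rec4_shift 2 c4) _ j (i + 2)%N; apply.
    by move=> j' i' lt_j /nzXM [le_i nz']; rewrite -(subnK le_i); apply: base2.
  by rewrite /nz coef_shift.
have [hq Oq] := hO_pow2 k.
have [w [w0 hw]] := h_pow k.
have q4 : (2 ^ k.+2 = 4 * 2 ^ k)%N by rewrite !expnS; lia.
move: nzi; rewrite c4 => /nzD [] /nzXM [le_i nzi].
  have := cR _ _ nzi.
  have := h_subadd (i - 2 ^ k.+2) (2 * 2 ^ k.+2).
  have -> : (i - 2 ^ k.+2 + 2 * 2 ^ k.+2 = i + 2 ^ k.+2)%N by lia.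
  have [hp Op] := hO_pow2 k.+1; rewrite -expnS.
  by rewrite /kR /le2 hp Op hq Oq /h; case: hw => -[-> -> -> ->]; lia.
have := IH k ltac:(lia) j _ nzi; rewrite subnK //.
have := h_subadd i (2 ^ k.+2).
by rewrite /kR /le2 hq Oq; lia.
Qed.

Lemma lead_c (c : pseq) : rec4 c ->
  (forall k j i, nz (c (j + 2 ^ k)%N) i ->
    kR 0 1 (2 * h (2 ^ k)) (2 * O (2 ^ k)) (i + 2 ^ k)%N j) ->
  (forall j, (j < 4)%N -> (c j)`_j = 1) -> forall j, (c j)`_j = 1.
Proof.
move=> c4 cB base; elim/ltn_ind => j IH.
have [lt4|/top4 [k [j0 [jE lt_j0]]]] := ltnP j 4; first exact: base.
have q0 : (0 < 2 ^ k)%N by rewrite expn_gt0.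
have q4 : (2 ^ k.+2 = 4 * 2 ^ k)%N by rewrite !expnS; lia.
have [hQ OQ] := hO_top lt_j0; have [hq Oq] := hO_pow2 k.
rewrite jE c4 coefD coef_shift IH; last by lia.
have -> : (j0 + 2 ^ k.+2 = j0 + 3 * 2 ^ k + 2 ^ k)%N by lia.
rewrite coef_shift nz0P ?addr0 // => /cB.
have -> : (j0 + 3 * 2 ^ k + 2 ^ k = j0 + 2 ^ k.+2)%N by lia.
by rewrite /kR /le2 hQ OQ hq Oq; lia.
Qed.

Lemma lead_deg4 (t : pseq) : rec4 t -> (forall j i, nz (t j) i -> (i <= j)%N) ->
  (forall j, (j < 4)%N -> (t j)`_j = 1) -> forall j, (t j)`_j = 1.
Proof.
move=> t4 tR base; elim/ltn_ind => j IH.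
have [lt4|/top4 [k [j0 [jE lt_j0]]]] := ltnP j 4; first exact: base.
have q4 : (2 ^ k.+2 = 4 * 2 ^ k)%N by rewrite !expnS; lia.
have q0 : (0 < 2 ^ k)%N by rewrite expn_gt0.
rewrite jE t4 coefD coef_shift IH; last by lia.
have -> : (j0 + 2 ^ k.+2 = j0 + 3 * 2 ^ k + 2 ^ k)%N by lia.
by rewrite coef_shift nz0P ?addr0 // => /tR; lia.
Qed.

Lemma lead_deg8 (t : pseq) : rec8 t t -> (forall j i, nz (t j) i -> (i <= j)%N) ->
  (forall j, (j < 8)%N -> (t j)`_j = 1) -> forall j, (t j)`_j = 1.
Proof.
move=> t8 tR base; elim/ltn_ind => j IH.
have [lt8|/top8 [k [j0 [jE lt_j0]]]] := ltnP j 8; first exact: base.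
have q8 : (2 ^ k.+3 = 8 * 2 ^ k)%N by rewrite !expnS; lia.
have q2 : (2 ^ k.+1 = 2 * 2 ^ k)%N by rewrite expnS.
have q0 : (0 < 2 ^ k)%N by rewrite expn_gt0.
rewrite jE t8 !coefD coef_shift IH; last by lia.
have -> : (j0 + 2 ^ k.+3 = j0 + 6 * 2 ^ k + 2 ^ k.+1)%N by lia.
rewrite coef_shift nz0P ?addr0 => [|/tR]; last by lia.
have -> : (j0 + 6 * 2 ^ k + 2 ^ k.+1 = j0 + 7 * 2 ^ k + 2 ^ k)%N by lia.
by rewrite coef_shift nz0P ?addr0 // => /tR; lia.
Qed.

(** At level k + 1, [rec4] coincides with the first two terms of [rec8], so in the sum only [y]
    feeds the third one. This is why [rec8] takes two families. *)
Lemma rec8_add (b y : pseq) : rec4 b -> rec8 y y -> rec8 (fun j => b j + y j) y.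
Proof.
move=> b4 y8 k j; rewrite y8 b4.
move: ('X^(2 ^ k.+3)) ('X^(2 ^ k.+1)) ('X^(2 ^ k)) (b j) (y j) => c1 c2 c3 x1 x2.
by move: (b _) (y (j + 2 ^ k.+1)%N) (y _) => x3 x4 x5; ring.
Qed.

Lemma bound_z (z y : pseq) : rec8 z y -> (forall j i, nz (y j) i -> kR 1 0 0 0 i j) ->
  (forall j i, (j < 8)%N -> nz (z j) i -> kR 1 1 0 0 i j) ->
  forall j i, nz (z j) i -> kR 1 1 0 0 i j.
Proof.
move=> z8 yR base; apply: (rec8_supp z8 yR base) => k i j lt_j; first exact: kR_cl1.
  by apply: (kR_shift lt_j); have [-> ->] := hO_pow2 k.+1; rewrite /le2; lia.
by apply: (kR_shift lt_j); have := hO_pow3 k; rewrite /le2; lia.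
Qed.

(** The bound on [y] kills the third term at x. Of the other two terms exactly one contributes: the
    first if O j0 > 0, the second if O j0 = 0. *)
Lemma lead_z (z y : pseq) : rec8 z y -> (forall j i, nz (y j) i -> kR 1 0 0 0 i j) ->
  (forall j i, nz (z j) i -> kR 1 1 0 0 i j) ->
  (forall j x, (j < 8)%N -> E x = E j -> (O x).+1 = O j -> (z j)`_x = 1) ->
  forall j x, E x = E j -> (O x).+1 = O j -> (z j)`_x = 1.
Proof.
move=> z8 yR zR base; elim/ltn_ind => j IH x ex ox.
have [lt8|/top8 [k [j0 [jE lt_j0]]]] := ltnP j 8; first exact: base.
have q0 : (0 < 2 ^ k)%N by rewrite expn_gt0.
have q8 : (2 ^ k.+3 = 8 * 2 ^ k)%N by rewrite !expnS; lia.
have q2 : (2 ^ k.+1 = 2 * 2 ^ k)%N by rewrite expnS.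
have [hQ OQ] := hO_top lt_j0; rewrite -jE in hQ OQ.
have EQ : E j = (E j0 + E (2 ^ k.+3))%N by move: hQ; rewrite /h; lia.
have [hp Op] := hO_pow2 k.+1.
have Ep : E (2 ^ k.+3) = (2 * E (2 ^ k.+1))%N by move: hp; rewrite /h; lia.
have third : ('X^(2 ^ k) * y (j0 + 2 ^ k)%N)`_x = 0.
  apply: nz0P => /nzXM [le_x /yR]; have := hO_pow3 k.
  have := h_subadd (x - 2 ^ k) (2 ^ k); rewrite subnK //.
  have := h_subadd j0 (2 ^ k).
  by rewrite /kR /le2; move: hQ OQ; rewrite /h; lia.
rewrite jE z8 !coefD third addr0.
have [Oj0|Oj0] := posnP (O j0); last first.
  have [x0 [ex0 ox0]] := EO_surj (E j0) (O j0).-1.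
  have lt_x0 : (x0 < j0)%N by apply: lt_decO; lia.
  have lt_x0Q : (x0 < 2 ^ k.+3)%N by lia.
  have [hx Ox] := hO_top lt_x0Q.
  have -> : x = (x0 + 2 ^ k.+3)%N by apply: EO_inj; move: hx; rewrite /h; lia.
  rewrite coef_shift (IH j0); [|lia|lia|lia].
  have -> : (x0 + 2 ^ k.+3 = x0 + 3 * 2 ^ k.+1 + 2 ^ k.+1)%N by lia.
  rewrite coef_shift nz0P ?addr0 // => /zR.
  have lt4x0 : (x0 < 4 * 2 ^ k.+1)%N by lia.
  have [a1 a2] := h_add3 lt4x0; have sb := h_subadd j0 (2 ^ k.+1).
  have [od|ev] := boolP (odd (x0 %/ 2 ^ k.+1)).
    have lt4j0 : (j0 < 4 * 2 ^ k.+1)%N by lia.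
    have odj : odd (j0 %/ 2 ^ k.+1) by apply: (@bit_decO k.+1 x0) => //; lia.
    by move: (h_carry lt4j0 odj) a1; rewrite /kR /le2 /h; lia.
  by move: (a2 ev) sb; rewrite /kR /le2 /h; lia.
(* Now O j = 2 O(2^(k+1)) > 0, so k + 1 is odd. Then x = x1 + 2^(k+1) without carry, and x1 is the
   leading index for j0 + 2^(k+1). *)
have [Op0|Ep0] := O_pow_case k.+1; first by lia.
rewrite nz0P ?add0r; last first.
  move=> /nzXM [le_x /zR]; have := h_subadd (x - 2 ^ k.+3) (2 ^ k.+3).
  by rewrite subnK // /kR /le2; move: hQ; rewrite /h; lia.
have [ea oa] := EO_add Oj0 Ep0.
have [w [w0 hw]] := h_pow k.+1.
have Opos : (0 < O (2 ^ k.+1))%N by lia.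
have [x1 [ex1 ox1]] := EO_surj (E j0) (O (2 ^ k.+1)).-1.
have [eb ob] := @EO_addpow k.+1 x1 Ep0 ltac:(lia).
have -> : x = (x1 + 2 ^ k.+1)%N by apply: EO_inj; lia.
by rewrite coef_shift; apply: IH; lia.
Qed.

Lemma bound_d (d : pseq) : rec4 d -> (forall j i, nz (d j) i -> hR 0 0 i j) ->
  (forall j i, (j < 4)%N -> nz (d (j + 1)%N) i -> hR 1 2 (i + 1)%N j) ->
  forall k j i, O (2 ^ k) = 0%N -> nz (d (j + 2 ^ k)%N) i ->
    hR 1 (2 * h (2 ^ k)) (i + 2 ^ k)%N j.
Proof.
move=> d4 dR base1; elim/ltn_ind => -[|[|k]] IH j i // ok nzi.
  have := @hR_rec4 _ 1 2 (rec4_shift 1 d4) _ j (i + 1)%N; apply.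
    by move=> j' i' lt_j /nzXM [le_i nz']; rewrite -(subnK le_i); apply: base1.
  by rewrite /nz coef_shift.
have [hq Oq] := hO_pow2 k; have [w [w0 hw]] := h_pow k.
have q4 : (2 ^ k.+2 = 4 * 2 ^ k)%N by rewrite !expnS; lia.
have okk : O (2 ^ k) = 0%N by lia.
move: nzi; rewrite d4 => /nzD [] /nzXM [le_i nzi].
  have := dR _ _ nzi; have := h_subadd (i - 2 ^ k.+2) (2 * 2 ^ k.+2).
  have -> : (i - 2 ^ k.+2 + 2 * 2 ^ k.+2 = i + 2 ^ k.+2)%N by lia.
  have [hp Op] := hO_pow2 k.+1; rewrite -expnS.
  by rewrite /hR /le2 hp Op hq /h; case: hw => -[e1 e2 e3 e4]; lia.
have := IH k ltac:(lia) j _ okk nzi; rewrite subnK //.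
have := h_subadd i (2 ^ k.+2).
by rewrite /hR /le2 hq; lia.
Qed.

(** In the third term f is written as d + (d + f), the second summand being covered by induction.
    For d alone, even k need the sharper bound of [bound_d], while odd k have room because
    h(2^(k+3)) = 4 h(2^k). *)
Lemma bound_e (d f : pseq) : rec4 d -> rec8 f f ->
  (forall j i, nz (d j) i -> hR 0 0 i j) ->
  (forall k j i, O (2 ^ k) = 0%N -> nz (d (j + 2 ^ k)%N) i ->
    hR 1 (2 * h (2 ^ k)) (i + 2 ^ k)%N j) ->
  (forall j i, (j < 8)%N -> nz (d j + f j) i -> hR 1 0 i j) ->
  forall j i, nz (d j + f j) i -> hR 1 0 i j.
Proof.
move=> d4 f8 dR dB base; have e8 := rec8_add d4 f8.
elim/ltn_ind => j IH i; have [lt8|/top8 [k [j0 [jE lt_j0]]]] := ltnP j 8; first exact: base.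
have q0 : (0 < 2 ^ k)%N by rewrite expn_gt0.
have q8 : (2 ^ k.+3 = 8 * 2 ^ k)%N by rewrite !expnS; lia.
have q2 : (2 ^ k.+1 = 2 * 2 ^ k)%N by rewrite expnS.
have [hp Op] := hO_pow2 k.+1; have h3 := hO_pow3 k.
rewrite jE e8 => /nzD [/nzD []|] /nzXM [le_i nzi]; rewrite -(subnK le_i).
- by apply: hR_cl1 => //; apply: IH nzi; lia.
- by apply: (hR_shift (a := 1) lt_j0); [rewrite hp; lia | apply: IH nzi; lia].
have fE : f (j0 + 2 ^ k)%N = d (j0 + 2 ^ k)%N + (d (j0 + 2 ^ k)%N + f (j0 + 2 ^ k)%N).
  by rewrite addrA poly_addff add0r.
rewrite fE in nzi; case: (nzD nzi) => {}nzi; last first.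
  apply: (hR_shift (a := 1) lt_j0); last by apply: IH nzi; lia.
  by move: h3; rewrite /le2; lia.
have [hQ OQ] := hO_top lt_j0.
have [w [w0 hw]] := h_pow k.
have [ok|nk] := posnP (O (2 ^ k)).
  have := dB k _ _ ok nzi; rewrite /hR hQ hp; move: h3; rewrite hp /le2; lia.
have := dR _ _ nzi; have := h_subadd (i - 2 ^ k) (2 ^ k); have := h_subadd j0 (2 ^ k).
by move: nk; rewrite /hR hQ hp /le2 /h; case: hw => -[-> -> -> ->]; lia.
Qed.

(** * Families generated by their initial terms, and checks by computation *)

Definition polyl (l : seq nat) : {poly 'F_2} := \sum_(i <- l) 'X^i.

Lemma polyl_cat l1 l2 : polyl (l1 ++ l2) = polyl l1 + polyl l2.
Proof. exact: big_cat. Qed.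

Lemma polyl_map n l : polyl (map (addn n) l) = 'X^n * polyl l.
Proof. by rewrite /polyl big_map big_distrr; apply: eq_bigr => i _; rewrite exprD. Qed.

Lemma coef_polyl l i : (polyl l)`_i = (odd (count_mem i l))%:R.
Proof.
elim: l => [|j l IH]; first by rewrite /polyl big_nil coef0.
rewrite /polyl big_cons coefD coefXn -/(polyl l) IH /= oddD eq_sym.
by case: eqP => _; case: odd => //=; rewrite ?F2_addxx ?addr0 ?add0r.
Qed.

(** A sliding window over four consecutive terms. Terms are lists of exponents with repetitions;
    only the parity of a multiplicity counts. *)
Fixpoint lit4 n (l0 l1 l2 l3 : seq nat) : seq nat :=
  if n is n'.+1 then lit4 n' l1 l2 l3 (map (addn 4) l0 ++ map (addn 1) l1) else l0.

Definition ls4 (b : seq (seq nat)) j :=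
  lit4 j (nth [::] b 0) (nth [::] b 1) (nth [::] b 2) (nth [::] b 3).

Lemma lit4_rec n l0 l1 l2 l3 : lit4 (n + 4) l0 l1 l2 l3 =
  map (addn 4) (lit4 n l0 l1 l2 l3) ++ map (addn 1) (lit4 (n + 1) l0 l1 l2 l3).
Proof. by elim: n l0 l1 l2 l3 => [|n IH] l0 l1 l2 l3 //=; rewrite IH. Qed.

Definition s4 b j := polyl (ls4 b j).

Lemma s4_rec b : rec4 (s4 b).
Proof.
apply: rec4_of => j.
by rewrite /s4 /ls4 lit4_rec polyl_cat !polyl_map expr1.
Qed.

Fixpoint lit8 n (l0 l1 l2 l3 l4 l5 l6 l7 : seq nat) : seq nat :=
  if n is n'.+1 then lit8 n' l1 l2 l3 l4 l5 l6 l7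
    (map (addn 8) l0 ++ map (addn 2) l2 ++ map (addn 1) l1) else l0.

Definition ls8 (b : seq (seq nat)) j :=
  lit8 j (nth [::] b 0) (nth [::] b 1) (nth [::] b 2) (nth [::] b 3)
         (nth [::] b 4) (nth [::] b 5) (nth [::] b 6) (nth [::] b 7).

Lemma lit8_rec n l0 l1 l2 l3 l4 l5 l6 l7 : lit8 (n + 8) l0 l1 l2 l3 l4 l5 l6 l7 =
  map (addn 8) (lit8 n l0 l1 l2 l3 l4 l5 l6 l7) ++
  map (addn 2) (lit8 (n + 2) l0 l1 l2 l3 l4 l5 l6 l7) ++
  map (addn 1) (lit8 (n + 1) l0 l1 l2 l3 l4 l5 l6 l7).
Proof. by elim: n l0 l1 l2 l3 l4 l5 l6 l7 => [|n IH] l0 l1 l2 l3 l4 l5 l6 l7 //=; rewrite IH. Qed.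

Definition s8 b j := polyl (ls8 b j).

Lemma s8_rec b : rec8 (s8 b) (s8 b).
Proof.
apply: rec8_of => j.
by rewrite /s8 /ls8 lit8_rec !polyl_cat !polyl_map expr1 addrA.
Qed.

Definition chkR (ls : nat -> seq nat) (R : nat -> nat -> bool) n :=
  all (fun j => all (fun i => odd (count_mem i (ls j)) ==> R i j) (ls j)) (iota 0 n).

Lemma chkRP ls R n j i : chkR ls R n -> (j < n)%N -> nz (polyl (ls j)) i -> R i j.
Proof.
move=> /allP /(_ j); rewrite mem_iota => H /H /allP /(_ i).
rewrite /nz coef_polyl; case: (boolP (odd _)) => [od|]; last by rewrite eqxx.
move=> h _; apply: implyP (h _) _ => //.
by rewrite -has_pred1 has_count; case: (count _ _) od.
Qed.

Definition chk1 (ls : nat -> seq nat) n := all (fun j => odd (count_mem j (ls j))) (iota 0 n).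

Lemma chk1P ls n j : chk1 ls n -> (j < n)%N -> (polyl (ls j))`_j = 1.
Proof. by move=> /allP /(_ j); rewrite mem_iota coef_polyl => H /H ->. Qed.

(** * Supports and leading coefficients of the entries of T3 and T7 *)

Lemma a_bound j i : nz (s4 base3_13 j) i -> kR 1 1 0 0 i j.
Proof.
apply: (kR_rec4 (s4_rec _)) => {}j {}i; apply: (@chkRP (ls4 base3_13)).
by vm_compute.
Qed.

Lemma b_bound j i : nz (s4 base3_17 j) i -> kR 1 0 0 0 i j.
Proof.
apply: (kR_rec4 (s4_rec _)) => {}j {}i; apply: (@chkRP (ls4 base3_17)).
by vm_compute.
Qed.

Lemma b_lead j x : O j = 0%N -> (E x).+1 = E j -> O x = 0%N -> (s4 base3_17 j)`_x = 1.
Proof.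
apply: (lead_b (s4_rec _)); first exact: b_bound.
  by rewrite /s4 /polyl big_nil.
by rewrite /s4 coef_polyl.
Qed.

Lemma c_bound j i : nz (s4 base3_93 j) i -> kR 0 0 0 0 i j.
Proof.
apply: (kR_rec4 (s4_rec _)) => {}j {}i; apply: (@chkRP (ls4 base3_93)).
by vm_compute.
Qed.

Lemma c_lead j : (s4 base3_93 j)`_j = 1.
Proof.
apply: (lead_c (s4_rec _)); last by move=> j'; apply: (@chk1P (ls4 base3_93)).
apply: (bound_c (s4_rec _)); first exact: c_bound.
  move=> j' i'; apply: (@chkRP (fun j => ls4 base3_93 (j + 1)) (fun i j => kR 0 1 2 0 (i + 1) j)%N).
  by vm_compute.
move=> j' i'; apply: (@chkRP (fun j => ls4 base3_93 (j + 2)) (fun i j => kR 0 1 2 2 (i + 2) j)%N).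
by vm_compute.
Qed.

Lemma d_bound j i : nz (s4 base3_97 j) i -> hR 0 0 i j.
Proof.
apply: (hR_rec4 (s4_rec _)) => {}j {}i; apply: (@chkRP (ls4 base3_97)).
by vm_compute.
Qed.

Lemma e_bound j i : nz (s4 base3_97 j + s8 base7_97 j) i -> hR 1 0 i j.
Proof.
apply: (bound_e (s4_rec _) (s8_rec _)); first exact: d_bound.
  apply: (bound_d (s4_rec _)); first exact: d_bound.
  move=> j' i'; apply: (@chkRP (fun j => ls4 base3_97 (j + 1)) (fun i j => hR 1 2 (i + 1) j)%N).
  by vm_compute.
move=> j' i'; rewrite -polyl_cat.
apply: (@chkRP (fun j => ls4 base3_97 j ++ ls8 base7_97 j)).
by vm_compute.
Qed.

Lemma y_bound j i : nz (s8 base7_17 j) i -> kR 1 0 0 0 i j.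
Proof.
apply: (kR_rec8 (s8_rec _)) => {}j {}i; apply: (@chkRP (ls8 base7_17)).
by vm_compute.
Qed.

(** Where h drops by exactly 1 and O does not drop, the T3 and T7 entries agree, so in the sum O
    drops too. This is what brings T3 + T7 into the kernel argument. *)
Lemma z_bound j i : nz (s4 base3_17 j + s8 base7_17 j) i -> kR 1 1 0 0 i j.
Proof.
apply: (bound_z (rec8_add (s4_rec _) (s8_rec _)) y_bound) => {}j {}i; rewrite -polyl_cat.
apply: (@chkRP (fun j => ls4 base3_17 j ++ ls8 base7_17 j)).
by vm_compute.
Qed.

Definition chkz (ls : nat -> seq nat) n :=
  all (fun j => all (fun x => (E x == E j) && ((O x).+1 == O j) ==> odd (count_mem x (ls j)))
    (iota 0 j)) (iota 0 n).

Lemma z_lead j x : E x = E j -> (O x).+1 = O j ->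
  (s4 base3_17 j + s8 base7_17 j)`_x = 1.
Proof.
apply: (lead_z (rec8_add (s4_rec _) (s8_rec _)) y_bound z_bound) => {}j {}x lt_j ex ox.
have lt_x := lt_decO ex ox.
rewrite -polyl_cat coef_polyl.
have : chkz (fun j => ls4 base3_17 j ++ ls8 base7_17 j) 8 by vm_compute.
move/allP/(_ j); rewrite mem_iota => /(_ lt_j) /allP /(_ x); rewrite mem_iota => /(_ lt_x).
by rewrite ex ox !eqxx => /implyP ->.
Qed.

Lemma s4_deg b : chkR (ls4 b) (fun i j => i <= j)%N 4 -> forall j i, nz (s4 b j) i -> (i <= j)%N.
Proof.
move=> ck; apply: (rec4_supp (s4_rec b)) => [j i|k i j|k i j]; first exact: chkRP ck.
  by lia.
by rewrite !expnS; lia.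
Qed.

Lemma s4_degS b : chkR (ls4 b) (fun i j => i < j)%N 4 -> forall j i, nz (s4 b j) i -> (i < j)%N.
Proof.
move=> ck; apply: (rec4_supp (s4_rec b)) => [j i|k i j|k i j]; first exact: chkRP ck.
  by lia.
by rewrite !expnS; lia.
Qed.

Lemma s8_deg b : chkR (ls8 b) (fun i j => i <= j)%N 8 -> forall j i, nz (s8 b j) i -> (i <= j)%N.
Proof.
move=> ck; apply: (rec8_supp_diag (s8_rec b)) => [j i|k i j|k i j|k i j]; first exact: chkRP ck.
- by lia.
- by rewrite !expnS; lia.
- by rewrite !expnS; lia.
Qed.

Lemma x31_deg j i : nz (s4 base3_31 j) i -> (i <= j)%N.
Proof. by apply: s4_deg; vm_compute. Qed.
Lemma x31_lead j : (s4 base3_31 j)`_j = 1.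
Proof.
apply: (lead_deg4 (s4_rec _) x31_deg) => {}j; apply: (@chk1P (ls4 base3_31)).
by vm_compute.
Qed.
Lemma x71_deg j i : nz (s4 base3_71 j) i -> (i < j)%N.
Proof. by apply: s4_degS; vm_compute. Qed.
Lemma y31_deg j i : nz (s8 base7_31 j) i -> (i <= j)%N.
Proof. by apply: s8_deg; vm_compute. Qed.
Lemma y71_deg j i : nz (s8 base7_71 j) i -> (i <= j)%N.
Proof. by apply: s8_deg; vm_compute. Qed.
Lemma y71_lead j : (s8 base7_71 j)`_j = 1.
Proof.
apply: (lead_deg8 (s8_rec _) y71_deg) => {}j; apply: (@chk1P (ls8 base7_71)).
by vm_compute.
Qed.

(* The weight of u^j D_c is 2 h j + wc c. *)
Definition wc (c : nat) : nat := if c == 1%N then 0 else if c == 9%N then 2 else 1.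

Definition wt_lt c c' i j := (2 * h i + wc c' < 2 * h j + wc c)%N.

Lemma s4_wt b c c' a : chkR (ls4 b) (hR a 0) 4 ->
  (wc c' < wc c + 2 * a)%N -> forall j i, nz (s4 b j) i -> wt_lt c c' i j.
Proof.
move=> ck lt_w j i nzi; have : hR a 0 i j.
  by apply: (hR_rec4 (s4_rec b)) nzi => {}j {}i; exact: chkRP ck.
by rewrite /hR /wt_lt; lia.
Qed.

Lemma s8_wt b c c' a : chkR (ls8 b) (hR a 0) 8 ->
  (wc c' < wc c + 2 * a)%N -> forall j i, nz (s8 b j) i -> wt_lt c c' i j.
Proof.
move=> ck lt_w j i nzi; have : hR a 0 i j.
  by apply: (hR_rec8 (s8_rec b)) nzi => {}j {}i; exact: chkRP ck.
by rewrite /hR /wt_lt; lia.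
Qed.

(** * The joint kernel of T3 and T7 *)

Lemma D_key : {d : nat -> Ft | forall c, d c = pr (s ^+ c)}.
Proof. by exists (fun c => pr (s ^+ c)). Qed.

Definition D : nat -> Ft := sval D_key.

Lemma D_def c : D c = pr (s ^+ c). Proof. exact: (svalP D_key). Qed.

Lemma vbE j c : vb j c = u ^+ j * D c. Proof. by rewrite D_def. Qed.

Lemma TD4 p (a b c d a' b' c' d' : Ft) :
  hecke_T p a = a' -> hecke_T p b = b' -> hecke_T p c = c' -> hecke_T p d = d' ->
  hecke_T p (a + b + c + d) = a' + b' + c' + d'.
Proof. by move=> <- <- <- <-; rewrite !TD. Qed.

Lemma ev_polyl l c : ev u (polyl l) * D c = \sum_(i <- l) vb i c.
Proof.
elim: l => [|i l IH]; first by rewrite /polyl !big_nil ev0 mul0r.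
by rewrite /polyl !big_cons evD evXn mulrDl -/(polyl l) IH vbE.
Qed.

Lemma u_dil3 : (u + dil 3 u) ^+ 4 = u * dil 3 u.
Proof.
rewrite /u dilX //; transitivity (((G + dil 3 G) ^+ 4) ^+ 4).
  by move: G (dil 3 G) => x y; ring2.
by rewrite G_dil3 exprMn.
Qed.

Lemma u_dil7 : (u + dil 7 u) ^+ 8 = u * dil 7 u + u ^+ 2 * dil 7 u ^+ 2.
Proof.
rewrite /u dilX //; transitivity (((G + dil 7 G) ^+ 8) ^+ 4).
  by move: G (dil 7 G) => x y; ring2.
by rewrite G_dil7; move: G (dil 7 G) => x y; ring2.
Qed.

Lemma T3_vb c c1 c2 b1 b2 : chk T3l c c1 c2 b1 b2 -> size b1 = 4 ->
  isc c -> isc c1 -> isc c2 -> forall j,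
  hecke_T 3 (vb j c) = ev u (s4 b1 j) * D c1 + ev u (s4 b2 j) * D c2.
Proof.
move=> ck sz1 hc h1 h2; elim/ltn_ind => j IH; have [lt4|ge4] := ltnP j 4.
  rewrite (chkP _ T3lP hc h1 h2 _ ck) ?sz1 // /s4 !ev_polyl.
  by move: j lt4 {IH} => [|[|[|[|//]]]].
have [j' jE] : exists j', j = (j' + 2 ^ 2)%N by exists (j - 4)%N; lia.
have e : vb j c = u ^+ 4 * vb j' c by rewrite jE /vb addnC exprD mulrA.
have e1 : u * vb j' c = vb (j' + 1) c by rewrite /vb addn1 exprS mulrA.
rewrite e (T_rel4 _ _ u_dil3) // e1 !IH; [|lia|lia].
rewrite jE !(s4_rec _ 0) expn0 !evD.
have ex (n : nat) p : ev u ('X^n * p) = u ^+ n * ev u p by rewrite (@evM _ 'X^n) evXn.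
rewrite !ex expr1; move: (ev u (s4 b1 j')) (ev u (s4 b1 (j' + 1)%N)) => x1 x2.
move: (ev u (s4 b2 j')) (ev u (s4 b2 (j' + 1)%N)) (D c1) (D c2) u => x3 x4 d1 d2 w.
by ring2.
Qed.

Lemma T7_vb c c1 c2 b1 b2 : chk T7l c c1 c2 b1 b2 -> size b1 = 8 ->
  isc c -> isc c1 -> isc c2 -> forall j,
  hecke_T 7 (vb j c) = ev u (s8 b1 j) * D c1 + ev u (s8 b2 j) * D c2.
Proof.
move=> ck sz1 hc h1 h2; elim/ltn_ind => j IH; have [lt8|ge8] := ltnP j 8.
  rewrite (chkP _ T7lP hc h1 h2 _ ck) ?sz1 // /s8 !ev_polyl.
  by move: j lt8 {IH}; do 8?[case=> //].
have [j' jE] : exists j', j = (j' + 2 ^ 3)%N by exists (j - 8)%N; lia.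
have e : vb j c = u ^+ 8 * vb j' c by rewrite jE /vb addnC exprD mulrA.
have e1 : u * vb j' c = vb (j' + 1) c by rewrite /vb addn1 exprS mulrA.
have e2 : u ^+ 2 * vb j' c = vb (j' + 2) c by rewrite /vb addnC exprD mulrA.
rewrite e (T_rel8 _ _ u_dil7) // e1 e2 !IH; [|lia|lia|lia].
rewrite jE !(s8_rec _ 0) (_ : 2 ^ 0.+1 = 2)%N // (_ : 2 ^ 0.+3 = 8)%N // (_ : 2 ^ 0 = 1)%N // !evD.
have ex (n : nat) p : ev u ('X^n * p) = u ^+ n * ev u p by rewrite (@evM _ 'X^n) evXn.
rewrite !ex !expr1; move: (ev u (s8 b1 j')) (ev u (s8 b1 (j' + 1)%N)) (ev u (s8 b1 (j' + 2)%N)) => x1 x2 x3.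
move: (ev u (s8 b2 j')) (ev u (s8 b2 (j' + 1)%N)) (ev u (s8 b2 (j' + 2)%N)) (D c1) (D c2) u => y1 y2 y3 d1 d2 w.
by ring2.
Qed.

(** The F_2-linear map 'X^j -> t j. It is not F_2[u]-linear, since T3 and T7 are not. *)
Definition L (t : pseq) (g : {poly 'F_2}) : {poly 'F_2} := \sum_(j < size g) g`_j *: t j.

Lemma T_ev p c c1 c2 (t1 t2 : pseq) g :
  (forall j, hecke_T p (vb j c) = ev u (t1 j) * D c1 + ev u (t2 j) * D c2) ->
  hecke_T p (ev u g * D c) = ev u (L t1 g) * D c1 + ev u (L t2 g) * D c2.
Proof.
move=> Tv; rewrite (evS u (leqnn _)) big_distrl /= (big_morph _ (TD p) (T0 _ p)) /L.
rewrite !(big_morph (ev u) (@evD u) (ev0 u)) !big_distrl -big_split /=.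
apply: eq_bigr => j _; rewrite -scalerAl TZ -vbE Tv !evZ -!scalerAl.
by rewrite scalerDr.
Qed.

Definition W (g1 g3 g7 g9 : {poly 'F_2}) : Ft :=
  ev u g1 * D 1%N + ev u g3 * D 3%N + ev u g7 * D 7%N + ev u g9 * D 9%N.

Definition X13 := L (s4 base3_13). Definition X17 := L (s4 base3_17).
Definition X31 := L (s4 base3_31). Definition X39 := L (s4 base3_39).
Definition X71 := L (s4 base3_71). Definition X79 := L (s4 base3_79).
Definition X93 := L (s4 base3_93). Definition X97 := L (s4 base3_97).
Definition Y13 := L (s8 base7_13). Definition Y17 := L (s8 base7_17).
Definition Y31 := L (s8 base7_31). Definition Y39 := L (s8 base7_39).
Definition Y71 := L (s8 base7_71). Definition Y79 := L (s8 base7_79).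
Definition Y93 := L (s8 base7_93). Definition Y97 := L (s8 base7_97).

(** T3 and T7 exchange the exponents 1 and 3 mod 4, hence the blocks {1, 9} and {3, 7}; the kernel
    splits accordingly into [ker_plus] and [ker_minus]. *)
Lemma T3_W g1 g3 g7 g9 : hecke_T 3 (W g1 g3 g7 g9) =
  W (X31 g3 + X71 g7) (X13 g1 + X93 g9) (X17 g1 + X97 g9) (X39 g3 + X79 g7).
Proof.
have /and4P [k1 k3 k7 k9] := chk3.
have e1 := T_ev g1 (T3_vb k1 (erefl _) isT isT isT).
have e3 := T_ev g3 (T3_vb k3 (erefl _) isT isT isT).
have e7 := T_ev g7 (T3_vb k7 (erefl _) isT isT isT).
have e9 := T_ev g9 (T3_vb k9 (erefl _) isT isT isT).
apply: (etrans (TD4 e1 e3 e7 e9)); clear; rewrite /W !evD.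
rewrite -/(X13 g1) -/(X17 g1) -/(X31 g3) -/(X39 g3) -/(X71 g7) -/(X79 g7) -/(X93 g9) -/(X97 g9).
move: (ev u (X13 g1)) (ev u (X17 g1)) (ev u (X31 g3)) (ev u (X39 g3)) => x1 x2 x3 x4.
move: (ev u (X71 g7)) (ev u (X79 g7)) (ev u (X93 g9)) (ev u (X97 g9)) => x5 x6 x7 x8.
by move: (D 1%N) (D 3%N) (D 7%N) (D 9%N) => d1 d3 d7 d9; ring2.
Qed.

Lemma T7_W g1 g3 g7 g9 : hecke_T 7 (W g1 g3 g7 g9) =
  W (Y31 g3 + Y71 g7) (Y13 g1 + Y93 g9) (Y17 g1 + Y97 g9) (Y39 g3 + Y79 g7).
Proof.
have /and4P [k1 k3 k7 k9] := chk7.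
have e1 := T_ev g1 (T7_vb k1 (erefl _) isT isT isT).
have e3 := T_ev g3 (T7_vb k3 (erefl _) isT isT isT).
have e7 := T_ev g7 (T7_vb k7 (erefl _) isT isT isT).
have e9 := T_ev g9 (T7_vb k9 (erefl _) isT isT isT).
apply: (etrans (TD4 e1 e3 e7 e9)); clear; rewrite /W !evD.
rewrite -/(Y13 g1) -/(Y17 g1) -/(Y31 g3) -/(Y39 g3) -/(Y71 g7) -/(Y79 g7) -/(Y93 g9) -/(Y97 g9).
move: (ev u (Y13 g1)) (ev u (Y17 g1)) (ev u (Y31 g3)) (ev u (Y39 g3)) => x1 x2 x3 x4.
move: (ev u (Y71 g7)) (ev u (Y79 g7)) (ev u (Y93 g9)) (ev u (Y97 g9)) => x5 x6 x7 x8.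
by move: (D 1%N) (D 3%N) (D 7%N) (D 9%N) => d1 d3 d7 d9; ring2.
Qed.

Definition cn (n : nat) : nat := nth 1%N [:: 1; 3; 7; 9]%N (n %% 4).

Lemma sum4 (f : nat -> Ft) N : \sum_(n < 4 * N) f n =
  \sum_(j < N) (f (4 * j)%N + f (4 * j + 1)%N + f (4 * j + 2)%N + f (4 * j + 3)%N).
Proof.
elim: N => [|N IH]; first by rewrite muln0 !big_ord0.
rewrite [RHS]big_ord_recr /= -IH; have -> : (4 * N.+1 = (4 * N).+4)%N by lia.
by rewrite !big_ord_recr /= !addrA addn1 addn2 addn3.
Qed.

Lemma ev_poly A N (g : nat -> 'F_2) :
  ev A (\poly_(i < N) g i) = \sum_(i < N) g i *: A ^+ i.
Proof. by rewrite poly_def; exact: ev_sum. Qed.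

Lemma W_sum N (c : nat -> 'F_2) : \sum_(n < 4 * N) c n *: vb (n %/ 4) (cn n) =
  W (\poly_(j < N) c (4 * j)%N) (\poly_(j < N) c (4 * j + 1)%N)
    (\poly_(j < N) c (4 * j + 2)%N) (\poly_(j < N) c (4 * j + 3)%N).
Proof.
rewrite (sum4 (fun n => c n *: vb (n %/ 4) (cn n))) /W !ev_poly !big_distrl -!big_split /=.
apply: eq_bigr => j _; rewrite -!scalerAl -!vbE.
have d0 i : (i < 4)%N -> ((4 * j + i) %/ 4 = j)%N /\ ((4 * j + i) %% 4 = i)%N by lia.
have [e1 e2] := d0 0%N isT; rewrite addn0 in e1 e2.
have [e3 e4] := d0 1%N isT; have [e5 e6] := d0 2%N isT; have [e7 e8] := d0 3%N isT.
rewrite /cn e1 e2 e3 e4 e5 e6 e7 e8 /=; reflexivity.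
Qed.

Lemma isc_cn n : isc (cn n).
Proof.
rewrite /cn; have : (n %% 4 < 4)%N by rewrite ltn_mod.
by case: (n %% 4)%N => [|[|[|[|]]]].
Qed.

Lemma vb_indep N (c : nat -> 'F_2) :
  \sum_(n < N) c n *: vb (n %/ 4) (cn n) = 0 -> forall n, (n < N)%N -> c n = 0.
Proof.
apply: (@val_indep (fun n => vb (n %/ 4) (cn n)) (fun n => 20 * (n %/ 4) + cn n)%N).
  move=> m n lt_mn; have [lt_d|ge_d] := ltnP (m %/ 4) (n %/ 4).
    have : (cn m <= 9)%N by rewrite /cn; case: (m %% 4)%N => [|[|[|[|k]]]] //=; rewrite nth_nil.
    by lia.
  have e : (m %/ 4 = n %/ 4)%N by lia.
  rewrite e ltn_add2l /cn; have : (m %% 4 < n %% 4)%N by lia.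
  have : (n %% 4 < 4)%N by rewrite ltn_mod.
  by case: (m %% 4)%N => [|[|[|[|m']]]]; case: (n %% 4)%N => [|[|[|[|n']]]].
by move=> n; apply: val_vb; apply: isc_cn.
Qed.

Lemma W_inj g1 g3 g7 g9 : W g1 g3 g7 g9 = 0 -> [/\ g1 = 0, g3 = 0, g7 = 0 & g9 = 0].
Proof.
pose N := (size g1 + size g3 + size g7 + size g9)%N.
pose c n := if (n %% 4 == 0)%N then g1`_(n %/ 4) else if (n %% 4 == 1)%N then g3`_(n %/ 4)
  else if (n %% 4 == 2)%N then g7`_(n %/ 4) else g9`_(n %/ 4).
have d0 j i : (i < 4)%N -> ((4 * j + i) %/ 4 = j)%N /\ ((4 * j + i) %% 4 = i)%N by lia.
have c0 j : c (4 * j)%N = g1`_j by have := d0 j 0%N isT; rewrite addn0 /c => -[-> ->].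
have c1 j : c (4 * j + 1)%N = g3`_j by have := d0 j 1%N isT; rewrite /c => -[-> ->].
have c2 j : c (4 * j + 2)%N = g7`_j by have := d0 j 2%N isT; rewrite /c => -[-> ->].
have c3 j : c (4 * j + 3)%N = g9`_j by have := d0 j 3%N isT; rewrite /c => -[-> ->].
have pE (g : {poly 'F_2}) (f : nat -> 'F_2) : (size g <= N)%N -> (forall j, f j = g`_j) ->
    \poly_(j < N) f j = g.
  move=> szg fg; apply/polyP => i; rewrite coef_poly fg; case: ltnP => // le_i.
  by rewrite nth_default // (leq_trans szg).
move=> W0; have := @W_sum N c.
rewrite (pE g1 _ _ c0) ?(pE g3 _ _ c1) ?(pE g7 _ _ c2) ?(pE g9 _ _ c3) ?W0; [|rewrite /N; lia..].
move/vb_indep => cz.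
have z (g : {poly 'F_2}) i : (size g <= N)%N -> (i < 4)%N ->
    (forall j, c (4 * j + i)%N = g`_j) -> g = 0.
  move=> szg lt_i cg; apply/polyP => j; rewrite coef0 -cg.
  have [lt_j|le_j] := ltnP j N; first by apply: cz; lia.
  by rewrite cg nth_default // (leq_trans szg).
split; [apply: (z _ 0%N) | apply: (z _ 1%N) | apply: (z _ 2%N) | apply: (z _ 3%N)] => //; try by rewrite /N; lia.
by move=> j; rewrite addn0.
Qed.

Lemma nz_size (g : {poly 'F_2}) j : nz g j -> (j < size g)%N.
Proof. by move=> nzj; rewrite ltnNge; apply/negP => /(nth_default 0) e; rewrite /nz e eqxx in nzj. Qed.

Lemma nz1 (g : {poly 'F_2}) j : nz g j -> g`_j = 1.
Proof. by rewrite /nz; case: (F2_cases g`_j) => ->; rewrite ?eqxx. Qed.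

Lemma L_coef0 (t : pseq) g i : (forall j, nz g j -> ~ nz (t j) i) -> (L t g)`_i = 0.
Proof.
move=> h0; rewrite /L coef_sum big1 // => j _; rewrite coefZ.
have [->|/h0 /nz0P ->] := eqVneq g`_j 0; first by rewrite mul0r.
by rewrite mulr0.
Qed.

Lemma L_coef1 (t : pseq) g i j0 : nz g j0 -> (t j0)`_i = 1 ->
  (forall j, nz g j -> nz (t j) i -> j = j0) -> (L t g)`_i = 1.
Proof.
move=> nz0 t1 uniq; rewrite /L coef_sum (bigD1 (Ordinal (nz_size nz0))) //= big1.
  by rewrite coefZ t1 (nz1 nz0) mulr1 addr0.
move=> j ne_j; rewrite coefZ; have [->|nzj] := eqVneq g`_j 0; first by rewrite mul0r.
rewrite (@nz0P (t j)) ?mulr0 // => nzt; move/negP: ne_j; apply.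
by apply/eqP/val_inj; apply: uniq.
Qed.

Lemma L_add (t1 t2 : pseq) g : L t1 g + L t2 g = L (fun j => t1 j + t2 j) g.
Proof. by rewrite /L -big_split; apply: eq_bigr => j _; rewrite scalerDr. Qed.

Lemma ex_max (P : pred nat) N (f : nat -> nat) j : (forall i, P i -> (i < N)%N) -> P j ->
  exists2 j0, P j0 & forall i, P i -> (f i <= f j0)%N.
Proof.
move=> PN Pj; case: (@arg_maxnP 'I_N (Ordinal (PN j Pj)) (fun i => P i) (fun i => f i)) => // i0 P0 mx.
by exists (i0 : nat) => // i Pi; have := mx (Ordinal (PN i Pi)) Pi.
Qed.

Lemma ex_lexmax (P : pred nat) N j : (forall i, P i -> (i < N)%N) -> P j ->
  exists2 j0, P j0 & forall i, P i -> le2 (h i) (O i) (h j0) (O j0).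
Proof.
move=> PN Pj; have [j1 P1 m1] := ex_max h PN Pj.
pose Q i := P i && (h i == h j1).
have QN i : Q i -> (i < N)%N by move=> /andP [/PN].
have Q1 : Q j1 by rewrite /Q P1 eqxx.
have [j0 /andP [P0 /eqP h0] m0] := ex_max O QN Q1.
exists j0 => // i Pi; have := m1 i Pi; have := m0 i; rewrite /Q Pi /le2 h0 /=.
by case: eqP => [-> /(_ isT)|]; lia.
Qed.

Lemma le2_anti i j : le2 (h i) (O i) (h j) (O j) -> le2 (h j) (O j) (h i) (O i) -> i = j.
Proof. by rewrite /le2 => h1 h2; apply: h_inj; lia. Qed.

(** Ordinary degree suffices here. At the largest index n present, T3 keeps the degree on g3 and
    lowers it on g7, so g3 does not reach n; then T7, which keeps the degree on g7, gives
    coefficient 1 at n. *)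
Lemma ker_minus g3 g7 : X31 g3 + X71 g7 = 0 -> Y31 g3 + Y71 g7 = 0 -> g3 = 0 /\ g7 = 0.
Proof.
move=> Xz Yz; pose P j := nz g3 j || nz g7 j.
have PN i : P i -> (i < size g3 + size g7)%N by case/orP => /nz_size; lia.
have [noP|] := pselect (forall j, ~ P j).
  by split; apply/polyP => j; rewrite coef0; apply: nz0P => nzj; apply: (noP j); rewrite /P nzj ?orbT.
move/existsNP => [j /contrapT Pj]; exfalso.
have [n Pn mx] := ex_max id PN Pj.
have z7 : (X71 g7)`_n = 0.
  by apply: L_coef0 => i nzi /x71_deg; have := mx i; rewrite /P nzi orbT => /(_ isT) /=; lia.
have n3 : ~ nz g3 n.
  move=> nz3; have : (X31 g3 + X71 g7)`_n = 1.
    rewrite coefD z7 addr0; apply: (L_coef1 nz3 (x31_lead n)) => i nzi /x31_deg.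
    by have := mx i; rewrite /P nzi => /(_ isT) /=; lia.
  by rewrite Xz coef0 => /esym/eqP; rewrite oner_eq0.
have nz7 : nz g7 n by case/orP: Pn.
have : (Y31 g3 + Y71 g7)`_n = 1.
  rewrite coefD (@L_coef0 (s8 base7_31)); last first.
    move=> i nzi /y31_deg le_n; have := mx i; rewrite /P nzi => /(_ isT) /= le_i.
    by apply: n3; have -> : n = i by lia.
  rewrite add0r; apply: (L_coef1 nz7 (y71_lead n)) => i nzi /y71_deg.
  by have := mx i; rewrite /P nzi orbT => /(_ isT) /=; lia.
by rewrite Yz coef0 => /esym/eqP; rewrite oner_eq0.
Qed.

(** Let j1 and j9 be the (h, O)-maximal indices of g1 and g9. The D_3 coordinate of T3 keeps j9 and
    strictly lowers g1, which forces h j9 < h j1. If h j1 > 0, the D_7 coordinate then shows the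
    leading term of j1: in T3 + T7 when O j1 > 0, in T3 when O j1 = 0. *)
Lemma ker_plus g1 g9 : X13 g1 + X93 g9 = 0 -> X17 g1 + X97 g9 = 0 -> Y17 g1 + Y97 g9 = 0 ->
  g9 = 0 /\ g1 = (g1`_0)%:P.
Proof.
move=> X3 X7 Y7.
have Z7 : L (fun j => s4 base3_17 j + s8 base7_17 j) g1 +
          L (fun j => s4 base3_97 j + s8 base7_97 j) g9 = 0.
  by rewrite -!L_add addrACA -/(X17 g1) -/(X97 g9) -/(Y17 g1) -/(Y97 g9) X7 Y7 addr0.
have N9 i : nz g9 i -> (i < size g9)%N by exact: nz_size.
have N1 i : nz g1 i -> (i < size g1)%N by exact: nz_size.
(* a maximal index of g9 of weight not below those of g1 survives in X13, X93 *)
have top9 j9 : nz g9 j9 -> (forall j, nz g9 j -> le2 (h j) (O j) (h j9) (O j9)) ->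
    (forall j, nz g1 j -> ~~ le2 (h j9).+1 (O j9).+1 (h j) (O j)) -> False.
  move=> nz9 mx9 small1; have : (X13 g1 + X93 g9)`_j9 = 1.
    rewrite coefD (@L_coef0 (s4 base3_13)); last first.
      by move=> j /small1 /negP s1 /a_bound; rewrite /kR !addn0 !addn1.
    rewrite add0r; apply: (L_coef1 nz9 (c_lead j9)) => j nzj /c_bound; rewrite /kR !addn0 => le1.
    by apply: le2_anti le1; exact: mx9.
  by rewrite X3 coef0 => /esym/eqP; rewrite oner_eq0.
have [no1|] := pselect (forall j, ~ nz g1 j).
  have [no9|] := pselect (forall j, ~ nz g9 j).
    split; apply/polyP => j; rewrite ?coef0 ?coefC; first exact: nz0P.
    by case: eqP => [-> //|_]; apply: nz0P.
  move/existsNP => [j /contrapT nzj]; have [j9 nz9 mx9] := ex_lexmax N9 nzj.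
  by exfalso; apply: (top9 j9) => // j1 /no1.
move/existsNP => [j /contrapT nzj]; have [j1 nz1 mx1] := ex_lexmax N1 nzj.
have lt91 j9 : nz g9 j9 -> (h j9 < h j1)%N.
  move=> nz9; rewrite ltnNge; apply/negP => le1.
  have [k9 nzk mxk] := ex_lexmax N9 nz9; apply: (top9 k9 nzk mxk) => i /mx1.
  by have := mxk _ nz9; rewrite /le2; lia.
have [h0|hpos] := posnP (h j1).
  have no9 i : ~ nz g9 i by move/lt91; rewrite h0.
  have all0 i : nz g1 i -> i = 0%N.
    by move/mx1; rewrite /le2 => le_i; apply: EO_inj; rewrite ?(proj1 EO0) ?(proj2 EO0); move: le_i; rewrite h0 /h; lia.
  split; apply/polyP => i; rewrite ?coef0 ?coefC; first exact: nz0P.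
  by case: eqP => [-> //|ne]; apply: nz0P => /all0.
exfalso; have [O0|Opos] := posnP (O j1); last first.
  have [x [ex ox]] := EO_surj (E j1) (O j1).-1.
  have ox1 : (O x).+1 = O j1 by lia.
  have : (L (fun j => s4 base3_17 j + s8 base7_17 j) g1 +
          L (fun j => s4 base3_97 j + s8 base7_97 j) g9)`_x = 1.
    rewrite coefD [X in _ + X]L_coef0; last first.
      by move=> i /lt91 lt_i /e_bound; rewrite /hR /h in lt_i *; lia.
    rewrite addr0; apply: (L_coef1 nz1 (z_lead ex ox1)) => i nzi /z_bound; rewrite /kR !addn0 !addn1 => le1.
    by apply: le2_anti; [exact: mx1 | move: le1; rewrite /le2 /h; lia].
  by rewrite Z7 coef0 => /esym/eqP; rewrite oner_eq0.
(* On g9 the D_7 entry of T3 need not lower h, so an index with h = h j1 - 1 could interfere. It is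
   excluded by the D_3 coordinate again, since O j1 = 0 leaves no room for a drop of O. *)
have [|no] := pselect (exists j9, nz g9 j9 && ((h j9).+1 == h j1)).
  move=> [j9 /andP [nz9 /eqP h9]]; have [k9 nzk mxk] := ex_lexmax N9 nz9.
  apply: (top9 k9 nzk mxk) => i /mx1; have := mxk _ nz9; have := lt91 _ nzk.
  by rewrite /le2; lia.
have Epos : (0 < E j1)%N by move: hpos; rewrite /h; lia.
have [x [ex ox]] := EO_surj (E j1).-1 0.
have ex1 : (E x).+1 = E j1 by lia.
have : (X17 g1 + X97 g9)`_x = 1.
  rewrite coefD [X in _ + X]L_coef0; last first.
    move=> i nzi /d_bound; rewrite /hR !addn0 => le_i; have lt_i := lt91 _ nzi.
    by apply: no; exists i; rewrite nzi /=; apply/eqP; move: le_i lt_i; rewrite /h; lia.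
  rewrite addr0; apply: (L_coef1 nz1 (b_lead O0 ex1 ox)) => i nzi /b_bound; rewrite /kR !addn0 => le1.
  by apply: le2_anti; [exact: mx1 | move: le1; rewrite /le2 /h; lia].
by rewrite X7 coef0 => /esym/eqP; rewrite oner_eq0.
Qed.

Lemma ker_W g1 g3 g7 g9 : hecke_T 3 (W g1 g3 g7 g9) = 0 -> hecke_T 7 (W g1 g3 g7 g9) = 0 ->
  W g1 g3 g7 g9 = g1`_0 *: D 1%N.
Proof.
rewrite T3_W T7_W => /W_inj [x1 x3 x7 _] /W_inj [y1 _ y7 _].
have [-> ->] := ker_minus x1 y1; have [-> e1] := ker_plus x3 x7 y7.
by rewrite /W {1}e1 evC !ev0 !mul0r !addr0 mulr_algl.
Qed.

(** * Adapted bases *)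

Section AdaptedBasis.
Variables (V : lmodType 'F_2) (S : set V) (X Y : V -> V) (lam : V -> 'F_2).
Variables (Fil : nat -> V -> Prop) (bas : nat -> nat -> V).
Hypothesis XD : forall v w, X (v + w) = X v + X w.
Hypothesis YD : forall v w, Y (v + w) = Y v + Y w.
Hypothesis lamD : forall v w, lam (v + w) = lam v + lam w.
Hypothesis XY : forall v, X (Y v) = Y (X v).
Hypothesis FilS : forall n v, Fil n v -> S v.
Hypothesis SFil : forall v, S v -> exists n, Fil n v.
Hypothesis FilD : forall n v w, Fil n v -> Fil n w -> Fil n (v + w).
Hypothesis Fil_mono : forall n m v, (n <= m)%N -> Fil n v -> Fil m v.
Hypothesis Fil0 : forall v, Fil 0 v -> v = 0.
Hypothesis FilX : forall n v, Fil n.+1 v -> Fil n (X v).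
Hypothesis FilY : forall n v, Fil n.+1 v -> Fil n (Y v).
Hypothesis ker_XY : forall v, S v -> X v = 0 -> Y v = 0 -> lam v = 0 -> v = 0.
Hypothesis bas_Fil : forall a b, Fil (a + b).+1 (bas a b).
Hypothesis bas_indep : forall (T : finType) (x : T -> nat * nat) (c : T -> 'F_2), injective x ->
  \sum_t c t *: bas (x t).1 (x t).2 = 0 -> forall t, c t = 0.

Lemma vaddvv (v : V) : v + v = 0.
Proof. by rewrite -[v]scale1r -scalerDl F2_addxx scale0r. Qed.

Lemma vadd_eq0 (v w : V) : v + w = 0 -> v = w.
Proof. by move=> vw; rewrite -[v]addr0 -(vaddvv w) addrA vw add0r. Qed.

Lemma add_fun0 (W : zmodType) (f : V -> W) : (forall v w, f (v + w) = f v + f w) -> f 0 = 0.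
Proof. by move=> fD; apply: (@addrI _ (f 0)); rewrite addr0 -fD addr0. Qed.

Definition Theta a b v := lam (iter a X (iter b Y v)).

Lemma iterD (Z : V -> V) : (forall v w, Z (v + w) = Z v + Z w) ->
  forall a v w, iter a Z (v + w) = iter a Z v + iter a Z w.
Proof. by move=> ZD a v w; elim: a => //= a ->. Qed.

Lemma ThetaD a b v w : Theta a b (v + w) = Theta a b v + Theta a b w.
Proof. by rewrite /Theta (iterD YD) (iterD XD) lamD. Qed.

Lemma Theta0 a b : Theta a b 0 = 0. Proof. exact: add_fun0 (ThetaD a b). Qed.

Lemma ThetaZ a b c v : Theta a b (c *: v) = c * Theta a b v.
Proof. by case: (F2_cases c) => ->; rewrite ?scale0r ?mul0r ?Theta0 ?scale1r ?mul1r. Qed.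

Lemma Theta_sum a b (T : finType) (v : T -> V) (c : T -> 'F_2) :
  Theta a b (\sum_t c t *: v t) = \sum_t c t * Theta a b (v t).
Proof.
rewrite (big_morph (Theta a b) (ThetaD a b) (Theta0 a b)).
by apply: eq_bigr => t _; rewrite ThetaZ.
Qed.

Lemma ThetaX a b v : Theta a b (X v) = Theta a.+1 b v.
Proof.
rewrite /Theta iterSr; congr (lam (iter a X _)).
by elim: b => //= b ->; rewrite XY.
Qed.

Lemma ThetaY a b v : Theta a b (Y v) = Theta a b.+1 v.
Proof. by rewrite /Theta iterSr. Qed.

(** [X (bas 0 0)] has level 0, hence is 0; so 0 belongs to level 0. *)
Lemma Fil_zero n : Fil n 0.
Proof.
have := bas_Fil 0 0 => b0; have := FilX b0; move/Fil0: (FilX b0) => -> h.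
exact: Fil_mono h.
Qed.

Lemma Fil_sum n (T : finType) (v : T -> V) (c : T -> 'F_2) :
  (forall t, Fil n (v t)) -> Fil n (\sum_t c t *: v t).
Proof.
move=> Fv; apply: big_ind => [|x y|t _]; [exact: Fil_zero|exact: FilD|].
by case: (F2_cases (c t)) => ->; rewrite ?scale0r ?scale1r //; exact: Fil_zero.
Qed.

Lemma Theta_Fil n a b v : Fil n v -> (n <= a + b)%N -> Theta a b v = 0.
Proof.
elim: b n v => [|b IH] n v Fv le_n; last first.
  rewrite -ThetaY; case: n Fv le_n => [/Fil0 ->|n Fv] le_n; last by apply: IH (FilY Fv) _; lia.
  by rewrite (add_fun0 YD) Theta0.
elim: a n v Fv le_n => [|a IHa] n v Fv le_n; rewrite -?ThetaX.
  have -> : v = 0 by apply: Fil0; move: Fv; have -> : n = 0%N by lia.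
  exact: Theta0.
case: n Fv le_n => [/Fil0 ->|n Fv] le_n; last by apply: IHa (FilX Fv) _; lia.
by rewrite (add_fun0 XD) Theta0.
Qed.

(** Induction on the level: the coordinates of X v and Y v are shifts of those of v, so both vanish,
    and v falls in the joint kernel. *)
Lemma Theta_inj n v : Fil n v -> (forall a b, Theta a b v = 0) -> v = 0.
Proof.
elim: n v => [|n IH] v Fv Tv; first exact: Fil0.
apply: (ker_XY (FilS Fv)); last exact: (Tv 0 0)%N.
  by apply: IH (FilX Fv) _ => a b; rewrite ThetaX.
by apply: IH (FilY Fv) _ => a b; rewrite ThetaY.
Qed.

(* Both sides have dimension n (n + 1) / 2, so injectivity of Theta suffices. *)
Lemma Theta_surj n (d : nat -> nat -> 'F_2) :
  exists2 v, Fil n v & forall a b, (a + b < n)%N -> Theta a b v = d a b.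
Proof.
pose T := {x : 'I_n * 'I_n | (x.1 + x.2 < n)%N}.
pose x (t : T) : nat * nat := (val (val t).1, val (val t).2).
have x_inj : injective x.
  by move=> [[a b] p] [[a' b'] p'] [/= /val_inj ea /val_inj eb]; apply: val_inj; rewrite /= ea eb.
pose comb (c : T -> 'F_2) := \sum_t c t *: bas (x t).1 (x t).2.
have comb_Fil c : Fil n (comb c).
  by apply: Fil_sum => t; apply: Fil_mono (bas_Fil _ _); exact: (valP t).
pose Phi (c : {ffun T -> 'F_2}) : {ffun T -> 'F_2} := [ffun t => Theta (x t).1 (x t).2 (comb c)].
have Phi_inj : injective Phi.
  move=> c c' /ffunP eq_c; apply/ffunP => t; suff : c t + c' t = 0.
    by case: (F2_cases (c t)) (F2_cases (c' t)) => -> [] -> // /eqP; rewrite ?addr0 ?add0r oner_eq0.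
  have sumE : comb (fun t => c t + c' t) = comb c + comb c'.
    by rewrite /comb -big_split; apply: eq_bigr => i _; rewrite scalerDl.
  apply: (@bas_indep T x (fun t => c t + c' t) x_inj _ t).
  apply: (@Theta_inj n) => [|a b]; first exact: (comb_Fil (fun t => c t + c' t)).
  have [lt_n|] := ltnP (a + b) n; last by move=> le_n; exact: (Theta_Fil (comb_Fil (fun t => c t + c' t)) le_n).
  have [la lb] : (a < n)%N /\ (b < n)%N by lia.
  have := eq_c (exist _ (Ordinal la, Ordinal lb) lt_n); rewrite !ffunE /x /= => e.
  by rewrite -/(comb (fun t => c t + c' t)) sumE ThetaD e F2_addxx.
have [Psi _ PsiK] := injF_bij Phi_inj.
pose c0 : {ffun T -> 'F_2} := [ffun t => d (x t).1 (x t).2].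
exists (comb (Psi c0)) => // a b lt_n; have [la lb] : (a < n)%N /\ (b < n)%N by lia.
have := congr1 (fun f : {ffun T -> 'F_2} => f (exist _ (Ordinal la, Ordinal lb) lt_n)) (PsiK c0).
by rewrite !ffunE.
Qed.

(** Elements are compared through their coordinates [Theta]: those of [X (m i j)] and [m i.-1 j]
    agree, and the coefficients of v in the basis are its own coordinates. *)
Lemma adapted_basis : exists m : nat -> nat -> V,
  [/\ lam (m 0 0)%N = 1,
      forall i j, X (m i j) = if (0 < i)%N then m i.-1 j else 0,
      forall i j, Y (m i j) = if (0 < j)%N then m i j.-1 else 0
    & is_basis2 S m].
Proof.
have mex (ij : nat * nat) : exists v, Fil (ij.1 + ij.2).+1 v /\
    forall a b, Theta a b v = ((a == ij.1) && (b == ij.2))%:R.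
  have [v Fv Tv] := Theta_surj (ij.1 + ij.2).+1 (fun a b => ((a == ij.1) && (b == ij.2))%:R).
  exists v; split=> // a b; have [lt_n|le_n] := ltnP (a + b) (ij.1 + ij.2).+1; first exact: Tv.
  rewrite (Theta_Fil Fv) //; case: andP => // -[/eqP ea /eqP eb].
  by move: le_n; rewrite ea eb ltnn.
have [m0 m0P] := choice mex; pose m i j := m0 (i, j).
have mF i j : Fil (i + j).+1 (m i j) by case: (m0P (i, j)).
have mT i j a b : Theta a b (m i j) = ((a == i) && (b == j))%:R by case: (m0P (i, j)) => _; apply.
have Tsum N (c : nat -> nat -> 'F_2) a b : Theta a b (\sum_(i < N) \sum_(j < N) c i j *: m i j) =
    if (a < N)%N && (b < N)%N then c a b else 0.
  rewrite pair_big /= (Theta_sum a b (fun p : 'I_N * 'I_N => m p.1 p.2) (fun p => c p.1 p.2)).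
  case: ifP => [/andP [la lb]|no]; last first.
    rewrite big1 // => -[i j] _ /=; rewrite mT; case: andP => [[/eqP ea /eqP eb]|]; last by rewrite mulr0.
    by move: no; rewrite ea eb !ltn_ord.
  rewrite (bigD1 (Ordinal la, Ordinal lb)) //= mT !eqxx mulr1 big1 ?addr0 // => -[i j] ne /=.
  rewrite mT; case: andP => [[/eqP ea /eqP eb]|]; last by rewrite mulr0.
  by case/negP: ne; apply/eqP; congr (_, _); apply: val_inj.
exists m; split; first by have := mT 0%N 0%N 0%N 0%N.
- move=> i j; case: i => [|i] /=; first by apply: (Theta_inj (FilX (mF 0%N j))) => a b; rewrite ThetaX mT.
  apply: vadd_eq0; apply: (@Theta_inj (i.+1 + j).+1); last first.
    by move=> a b; rewrite ThetaD ThetaX !mT eqSS F2_addxx.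
  apply: FilD; last by apply: Fil_mono (mF i j); lia.
  by apply: Fil_mono (FilX (mF i.+1 j)); lia.
- move=> i j; case: j => [|j] /=; first by apply: (Theta_inj (FilY (mF i 0%N))) => a b; rewrite ThetaY mT andbF.
  apply: vadd_eq0; apply: (@Theta_inj (i + j.+1).+1); last first.
    by move=> a b; rewrite ThetaD ThetaY !mT eqSS F2_addxx.
  apply: FilD; last by apply: Fil_mono (mF i j); lia.
  by apply: Fil_mono (FilY (mF i j.+1)); lia.
split=> [i j|N c sum0 i j li lj|v /SFil [n Fv]]; first exact: FilS (mF i j).
  by have := Tsum N c i j; rewrite sum0 Theta0 li lj.
(* For v of level n the coordinates vanish when i + j >= n, so the square of side n is enough; level
   n + n + 1 contains v and all [m i j] of that square. *)
exists n, (fun i j => Theta i j v); apply: vadd_eq0; apply: (@Theta_inj (n + n).+1).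
  apply: FilD; first by apply: Fil_mono Fv; lia.
  rewrite pair_big /=; apply: (@Fil_sum _ _ (fun p : 'I_n * 'I_n => m p.1 p.2) (fun p => Theta p.1 p.2 v)).
  by case=> i j; apply: Fil_mono (mF i j); have := ltn_ord i; have := ltn_ord j; lia.
move=> a b; rewrite ThetaD (Tsum n (fun i j => Theta i j v)); case: ifP => [_|no]; first exact: F2_addxx.
by rewrite addr0; apply: Theta_Fil Fv _; lia.
Qed.

End AdaptedBasis.

(** * Stability of K, its expansion and its filtration by weight *)

Lemma U_T_comm p q (f : Ft) : (0 < q)%N -> coprime p q ->
  hecke_U p (hecke_T q f) = hecke_T q (hecke_U p f).
Proof.
move=> q0 co; rewrite !hecke_TE UD U_dil_coprime //; congr (_ + _).
by apply: fps_eqP => n /=; rewrite !mulnA (mulnC p).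
Qed.

Lemma T_comm p q (f : Ft) : (0 < p)%N -> (0 < q)%N -> coprime p q ->
  hecke_T p (hecke_T q f) = hecke_T q (hecke_T p f).
Proof.
move=> p0 q0 co; rewrite [LHS]hecke_TE U_T_comm // [in RHS](hecke_TE p) TD; congr (_ + _).
by rewrite T_dil_coprime // coprime_sym.
Qed.

Definition s_poly (f : Ft) := exists A, f = ev s A.

Lemma s_polyD f g : s_poly f -> s_poly g -> s_poly (f + g).
Proof. by move=> [A ->] [B ->]; exists (A + B); rewrite evD. Qed.

Lemma s_polyXM n f : s_poly f -> s_poly (s ^+ n * f).
Proof. by move=> [A ->]; exists ('X^n * A); rewrite (@evM _ 'X^n) evXn. Qed.

Lemma s_polysM f : s_poly f -> s_poly (s * f).
Proof. by move=> [A ->]; exists ('X * A); rewrite (@evM _ 'X) evX. Qed.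

Lemma s_polyX n : s_poly (s ^+ n).
Proof. by exists 'X^n; rewrite evXn. Qed.

Lemma s_poly0 : s_poly 0.
Proof. by exists 0; rewrite ev0. Qed.

Lemma T_s_exp2 p k : prime p -> odd p -> p != 5 -> hecke_T p (s ^+ (2 ^ k)) = 0.
Proof. by move=> pp op p5; rewrite T_exp2n ?prime_gt0 // T_s // expr0n expn_eq0. Qed.

Lemma T3_s_poly n : s_poly (hecke_T 3 (s ^+ n)).
Proof.
elim/ltn_ind: n => n IH; have [lt4|ge4] := ltnP n 4; last first.
  have -> : n = (4 + (n - 4))%N by lia.
  rewrite exprD T3_s4 -exprD -exprS.
  by do 2?[apply: s_polyD]; (apply: s_polyXM || apply: s_polysM); apply: IH; lia.
have T2 k := @T_s_exp2 3 k isT isT isT.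
move: n lt4 {IH} => [|[|[|[|//]]]] _.
- by rewrite T_1 //; exact: s_poly0.
- by rewrite (T2 0%N); exact: s_poly0.
- by rewrite (T2 1%N); exact: s_poly0.
- by rewrite T3_s3 -[s]expr1; exact: s_polyX.
Qed.

Lemma T7_s_poly n : s_poly (hecke_T 7 (s ^+ n)).
Proof.
elim/ltn_ind: n => n IH; have [lt8|ge8] := ltnP n 8; last first.
  have -> : n = (8 + (n - 8))%N by lia.
  rewrite exprD T7_s8 mulrDl -!exprD -exprS !addrA.
  by do 5?[apply: s_polyD]; (apply: s_polyXM || apply: s_polysM); apply: IH; lia.
have T2 k := @T_s_exp2 7 k isT isT isT; have [T3 T5 T7] := T7_s357.
move: n lt8 {IH} => [|[|[|[|[|[|[|[|//]]]]]]]] _.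
- by rewrite T_1 //; exact: s_poly0.
- by rewrite (T2 0%N); exact: s_poly0.
- by rewrite (T2 1%N); exact: s_poly0.
- by rewrite T3 -[s]expr1; exact: s_polyX.
- by rewrite (T2 2%N); exact: s_poly0.
- by rewrite T5; exact: s_polyX.
- by rewrite (exprM s 3 2) T_sqr // T3; exact: s_polyX.
- by rewrite T7 -[s]expr1; exact: s_polyX.
Qed.

Lemma T_s_poly p A : (p == 3)%N || (p == 7)%N -> s_poly (hecke_T p (ev s A)).
Proof.
move=> p37; rewrite (evS s (leqnn _)) (big_morph _ (TD p) (T0 _ p)).
apply: big_ind => [|x y|i _]; [exact: s_poly0|exact: s_polyD|].
case: (F2_cases A`_i) => ->; rewrite ?scale0r ?scale1r ?T0; first exact: s_poly0.
by case/orP: p37 => /eqP ->; [exact: T3_s_poly|exact: T7_s_poly].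
Qed.

Lemma K_T p f : (p == 3)%N || (p == 7)%N -> K f -> K (hecke_T p f).
Proof.
move=> p37 Kf; have [A [_ fE]] := K_poly Kf; case: (Kf) => -[_ odd_f] Uf.
have op : odd p by case/orP: p37 => /eqP ->.
have p0 : (0 < p)%N by case/orP: p37 => /eqP ->.
have co : coprime 5 p by case/orP: p37 => /eqP ->.
split; last by rewrite U_T_comm // -TD Uf T0.
split.
  rewrite fE; have [B ->] := T_s_poly A p37.
  by exists (B \Po PS) => //; rewrite -ev_def ev_comp ev_PS.
move=> n en; rewrite fcoefT odd_f ?add0r; last by rewrite oddM op.
case: ifP => // /dvdnP [k kE]; rewrite kE mulnK // odd_f //.
by move: en; rewrite kE oddM op andbT.
Qed.

Lemma KD f g : K f -> K g -> K (f + g).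
Proof.
case=> [[[p _ pE] odf] uf] [[[q _ qE] odg] ug]; split; last first.
  by rewrite UD addrACA uf ug addr0.
split; last by move=> n en; rewrite fcoefD odf // odg // addr0.
by exists (p + q) => //; rewrite -pE -qE -!ev_def evD.
Qed.

Lemma inKD A B : inK A -> inK B -> inK (A + B).
Proof. by move=> [oA uA] [oB uB]; split; [exact: oddpD|rewrite evD UD uA uB]. Qed.

Lemma K_base : exists H : nat -> {poly 'F_2}, forall n,
  [/\ inK (H n), size (H n) = ((12 * (n %/ 4) + cn n).+1)%N & pr (ev s (H n)) = vb (n %/ 4) (cn n)].
Proof. by have [H HP] := choice (fun n => vb_ex (n %/ 4) (isc_cn n)); exists H. Qed.

(** The degree is odd and by [K_size] not 5 mod 6, hence 1, 3, 7 or 9 mod 12. *)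
Lemma inK_size A : inK A -> A != 0 -> exists n, size A = ((12 * (n %/ 4) + cn n).+1)%N.
Proof.
move=> [oA UA] A0; have s6 := K_size oA UA A0.
have : lead_coef A != 0 by rewrite lead_coef_eq0.
rewrite lead_coefE => lc; have od : odd (size A).-1 by apply: contraNT lc => /oA ->.
have szA : (0 < size A)%N by rewrite size_poly_gt0.
move: (size A) szA od s6 => [//|n] _ /= on n6.
pose i := index (n %% 12)%N [:: 1; 3; 7; 9]%N; exists (4 * (n %/ 12) + i)%N.
have hm : (n %% 12 \in [:: 1; 3; 7; 9])%N.
  have : (n %% 12 < 12)%N by rewrite ltn_mod.
  have : odd (n %% 12) by lia.
  have : ((n %% 12) %% 6 != 5)%N by lia.
  by move: (n %% 12)%N; do 12?[case=> //].
have i4 : (i < 4)%N by rewrite /i -index_mem in hm *.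
have -> : ((4 * (n %/ 12) + i) %/ 4 = n %/ 12)%N by lia.
rewrite /cn; have -> : ((4 * (n %/ 12) + i) %% 4 = i)%N by lia.
by rewrite (nth_index _ hm); lia.
Qed.

Lemma base_size_mono m n : (m < n)%N -> (12 * (m %/ 4) + cn m < 12 * (n %/ 4) + cn n)%N.
Proof.
have cn9 k : (0 < cn k <= 9)%N.
  by rewrite /cn; have := ltn_mod k 4; case: (k %% 4)%N => [|[|[|[|]]]].
have := cn9 m; have := cn9 n; have [lt_d|ge_d] := ltnP (m %/ 4) (n %/ 4); first by lia.
move=> _ _ lt_mn; have e : (m %/ 4 = n %/ 4)%N by lia.
rewrite e ltn_add2l /cn; have : (m %% 4 < n %% 4)%N by lia.
have : (n %% 4 < 4)%N by rewrite ltn_mod.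
by case: (m %% 4)%N => [|[|[|[|m']]]]; case: (n %% 4)%N => [|[|[|[|n']]]].
Qed.

(** By [inK_size] the degrees of the [H n] are all those that occur in K, so leading terms can be
    cancelled one after the other. *)
Lemma K_expand (H : nat -> {poly 'F_2}) :
  (forall n, inK (H n) /\ size (H n) = ((12 * (n %/ 4) + cn n).+1)%N) ->
  forall N A, inK A -> (size A <= 12 * (N %/ 4) + cn N)%N ->
  exists c : nat -> 'F_2, A = \sum_(n < N) c n *: H n.
Proof.
move=> HP; elim=> [|N IH] A kA szA.
  exists (fun=> 0); rewrite big_ord0; apply/eqP/negPn/negP => A0.
  have [n nE] := inK_size kA A0; move: szA; rewrite nE; case: n {nE} => [|n] //.
  by have := base_size_mono (ltn0Sn n); lia.
have [A0|A0] := eqVneq A 0.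
  by exists (fun=> 0); rewrite big1 // => i _; rewrite scale0r.
have [n nE] := inK_size kA A0; have [kH szH] := HP N.
have le_nN : (n <= N)%N.
  by rewrite -ltnS ltnNge; apply/negP; rewrite leq_eqVlt => /orP [/eqP e|/base_size_mono]; [rewrite e in szA|]; lia.
have ext (c : nat -> 'F_2) x B : B = \sum_(k < N) c k *: H k ->
    exists c : nat -> 'F_2, B + x *: H N = \sum_(k < N.+1) c k *: H k.
  move=> ->; exists (fun k => if (k < N)%N then c k else x); rewrite big_ord_recr /= ltnn.
  by congr (_ + _); apply: eq_bigr => k _; rewrite ltn_ord.
move: le_nN; rewrite leq_eqVlt => /orP [/eqP e|lt_n].
  have szE : size A = size (H N) by rewrite nE szH e.
  have lt_sz := size_cancel A0 szE.
  have [c cE] := IH (A + H N) (inKD kA kH) ltac:(lia).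
  have [c' c'E] := ext c 1 _ cE; exists c'; rewrite -c'E scale1r -addrA poly_addff addr0 //.
have [c cE] := IH A kA ltac:(have := base_size_mono lt_n; lia).
by have [c' c'E] := ext c 0 _ cE; exists c'; rewrite -c'E scale0r addr0.
Qed.

Lemma pr_sum (T : finType) (c : T -> 'F_2) (f : T -> Ft) :
  pr (\sum_t c t *: f t) = \sum_t c t *: pr (f t).
Proof. by rewrite (big_morph pr prD pr0); apply: eq_bigr => t _; rewrite prZ. Qed.

(** [pr] maps the degree basis of K to the family [vb], which is independent because its orders 20 j
    + c are distinct; this yields the coordinates and the injectivity at once. *)
Lemma K_W f : K f -> (exists g1 g3 g7 g9, pr f = W g1 g3 g7 g9) /\ (pr f = 0 -> f = 0).
Proof.
move=> Kf; have [A [oA fE]] := K_poly Kf; case: Kf => _ /fadd_eq0; rewrite fE => UA.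
have [H HP] := K_base.
have HS n : inK (H n) /\ size (H n) = ((12 * (n %/ 4) + cn n).+1)%N by case: (HP n).
have szA : (size A <= 12 * ((4 * size A) %/ 4) + cn (4 * size A))%N by rewrite mulKn //; lia.
have [c cE] := K_expand HS (conj oA UA) szA.
have prE : pr (ev s A) = \sum_(n < 4 * size A) c n *: vb (n %/ 4) (cn n).
  rewrite {1}cE (big_morph (ev s) (@evD s) (ev0 s)) (big_morph pr prD pr0).
  by apply: eq_bigr => n _; rewrite evZ prZ; case: (HP n) => _ _ ->.
split; first by rewrite prE W_sum; do 4!eexists; reflexivity.
rewrite prE => /vb_indep c0; rewrite cE big1 ?ev0 // => n _.
by rewrite c0 // scale0r.
Qed.

Definition bd c n (g : {poly 'F_2}) := forall j, nz g j -> (2 * h j + wc c < n)%N.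

Lemma bdD c n g g' : bd c n g -> bd c n g' -> bd c n (g + g').
Proof. by move=> hg hg' j /nzD [/hg|/hg']. Qed.

Lemma bd_mono c n m g : (n <= m)%N -> bd c n g -> bd c m g.
Proof. by move=> le_n hg j /hg lt_n; exact: leq_trans le_n. Qed.

Lemma bd0 c g : bd c 0 g -> g = 0.
Proof. by move=> hg; apply/polyP => i; rewrite coef0; apply: nz0P => /hg. Qed.

Lemma bd_ex c g : exists n, bd c n g.
Proof.
exists (\max_(j < size g) (2 * h j + wc c)).+1 => j /nz_size lt_j.
exact: (@leq_bigmax _ (fun j : 'I_(size g) => 2 * h j + wc c)%N (Ordinal lt_j)).
Qed.

Lemma bd_L c c' (t : nat -> {poly 'F_2}) n g : (forall j i, nz (t j) i -> wt_lt c c' i j) ->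
  bd c n.+1 g -> bd c' n (L t g).
Proof.
move=> wt hg i nzi; have [j [nzj nzt]] : exists j, nz g j /\ nz (t j) i.
  apply: contrapT => no; move: nzi; rewrite /nz L_coef0 ?eqxx // => j nzj nzt.
  by apply: no; exists j.
by have := wt _ _ nzt; have := hg _ nzj; rewrite /wt_lt; lia.
Qed.

Definition Fil n (f : Ft) := K f /\ exists g1 g3 g7 g9,
  pr f = W g1 g3 g7 g9 /\ [/\ bd 1 n g1, bd 3 n g3, bd 7 n g7 & bd 9 n g9].

Lemma WD g1 g3 g7 g9 g1' g3' g7' g9' : W g1 g3 g7 g9 + W g1' g3' g7' g9' =
  W (g1 + g1') (g3 + g3') (g7 + g7') (g9 + g9').
Proof.
rewrite /W !evD; move: (ev u g1) (ev u g3) (ev u g7) (ev u g9) => x1 x2 x3 x4.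
move: (ev u g1') (ev u g3') (ev u g7') (ev u g9') => x5 x6 x7 x8.
by move: (D 1%N) (D 3%N) (D 7%N) (D 9%N) => d1 d3 d7 d9; ring2.
Qed.

Lemma FilD n f g : Fil n f -> Fil n g -> Fil n (f + g).
Proof.
move=> [Kf [f1 [f3 [f7 [f9 [fE [b1 b3 b7 b9]]]]]]] [Kg [g1 [g3 [g7 [g9 [gE [c1 c3 c7 c9]]]]]]].
split; first exact: KD.
exists (f1 + g1), (f3 + g3), (f7 + g7), (f9 + g9).
by rewrite prD fE gE WD; do ?split; try exact: bdD.
Qed.

Lemma Fil_mono n m f : (n <= m)%N -> Fil n f -> Fil m f.
Proof.
move=> le_n [Kf [f1 [f3 [f7 [f9 [fE [b1 b3 b7 b9]]]]]]]; split=> //.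
by exists f1, f3, f7, f9; do ?split=> //; exact: bd_mono le_n _.
Qed.

Lemma Fil_ex f : K f -> exists n, Fil n f.
Proof.
move=> Kf; have [[g1 [g3 [g7 [g9 gE]]]] _] := K_W Kf.
have [n1 b1] := bd_ex 1 g1; have [n3 b3] := bd_ex 3 g3.
have [n7 b7] := bd_ex 7 g7; have [n9 b9] := bd_ex 9 g9.
exists (n1 + n3 + n7 + n9)%N; split=> //; exists g1, g3, g7, g9; split=> //.
by split; [apply: bd_mono b1|apply: bd_mono b3|apply: bd_mono b7|apply: bd_mono b9]; lia.
Qed.

Lemma W0 : W 0 0 0 0 = 0.
Proof. by rewrite /W !ev0 !mul0r !addr0. Qed.

Lemma Fil0 f : Fil 0 f -> f = 0.
Proof.
move=> [Kf [g1 [g3 [g7 [g9 [gE [/bd0 e1 /bd0 e3 /bd0 e7 /bd0 e9]]]]]]].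
by apply: (proj2 (K_W Kf)); rewrite gE e1 e3 e7 e9 W0.
Qed.

Lemma Fil_T3 n f : Fil n.+1 f -> Fil n (hecke_T 3 f).
Proof.
move=> [Kf [g1 [g3 [g7 [g9 [gE [b1 b3 b7 b9]]]]]]]; split; first exact: K_T.
rewrite pr_T // gE T3_W; do 4!eexists; split; first reflexivity.
split; apply: bdD.
- by apply: bd_L b3; apply: (@s4_wt _ 3 1 0) => //; vm_compute.
- by apply: bd_L b7; apply: (@s4_wt _ 7 1 0) => //; vm_compute.
- by apply: bd_L b1; apply: (@s4_wt _ 1 3 1) => //; vm_compute.
- by apply: bd_L b9; apply: (@s4_wt _ 9 3 0) => //; vm_compute.
- by apply: bd_L b1; apply: (@s4_wt _ 1 7 1) => //; vm_compute.
- by apply: bd_L b9; apply: (@s4_wt _ 9 7 0) => //; vm_compute.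
- by apply: bd_L b3; apply: (@s4_wt _ 3 9 1) => //; vm_compute.
- by apply: bd_L b7; apply: (@s4_wt _ 7 9 1) => //; vm_compute.
Qed.

Lemma Fil_T7 n f : Fil n.+1 f -> Fil n (hecke_T 7 f).
Proof.
move=> [Kf [g1 [g3 [g7 [g9 [gE [b1 b3 b7 b9]]]]]]]; split; first exact: K_T.
rewrite pr_T // gE T7_W; do 4!eexists; split; first reflexivity.
split; apply: bdD.
- by apply: bd_L b3; apply: (@s8_wt _ 3 1 0) => //; vm_compute.
- by apply: bd_L b7; apply: (@s8_wt _ 7 1 0) => //; vm_compute.
- by apply: bd_L b1; apply: (@s8_wt _ 1 3 1) => //; vm_compute.
- by apply: bd_L b9; apply: (@s8_wt _ 9 3 0) => //; vm_compute.
- by apply: bd_L b1; apply: (@s8_wt _ 1 7 1) => //; vm_compute.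
- by apply: bd_L b9; apply: (@s8_wt _ 9 7 0) => //; vm_compute.
- by apply: bd_L b3; apply: (@s8_wt _ 3 9 1) => //; vm_compute.
- by apply: bd_L b7; apply: (@s8_wt _ 7 9 1) => //; vm_compute.
Qed.

Lemma D1_coef : fcoef (D 1%N) 1 = 1.
Proof. by rewrite D_def expr1 /= fcoef_s1. Qed.

Lemma ker_T37 f : K f -> hecke_T 3 f = 0 -> hecke_T 7 f = 0 -> fcoef f 1 = 0 -> f = 0.
Proof.
move=> Kf T3f T7f f1; have [[g1 [g3 [g7 [g9 gE]]]] inj] := K_W Kf; apply: inj.
have e3 : hecke_T 3 (pr f) = 0 by rewrite -pr_T // T3f pr0.
have e7 : hecke_T 7 (pr f) = 0 by rewrite -pr_T // T7f pr0.
rewrite gE in e3 e7; rewrite gE (ker_W e3 e7).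
have : fcoef (pr f) 1 = 0 by rewrite /= f1.
by rewrite gE (ker_W e3 e7) fcoefZ D1_coef mulr1 => ->; rewrite scale0r.
Qed.

Lemma val_indep_fin (T : finType) (f : T -> Ft) (v : T -> nat) (c : T -> 'F_2) :
  injective v -> (forall t, fval (v t) (f t)) -> \sum_t c t *: f t = 0 -> forall t, c t = 0.
Proof.
move=> v_inj vf sum0 t; apply/eqP/negPn/negP => ct.
case: (@arg_minnP T t (fun t => c t != 0) v ct) => t0 ct0 min.
have := congr1 (fun f => fcoef f (v t0)) sum0; rewrite fcoef_sum (bigD1 t0) //= big1.
  by rewrite addr0 (proj1 (vf t0)) mulr1 => c0; rewrite c0 eqxx in ct0.
move=> i ne_i; have [->|ci] := eqVneq (c i) 0; first by rewrite mul0r.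
rewrite (proj2 (vf i)) ?mulr0 // ltn_neqAle (min i ci) andbT.
by apply: contraNneq ne_i => /v_inj ->.
Qed.

(* The pair (a, b) is encoded by u^j D_c, where a / 2 and b / 2 are E j and O j, and
   the parities of a and b select c. *)
Definition code (e1 e2 : bool) : nat := if e1 then if e2 then 9 else 3 else if e2 then 7 else 1.

(** The element coded by (a, b) has weight 2 (E j + O j) + w_c = a + b, with w_c the number of odd
    entries among a and b. Its order 20 j + c determines (a, b), which gives independence. *)
Lemma Fil_basis : exists (bas : nat -> nat -> Ft) (v : nat * nat -> nat),
  [/\ injective v, forall a b, Fil (a + b).+1 (bas a b) & forall a b, fval (v (a, b)) (pr (bas a b))].
Proof.
have jex (ab : nat * nat) : exists j, E j = ab.1./2 /\ O j = ab.2./2 by exact: EO_surj.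
have [J JP] := choice jex; pose C (ab : nat * nat) := code (odd ab.1) (odd ab.2).
have iscC ab : isc (C ab) by rewrite /C; case: (odd _); case: (odd _).
have bex (ab : nat * nat) : exists f, [/\ K f & pr f = vb (J ab) (C ab)].
  by have [A [[oA UA] _ pA]] := vb_ex (J ab) (iscC ab); exists (ev s A); split=> //; exact: poly_K.
have [B BP] := choice bex; exists (fun a b => B (a, b)), (fun ab => (20 * J ab + C ab)%N).
have C20 ab : (C ab < 20)%N by rewrite /C; case: (odd _); case: (odd _).
split=> [[a b] [a' b'] e|a b|a b]; last by case: (BP (a, b)) => _ ->; exact: val_vb.
  have [eJ eC] : J (a, b) = J (a', b') /\ C (a, b) = C (a', b').
    by have := C20 (a, b); have := C20 (a', b'); lia.
  have := JP (a, b); have := JP (a', b'); rewrite eJ /= => -[-> ->] [ea eb].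
  have [oa ob] : odd a = odd a' /\ odd b = odd b'.
    by move: eC; rewrite /C /=; do 4![case: (odd _)].
  by congr (_, _); lia.
have [Kf pf] := BP (a, b); split=> //; have [Ea Ob] := JP (a, b); rewrite /= in Ea Ob.
have bX c : (2 * (a./2 + b./2) + wc c < (a + b).+1)%N -> bd c (a + b).+1 'X^(J (a, b)).
  by move=> le_n j; rewrite /nz coefXn; have [-> _|_] := eqVneq j (J (a, b)); [rewrite /h Ea Ob|rewrite eqxx].
have b0 c : bd c (a + b).+1 0 by move=> j; rewrite /nz coef0 eqxx.
rewrite pf vbE -(evXn u) /C /code /=; move: bX b0; move: (J (a, b)) => k bX b0.
have [oa|oa] := boolP (odd a); have [ob|ob] := boolP (odd b).
- exists 0, 0, 0, 'X^k; rewrite /W !ev0 !mul0r !add0r; do ?split=> //.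
  by apply: bX; rewrite /wc /=; lia.
- exists 0, 'X^k, 0, 0; rewrite /W !ev0 !mul0r !add0r !addr0; do ?split=> //.
  by apply: bX; rewrite /wc /=; lia.
- exists 0, 0, 'X^k, 0; rewrite /W !ev0 !mul0r !add0r !addr0; do ?split=> //.
  by apply: bX; rewrite /wc /=; lia.
- exists 'X^k, 0, 0, 0; rewrite /W !ev0 !mul0r !addr0; do ?split=> //.
  by apply: bX; rewrite /wc /=; lia.
Qed.

Lemma K_s : K s.
Proof. by have := @poly_K 'X; rewrite evX; apply=> [i|]; [rewrite coefX; case: eqP => // ->|rewrite -[s]expr1 U5_sX dU1 addr0]. Qed.

Theorem theorem5p7 :
  exists m : nat -> nat -> fps 'F_2,
    [/\ m 0%N 0%N = r ^+ 2 + r /\ r ^+ 2 + r = F + G,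
        forall i j, hecke_T 3 (m i j) = if (0 < i)%N then m i.-1 j else 0,
        forall i j, hecke_T 7 (m i j) = if (0 < j)%N then m i j.-1 else 0
      & is_basis2 K m].
Proof.
have [bas [v [v_inj bF bv]]] := Fil_basis.
have [|T x c x_inj sum0 t|m [m1 mX mY mB]] := @adapted_basis (fps 'F_2) K (hecke_T 3) (hecke_T 7)
    (fun f => fcoef f 1) Fil bas (TD 3) (TD 7) (fun=> fun=> erefl) _ (fun n f => @proj1 _ _)
    Fil_ex FilD Fil_mono Fil0 Fil_T3 Fil_T7 ker_T37 bF.
- by move=> f; exact: T_comm.
- apply: (@val_indep_fin T (fun t => pr (bas (x t).1 (x t).2)) (v \o x) c) => [|k|].
  + exact: inj_comp.
  + by have := bv (x k).1 (x k).2; rewrite -surjective_pairing.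
  + apply: (etrans (esym (pr_sum c (fun t => bas (x t).1 (x t).2)))).
    exact: (etrans (congr1 pr sum0) pr0).
exists m; split=> //; split; last by rewrite r_eq s_def.
(* [m 0 0] and s both lie in K, are killed by T3 and T7 and have coefficient 1 at x, so their sum
   vanishes. *)
rewrite r_eq; apply: fadd_eq0; apply: ker_T37.
- by apply: KD K_s; case: mB => mK _ _; exact: mK.
- by rewrite TD mX T_s // addr0.
- by rewrite TD mY T_s // addr0.
- by rewrite fcoefD m1 fcoef_s1 F2_addxx.
Qed.
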